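(* Let $b>0$, let $q:[0,b]\to\mathbb{C}$ be continuous, let $f$ be a non-vanishing solution of $f''-qf=0$ on $[0,b]$ with $f(0)=1$, $h:=f'(0)$, let $K$, $\beta_j$ be as defined in the context, and let $K_N(x,t):=\sum_{j=0}^{N}\frac{\beta_j(x)}{x}P_j\!\left(\frac tx\right)$. Let $x\in(0,b]$ be fixed. Suppose that there exist an integer $p\ge2$ and constants $c$ and $\varepsilon>0$ such that for all $N>p+1$ and all $t$ with $|t|\le x$, $$\bigl|K(x,t)-K_N(x,t)\bigr|\le\frac{c}{N^{p+\varepsilon}} .$$ Then $q\in C^{([p/2]-1)}[0,x]\cap C^{(p-1)}(0,x)$, where $[a]$ denotes the largest integer less than or equal to $a$.
   Context: $P_n$ denotes the Legendre polynomial of degree $n$. Transmutation kernel: $K$ is the (unique continuous) function on $\{(x,t):0\le x\le b,\ |t|\le x\}$ satisfying $$K(x,t)=\frac h2+\frac12\int_0^{\frac{x+t}{2}}q(s)\,ds+\int_0^{\frac{x+t}{2}}\int_0^{\frac{x-t}{2}}q(\alpha+\beta)K(\alpha+\beta,\alpha-\beta)\,d\beta\,d\alpha .$$ It is the $C^1$ kernel of the transmutation operator $Tu(x)=u(x)+\int_{-x}^{x}K(x,t)u(t)\,dt$, which satisfies $\left(-\frac{d^2}{dx^2}+q\right)T[u]=T[-u'']$ for $u\in C^2$ and $T[1]=f$. Formal powers: $X^{(0)}\equiv\widetilde X^{(0)}\equiv1$ and, for $n\ge1$, $$X^{(n)}(x)=n\int_0^xX^{(n-1)}(s)\,(f^2(s))^{(-1)^n}ds,\qquad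 \widetilde X^{(n)}(x)=n\int_0^x\widetilde X^{(n-1)}(s)\,(f^2(s))^{(-1)^{n-1}}ds;$$ $\varphi_k=fX^{(k)}$ for odd $k$ and $\varphi_k=f\widetilde X^{(k)}$ for even $k$. Coefficients: let $p_{j,k}:=\int_{-1}^1P_j(y)y^k\,dy$. For $x\in(0,b]$ define recursively $$\beta_0(x)=\frac{f(x)-1}{2},\qquad \beta_1(x)=\frac32\left(\frac{\varphi_1(x)}{x}-1\right),$$ and for $k\ge2$ $$\beta_k(x)=\frac1{p_{k,k}}\Bigl(\frac{\varphi_k(x)}{x^k}-1-\sum_{j}p_{j,k}\beta_j(x)\Bigr),$$ where the sum runs over all $j$ with $0\le j\le k-2$ having the same parity as $k$. *)

(* Defs.v *)
From Stdlib Require Export Reals Lra Lia Arith.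
From Coquelicot Require Export Coquelicot.

Open Scope R_scope.

Definition CRInt (g : R -> C) (a b : R) : C :=
  @RInt C_R_CompleteNormedModule g a b.

(** This is Coquelicot's [is_derive] with [locally x] replaced by
    [within D (locally x)]: values of [g] outside [D] are irrelevant, and the
    derivative is one-sided at the endpoints of an interval [D]. *)
Definition is_derive_on (D : R -> Prop) (g : R -> C) (x : R) (l : C) : Prop :=
  @filterdiff R_AbsRing R_NormedModule C_R_NormedModule
    g (within D (locally x)) (fun y : R => @scal R_AbsRing C_R_ModuleSpace y l).

Definition C_class (n : nat) (D : R -> Prop) (g : R -> C) : Prop :=
  exists d : nat -> R -> C,
    (forall y, D y -> d 0%nat y = g y) /\
    (forall j y, (j < n)%nat -> D y -> is_derive_on D (d j) y (d (S j) y)) /\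
    continuous_on D (d n).

Definition cc_interval (a b y : R) : Prop := a <= y <= b.
Definition oo_interval (a b y : R) : Prop := a < y < b.

(** Bonnet's recursion
    [(n + 2) P_(n+2)(y) = (2 n + 3) y P_(n+1)(y) - (n + 1) P_n(y)]. *)
Fixpoint legendre (n : nat) (y : R) : R :=
  match n with
  | O => 1
  | S n1 =>
      match n1 with
      | O => y
      | S n2 =>
          ((2 * INR n2 + 3) * y * legendre n1 y
           - (INR n2 + 1) * legendre n2 y) / (INR n2 + 2)
      end
  end.

Definition legendre_moment (j k : nat) : R :=
  RInt (fun y => legendre j y * y ^ k) (-1) 1.

Definition goursat_domain (b : R) (z : R * R) : Prop :=
  0 <= fst z <= b /\ Rabs (snd z) <= fst z.

Definition transmutation_kernel
    (b : R) (q : R -> C) (h : C) (K : R -> R -> C) : Prop :=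
  continuous_on (goursat_domain b) (fun z : R * R => K (fst z) (snd z)) /\
  forall x t : R, goursat_domain b (x, t) ->
    K x t =
      (h / 2 + / 2 * CRInt q 0 ((x + t) / 2)
       + CRInt (fun al =>
           CRInt (fun be => (q (al + be)%R * K (al + be)%R (al - be)%R)%C)
             0 ((x - t) / 2))
           0 ((x + t) / 2))%C.

(** [signed_square n z] is [(z^2)^((-1)^n)]. *)
Definition signed_square (n : nat) (z : C) : C :=
  if Nat.even n then (z ^ 2)%C else (/ (z ^ 2))%C.

Fixpoint formal_X (f : R -> C) (n : nat) (x : R) : C :=
  match n with
  | O => RtoC 1
  | S m => (INR n * CRInt (fun s => formal_X f m s * signed_square n (f s)) 0 x)%C
  end.

Fixpoint formal_Xtilde (f : R -> C) (n : nat) (x : R) : C :=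
  match n with
  | O => RtoC 1
  | S m =>
      (INR n * CRInt (fun s => formal_Xtilde f m s * signed_square m (f s)) 0 x)%C
  end.

Definition formal_power (f : R -> C) (k : nat) (x : R) : C :=
  (f x * (if Nat.odd k then formal_X f k x else formal_Xtilde f k x))%C.

Definition beta_step (f : R -> C) (x : R) (prev : nat -> C) (k : nat) : C :=
  match k with
  | O => ((f x - 1) / 2)%C
  | S O => (3 / 2 * (formal_power f 1 x / x - 1))%C
  | S (S k2) =>
      (/ legendre_moment k k *
       (formal_power f k x / (x ^ k)%R - 1
        - sum_n (fun j => if Bool.eqb (Nat.even j) (Nat.even k)
                          then legendre_moment j k * prev j else RtoC 0) k2))%C
  end.

(** Course-of-values recursion: [beta_table f x n] holds the coefficients of
    index [< n]; see [beta_ge2] for the resulting recurrence. *)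
Fixpoint beta_table (f : R -> C) (x : R) (n : nat) : nat -> C :=
  match n with
  | O => fun _ => RtoC 0
  | S m => fun k =>
      if Nat.eqb k m then beta_step f x (beta_table f x m) m
      else beta_table f x m k
  end.

Definition beta (f : R -> C) (k : nat) (x : R) : C := beta_table f x (S k) k.

Definition kernel_partial_sum (f : R -> C) (N : nat) (x t : R) : C :=
  sum_n (fun j => (beta f j x / x * legendre j (t / x)%R)%C) N.

Lemma beta_tableE f x n k : (k < n)%nat -> beta_table f x n k = beta f k x.
Proof.
  induction n as [|n IH]; intros Hk; [lia|].
  destruct (Nat.eq_dec k n) as [->|Hne]; [reflexivity|].
  simpl. rewrite (proj2 (Nat.eqb_neq k n) Hne). apply IH. lia.
Qed.

Lemma beta_0 f x : beta f 0 x = ((f x - 1) / 2)%C.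
Proof. reflexivity. Qed.

Lemma beta_1 f x : beta f 1 x = (3 / 2 * (formal_power f 1 x / x - 1))%C.
Proof. reflexivity. Qed.

Lemma beta_ge2 f x k : (2 <= k)%nat ->
  beta f k x =
  (/ legendre_moment k k *
   (formal_power f k x / (x ^ k)%R - 1
    - sum_n (fun j => if Bool.eqb (Nat.even j) (Nat.even k)
                      then legendre_moment j k * beta f j x else RtoC 0) (k - 2)))%C.
Proof.
  destruct k as [|[|k]]; intros Hk; try lia.
  replace (S (S k) - 2)%nat with k by lia.
  transitivity (beta_step f x (beta_table f x (S (S k))) (S (S k))).
  - unfold beta.
    change (beta_table f x (S (S (S k)))) with
      (fun i => if Nat.eqb i (S (S k))
                then beta_step f x (beta_table f x (S (S k))) (S (S k))
                else beta_table f x (S (S k)) i).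
    cbv beta. now rewrite Nat.eqb_refl.
  - unfold beta_step. do 2 f_equal.
    apply sum_n_ext_loc. intros j Hj.
    rewrite beta_tableE by lia. reflexivity.
Qed.

(* Main.v *)
Require Import Defs.
From Stdlib Require Import Reals Lra Lia ZArith Classical ClassicalEpsilon.
From Coquelicot Require Import Coquelicot.
Open Scope R_scope.

(** The hypothesis makes [K x] the uniform limit, at the rate [N ^ - (p + eps)],
    of polynomials of degree [N] in [t].  So [K x] has as many derivatives as
    inverse approximation theorems give, and the problem is to transfer them to
    [q].

    _Smoothness of the section [K x]_ ([inverse_approximation]).  Consecutive
    polynomials of dyadic degree [N] differ by [O (N ^ - (p + eps))].
    Bernstein's inequality costs a factor [N] for each derivative inside the
    interval, Markov's inequality a factor [N ^ 2] up to its ends.  Hence the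
    derivatives converge geometrically up to order [p] inside and [p / 2] up to
    the ends, and [K x] has that regularity.  Bernstein's inequality comes from
    writing the derivative of a trigonometric polynomial of degree [n] as its
    mean against [2 * sin (n t)] times Fejer's kernel, which is nonnegative;
    Markov's follows by looking at a point where the derivative is maximal.

    _The Goursat problem_ ([kernel_goursat]).  In the coordinates
    [u = (x + t) / 2], [v = (x - t) / 2], the function [H u v = K (u + v) (u - v)]
    satisfies [H_u = q u / 2 + A] and [H_v = B], where [A] is the vertical
    integral of [q (u + s) * H u s] and [B] the corresponding horizontal one.
    Along the hypotenuse [u + v = x], the function [H] is the section [K x], and
    differentiating it along [(1, -1)] yields
    [q u / 2 = (d/du) H u (x - u) - A + B] ([q_from_hypotenuse]).

    _The gain of one derivative_ ([volt_gain]).  The identity can be bootstrapped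
    because, if [q] is [m] times differentiable, then [A] and [B] are [m + 1]
    times differentiable along the hypotenuse: on a line of direction [(1, -1)]
    the value of [u + v] is fixed, and there
    [A = integral of q r * H u (r - u) for r from u to u + v], where [u] no
    longer occurs in the argument of [q].  The derivative is the boundary term
    [- q u * H u 0] plus the same kind of integral with the derivative of [H]
    along [(1, -1)] in place of [H], so it is [m] times differentiable.

    Starting from continuity and gaining one order at a time, [q] reaches one
    order less than the section.  On the closed interval this works on the
    closed triangle at once ([q_regular_closed]).  On the open interval the
    derivatives of [q] may blow up at [0] and [x]; the argument first runs in
    the open triangle, and is then carried to the hypotenuse by cutting the
    integrals slightly inside it ([volt_edge], [q_regular_open]). *)

(** * The complex plane and its topology *)

Lemma norm_C_R (z : C) : @norm R_AbsRing C_R_NormedModule z = Cmod z.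
Proof.
  destruct z as [a b].
  unfold norm, Cmod; simpl. unfold prod_norm; simpl. unfold norm; simpl. unfold abs; simpl.
  f_equal. unfold Rabs; repeat destruct Rcase_abs; ring.
Qed.

Lemma Rabs_fst_le (z : C) : Rabs (fst z) <= Cmod z.
Proof. eapply Rle_trans; [apply Rmax_l|apply Rmax_Cmod]. Qed.

Lemma Rabs_snd_le (z : C) : Rabs (snd z) <= Cmod z.
Proof. eapply Rle_trans; [apply Rmax_r|apply Rmax_Cmod]. Qed.

Lemma Cmod_le_parts (z : C) : Cmod z <= Rabs (fst z) + Rabs (snd z).
Proof.
  destruct z as [a b]. unfold Cmod; simpl.
  apply Rsqr_incr_0_var.
  - rewrite Rsqr_sqrt by nra. unfold Rsqr, Rabs. repeat destruct Rcase_abs; nra.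
  - generalize (Rabs_pos a) (Rabs_pos b); lra.
Qed.

Lemma Cmod_sub_sym (a b : C) : Cmod (a - b) = Cmod (b - a).
Proof. rewrite <- Cmod_opp. f_equal. ring. Qed.

Lemma Cmod_sub_le (a b : C) : Cmod a <= Cmod (a - b) + Cmod b.
Proof. replace a with ((a - b) + b)%C at 1 by ring. apply Cmod_triangle. Qed.

Lemma Cmod_sub_trans (a b c : C) : Cmod (a - c) <= Cmod (a - b) + Cmod (b - c).
Proof. replace (a - c)%C with ((a - b) + (b - c))%C by ring. apply Cmod_triangle. Qed.

Lemma Rle_div_mult (a b c : R) : 0 < c -> a <= b / c -> a * c <= b.
Proof.
  intros Hc H. replace b with (b / c * c) by (field; lra).
  apply Rmult_le_compat_r; lra.
Qed.

Lemma ball_C_of_Cmod (l z : C) (e : R) : Cmod (z - l) < e -> ball l e z.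
Proof.
  intros H. split; unfold ball; simpl; unfold AbsRing_ball, abs, minus, plus, opp; simpl.
  - eapply Rle_lt_trans; [|exact H]. apply (Rabs_fst_le (z - l)%C).
  - eapply Rle_lt_trans; [|exact H]. apply (Rabs_snd_le (z - l)%C).
Qed.

Lemma Cmod_of_ball_C (l z : C) (e : R) : ball l e z -> Cmod (z - l) < 2 * e.
Proof.
  intros [H1 H2]. eapply Rle_lt_trans; [apply Cmod_le_parts|].
  unfold ball in H1, H2; simpl in H1, H2.
  unfold AbsRing_ball, abs, minus, plus, opp in H1, H2; simpl in H1, H2.
  simpl. lra.
Qed.

Lemma filterlim_C_eps {T} (F : (T -> Prop) -> Prop) (FF : Filter F) (f : T -> C) (l : C) :
  filterlim f F (locally l) <-> (forall e, 0 < e -> F (fun y => Cmod (f y - l) < e)).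
Proof.
  split.
  - intros H e He. apply (H (fun z => Cmod (z - l) < e)).
    assert (He2 : 0 < e / 2) by lra.
    exists (mkposreal _ He2). simpl. intros z Hz.
    replace e with (2 * (e / 2)) by field. now apply Cmod_of_ball_C.
  - intros H P [e He]. unfold filtermap.
    apply filter_imp with (2 := H e (cond_pos e)).
    intros y Hy. apply He. now apply ball_C_of_Cmod.
Qed.

Lemma continuous_on_eps (D : R -> Prop) (g : R -> C) :
  continuous_on D g <->
  (forall y, D y -> forall e, 0 < e -> exists d, 0 < d /\
     forall z, D z -> Rabs (z - y) < d -> Cmod (g z - g y) < e).
Proof.
  split.
  - intros H y Hy e He. specialize (H y Hy).
    apply (filterlim_C_eps _ _) with (e := e) in H; [|lra].
    destruct H as [d Hd]. exists d. split; [apply cond_pos|].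
    intros z Hz Hzy. now apply Hd.
  - intros H y Hy. apply (filterlim_C_eps _ _). intros e He.
    destruct (H y Hy e He) as [d [Hd HH]].
    exists (mkposreal d Hd). intros z Hz Hz'. apply HH; auto.
Qed.

Definition cont2 (S : R -> R -> Prop) (F : R -> R -> C) : Prop :=
  forall u v, S u v -> forall e, 0 < e -> exists d, 0 < d /\
    forall u' v', S u' v' -> Rabs (u' - u) < d -> Rabs (v' - v) < d ->
      Cmod (F u' v' - F u v) < e.

(** Only displacements that stay in [S] count, so that boundary points get
    one-sided derivatives and values outside [S] never matter. *)
Definition ddir (e1 e2 : R) (S : R -> R -> Prop) (F : R -> R -> C) (u v : R) (l : C) : Prop :=
  forall e, 0 < e -> exists d, 0 < d /\
    forall t, Rabs t < d -> S (u + t * e1) (v + t * e2) ->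
      Cmod (F (u + t * e1) (v + t * e2) - F u v - t * l) <= e * Rabs t.

(** Derivatives are asserted to exist one after the other rather than given as a
    sequence: at corners, where a line may meet [S] in one point, they are not
    unique. *)
Fixpoint Cdir (e1 e2 : R) (n : nat) (S : R -> R -> Prop) (F : R -> R -> C) : Prop :=
  cont2 S F /\
  match n with
  | O => True
  | Datatypes.S m =>
      exists F', (forall u v, S u v -> ddir e1 e2 S F u v (F' u v)) /\ Cdir e1 e2 m S F'
  end.

Lemma Cdir_cont e1 e2 n S F : Cdir e1 e2 n S F -> cont2 S F.
Proof. destruct n; intros H; apply H. Qed.

Lemma cont2_const S c : cont2 S (fun _ _ => c).
Proof.
  intros u v _ e He. exists 1. split; [lra|]. intros.
  replace (c - c)%C with (RtoC 0) by ring. rewrite Cmod_0. lra.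
Qed.

Lemma cont2_plus S F G : cont2 S F -> cont2 S G -> cont2 S (fun u v => F u v + G u v)%C.
Proof.
  intros HF HG u v Huv e He.
  destruct (HF u v Huv (e / 2)) as [d1 [Hd1 H1]]; [lra|].
  destruct (HG u v Huv (e / 2)) as [d2 [Hd2 H2]]; [lra|].
  exists (Rmin d1 d2). split; [apply Rmin_glb_lt; lra|].
  intros u' v' HS Hu Hv.
  pose proof (Rmin_l d1 d2). pose proof (Rmin_r d1 d2).
  specialize (H1 u' v' HS ltac:(lra) ltac:(lra)).
  specialize (H2 u' v' HS ltac:(lra) ltac:(lra)).
  replace (F u' v' + G u' v' - (F u v + G u v))%C
    with ((F u' v' - F u v) + (G u' v' - G u v))%C by ring.
  eapply Rle_lt_trans; [apply Cmod_triangle|]. lra.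
Qed.

Lemma cont2_mult S F G : cont2 S F -> cont2 S G -> cont2 S (fun u v => F u v * G u v)%C.
Proof.
  intros HF HG u v Huv e He.
  set (a := Cmod (F u v)). set (b := Cmod (G u v)).
  assert (Ha : 0 <= a) by apply Cmod_ge_0. assert (Hb : 0 <= b) by apply Cmod_ge_0.
  set (e1 := Rmin 1 (e / (2 * (a + b + 1)))).
  assert (He1 : 0 < e1).
  { apply Rmin_glb_lt; [lra|]. apply Rdiv_lt_0_compat; lra. }
  destruct (HF u v Huv e1 He1) as [d1 [Hd1 H1]].
  destruct (HG u v Huv e1 He1) as [d2 [Hd2 H2]].
  exists (Rmin d1 d2). split; [apply Rmin_glb_lt; lra|].
  intros u' v' HS Hu Hv.
  pose proof (Rmin_l d1 d2). pose proof (Rmin_r d1 d2).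
  specialize (H1 u' v' HS ltac:(lra) ltac:(lra)).
  specialize (H2 u' v' HS ltac:(lra) ltac:(lra)).
  replace (F u' v' * G u' v' - F u v * G u v)%C
    with ((F u' v' - F u v) * (G u' v' - G u v) + (F u v * (G u' v' - G u v)
           + (F u' v' - F u v) * G u v))%C by ring.
  eapply Rle_lt_trans; [apply Cmod_triangle|].
  eapply Rle_lt_trans; [apply Rplus_le_compat_l, Cmod_triangle|].
  rewrite !Cmod_mult. fold a b.
  pose proof (Cmod_ge_0 (F u' v' - F u v)). pose proof (Cmod_ge_0 (G u' v' - G u v)).
  assert (K1 : e1 <= 1) by apply Rmin_l.
  assert (K2 : e1 * (2 * (a + b + 1)) <= e).
  { apply Rle_div_mult; [lra|apply Rmin_r]. }
  nra.
Qed.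

Lemma cont2_ext S F G : (forall u v, S u v -> F u v = G u v) -> cont2 S F -> cont2 S G.
Proof.
  intros E HF u v Huv e He. destruct (HF u v Huv e He) as [d [Hd H]].
  exists d. split; [easy|]. intros u' v' HS Hu Hv. rewrite <- !E by easy. auto.
Qed.

Lemma ddir_plus e1 e2 S F G u v l m :
  ddir e1 e2 S F u v l -> ddir e1 e2 S G u v m ->
  ddir e1 e2 S (fun u v => F u v + G u v)%C u v (l + m)%C.
Proof.
  intros HF HG e He.
  destruct (HF (e / 2)) as [d1 [Hd1 H1]]; [lra|].
  destruct (HG (e / 2)) as [d2 [Hd2 H2]]; [lra|].
  exists (Rmin d1 d2). split; [apply Rmin_glb_lt; lra|].
  intros t Ht HS. pose proof (Rmin_l d1 d2). pose proof (Rmin_r d1 d2).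
  specialize (H1 t ltac:(lra) HS). specialize (H2 t ltac:(lra) HS).
  set (f := F (u + t * e1) (v + t * e2)) in *. set (g := G (u + t * e1) (v + t * e2)) in *.
  match goal with |- Cmod ?X <= _ => replace X with
    ((f - F u v - t * l) + (g - G u v - t * m))%C by ring end.
  eapply Rle_trans; [apply Cmod_triangle|]. lra.
Qed.

Lemma ddir_eq e1 e2 S F u v l m : l = m -> ddir e1 e2 S F u v l -> ddir e1 e2 S F u v m.
Proof. now intros ->. Qed.

Lemma ddir_const e1 e2 S c u v : ddir e1 e2 S (fun _ _ => c) u v (RtoC 0).
Proof.
  intros e He. exists 1. split; [lra|]. intros t _ _.
  replace (c - c - t * 0)%C with (RtoC 0) by ring. rewrite Cmod_0.
  generalize (Rabs_pos t); nra.
Qed.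

(** A derivative within a set forces a Lipschitz bound at the base point, which
    controls the quadratic remainder. *)
Lemma ddir_mult e1 e2 S F G u v l m :
  ddir e1 e2 S F u v l -> ddir e1 e2 S G u v m ->
  ddir e1 e2 S (fun u v => F u v * G u v)%C u v (l * G u v + F u v * m)%C.
Proof.
  intros HF HG e He.
  set (a := Cmod (F u v)). set (b := Cmod (G u v)).
  set (p := Cmod l). set (q := Cmod m).
  assert (Ha : 0 <= a) by apply Cmod_ge_0. assert (Hb : 0 <= b) by apply Cmod_ge_0.
  assert (Hp : 0 <= p) by apply Cmod_ge_0. assert (Hq : 0 <= q) by apply Cmod_ge_0.
  set (e0 := Rmin 1 (e / (2 * (a + b + 1)))).
  assert (He0 : 0 < e0).
  { apply Rmin_glb_lt; [lra|]. apply Rdiv_lt_0_compat; lra. }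
  assert (K1 : e0 <= 1) by apply Rmin_l.
  assert (K2 : e0 * (2 * (a + b + 1)) <= e).
  { apply Rle_div_mult; [lra|apply Rmin_r]. }
  destruct (HF e0 He0) as [d1 [Hd1 H1]].
  destruct (HG e0 He0) as [d2 [Hd2 H2]].
  set (d3 := e / (2 * ((1 + p) * (1 + q)))).
  assert (Hpq : 0 < (1 + p) * (1 + q)) by nra.
  assert (Hd3 : 0 < d3) by (apply Rdiv_lt_0_compat; lra).
  exists (Rmin d3 (Rmin d1 d2)). split; [repeat apply Rmin_glb_lt; lra|].
  intros t Ht HS.
  pose proof (Rmin_l d3 (Rmin d1 d2)). pose proof (Rmin_r d3 (Rmin d1 d2)).
  pose proof (Rmin_l d1 d2). pose proof (Rmin_r d1 d2).
  specialize (H1 t ltac:(lra) HS). specialize (H2 t ltac:(lra) HS).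
  set (f := F (u + t * e1) (v + t * e2)) in *. set (g := G (u + t * e1) (v + t * e2)) in *.
  match goal with |- Cmod ?X <= _ => replace X with
    ((f - F u v - t * l) * G u v + (F u v * (g - G u v - t * m)
     + (f - F u v) * (g - G u v)))%C by ring end.
  eapply Rle_trans; [apply Cmod_triangle|].
  eapply Rle_trans; [apply Rplus_le_compat_l, Cmod_triangle|].
  rewrite !Cmod_mult. fold a b.
  pose proof (Rabs_pos t) as Habs.
  assert (L1 : Cmod (f - F u v) <= (1 + p) * Rabs t).
  { eapply Rle_trans; [apply (Cmod_sub_le _ (t * l)%C)|]. rewrite Cmod_mult, Cmod_R. fold p. nra. }
  assert (L2 : Cmod (g - G u v) <= (1 + q) * Rabs t).
  { eapply Rle_trans; [apply (Cmod_sub_le _ (t * m)%C)|]. rewrite Cmod_mult, Cmod_R. fold q. nra. }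
  assert (L3 : Cmod (f - F u v) * Cmod (g - G u v) <= (e / 2) * Rabs t).
  { eapply Rle_trans; [apply Rmult_le_compat; try apply Cmod_ge_0; eassumption|].
    assert (T : (1 + p) * (1 + q) * Rabs t <= e / 2).
    { apply Rle_trans with ((1 + p) * (1 + q) * d3).
      - apply Rmult_le_compat_l; lra.
      - unfold d3. right. field. split; lra. }
    nra. }
  pose proof (Cmod_ge_0 (f - F u v - t * l)). pose proof (Cmod_ge_0 (g - G u v - t * m)).
  assert (Cmod (f - F u v - t * l) * b <= e0 * Rabs t * b) by (apply Rmult_le_compat_r; lra).
  assert (a * Cmod (g - G u v - t * m) <= a * (e0 * Rabs t)) by (apply Rmult_le_compat_l; lra).
  nra.
Qed.

Lemma ddir_ext e1 e2 S F G u v l :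
  S u v -> (forall u v, S u v -> F u v = G u v) -> ddir e1 e2 S F u v l -> ddir e1 e2 S G u v l.
Proof.
  intros Huv E HF e He. destruct (HF e He) as [d [Hd H]].
  exists d. split; [easy|]. intros t Ht HS. rewrite <- !E by easy. auto.
Qed.

(** Pulling back along a map that is affine in the direction of differentiation
    covers restrictions to lines, transpositions, shears and dilations alike. *)
Lemma cont2_pull (S S' : R -> R -> Prop) F (p1 p2 : R -> R -> R) L :
  0 < L ->
  (forall u v u' v', Rabs (p1 u' v' - p1 u v) <= L * (Rabs (u' - u) + Rabs (v' - v))) ->
  (forall u v u' v', Rabs (p2 u' v' - p2 u v) <= L * (Rabs (u' - u) + Rabs (v' - v))) ->
  (forall u v, S' u v -> S (p1 u v) (p2 u v)) ->
  cont2 S F -> cont2 S' (fun u v => F (p1 u v) (p2 u v)).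
Proof.
  intros HL H1 H2 HS HF u v Huv e He.
  destruct (HF _ _ (HS _ _ Huv) e He) as [d [Hd H]].
  exists (d / (2 * L)). split; [apply Rdiv_lt_0_compat; lra|].
  intros u' v' HS' Hu Hv.
  assert (X : L * (Rabs (u' - u) + Rabs (v' - v)) < d).
  { replace d with (L * (d / (2 * L) + d / (2 * L))) by (field; lra).
    apply Rmult_lt_compat_l; lra. }
  apply H; auto; eapply Rle_lt_trans; eauto.
Qed.

Lemma ddir_pull e1 e2 e1' e2' k (S S' : R -> R -> Prop) F (p1 p2 : R -> R -> R) u v l :
  (forall t, p1 (u + t * e1') (v + t * e2') = p1 u v + (k * t) * e1) ->
  (forall t, p2 (u + t * e1') (v + t * e2') = p2 u v + (k * t) * e2) ->
  (forall u v, S' u v -> S (p1 u v) (p2 u v)) ->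
  ddir e1 e2 S F (p1 u v) (p2 u v) l ->
  ddir e1' e2' S' (fun u v => F (p1 u v) (p2 u v)) u v (k * l)%C.
Proof.
  intros P1 P2 HS HF e He.
  pose proof (Rabs_pos k) as Hk.
  destruct (HF (e / (Rabs k + 1))) as [d [Hd H]]; [apply Rdiv_lt_0_compat; lra|].
  exists (d / (Rabs k + 1)). split; [apply Rdiv_lt_0_compat; lra|].
  intros t Ht HSt. apply HS in HSt. rewrite P1, P2 in *.
  assert (X : Rabs (k * t) < d).
  { rewrite Rabs_mult. apply Rle_lt_trans with ((Rabs k + 1) * Rabs t).
    - pose proof (Rabs_pos t). nra.
    - replace d with ((Rabs k + 1) * (d / (Rabs k + 1))) by (field; lra).
      apply Rmult_lt_compat_l; lra. }
  specialize (H _ X HSt).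
  replace (t * (k * l))%C with (RtoC (k * t) * l)%C by (rewrite RtoC_mult; ring).
  eapply Rle_trans; [exact H|]. rewrite Rabs_mult.
  replace (e * Rabs t) with (e / (Rabs k + 1) * ((Rabs k + 1) * Rabs t)) by (field; lra).
  apply Rmult_le_compat_l; [apply Rlt_le, Rdiv_lt_0_compat; lra|].
  pose proof (Rabs_pos t). nra.
Qed.

Lemma Cdir_const e1 e2 n S c : Cdir e1 e2 n S (fun _ _ => c).
Proof.
  revert c. induction n as [|n IH]; intros c; simpl; split; auto using cont2_const.
  exists (fun _ _ => RtoC 0). split; [|apply IH]. intros; apply ddir_const.
Qed.

Lemma Cdir_ext e1 e2 n S F G :
  (forall u v, S u v -> F u v = G u v) -> Cdir e1 e2 n S F -> Cdir e1 e2 n S G.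
Proof.
  intros E. destruct n; intros [H1 H2]; split; eauto using cont2_ext.
  destruct H2 as [F' [D HF']]. exists F'. split; [|easy].
  intros u v Huv. eapply ddir_ext; eauto.
Qed.

Lemma Cdir_plus e1 e2 n S F G :
  Cdir e1 e2 n S F -> Cdir e1 e2 n S G -> Cdir e1 e2 n S (fun u v => F u v + G u v)%C.
Proof.
  revert F G. induction n as [|n IH]; intros F G [H1 H2] [K1 K2]; split;
    auto using cont2_plus.
  destruct H2 as [F' [D HF']], K2 as [G' [E HG']].
  exists (fun u v => F' u v + G' u v)%C. split; auto using ddir_plus.
Qed.

Lemma Cdir_S e1 e2 n S F : Cdir e1 e2 (Datatypes.S n) S F -> Cdir e1 e2 n S F.
Proof.
  revert F. induction n as [|n IH]; intros F [H1 [F' [D HF']]]; split; auto.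
  exists F'. auto.
Qed.

Lemma Cdir_le e1 e2 m n S F : (m <= n)%nat -> Cdir e1 e2 n S F -> Cdir e1 e2 m S F.
Proof. induction 1; auto using Cdir_S. Qed.

Lemma Cdir_mult e1 e2 n S F G :
  Cdir e1 e2 n S F -> Cdir e1 e2 n S G -> Cdir e1 e2 n S (fun u v => F u v * G u v)%C.
Proof.
  revert F G. induction n as [|n IH]; intros F G HF HG.
  - split; auto. apply cont2_mult; [apply HF|apply HG].
  - pose proof (Cdir_S _ _ _ _ _ HF) as HF0. pose proof (Cdir_S _ _ _ _ _ HG) as HG0.
    destruct HF as [H1 [F' [D HF']]], HG as [K1 [G' [E HG']]].
    split; [now apply cont2_mult|].
    exists (fun u v => F' u v * G u v + F u v * G' u v)%C.
    split; [auto using ddir_mult|].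
    apply Cdir_plus; apply IH; auto.
Qed.

Lemma Cdir_scal e1 e2 n S F c :
  Cdir e1 e2 n S F -> Cdir e1 e2 n S (fun u v => c * F u v)%C.
Proof. intros H. apply (Cdir_mult _ _ _ _ (fun _ _ => c)); auto using Cdir_const. Qed.

Lemma Cdir_minus e1 e2 n S F G :
  Cdir e1 e2 n S F -> Cdir e1 e2 n S G -> Cdir e1 e2 n S (fun u v => F u v - G u v)%C.
Proof.
  intros HF HG.
  apply Cdir_ext with (fun u v => F u v + (- (1)) * G u v)%C; [intros; ring|].
  apply Cdir_plus; auto using Cdir_scal.
Qed.

Lemma Cdir_pull e1 e2 e1' e2' k n (S S' : R -> R -> Prop) F (p1 p2 : R -> R -> R) L :
  0 < L ->
  (forall u v u' v', Rabs (p1 u' v' - p1 u v) <= L * (Rabs (u' - u) + Rabs (v' - v))) ->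
  (forall u v u' v', Rabs (p2 u' v' - p2 u v) <= L * (Rabs (u' - u) + Rabs (v' - v))) ->
  (forall u v t, p1 (u + t * e1') (v + t * e2') = p1 u v + (k * t) * e1) ->
  (forall u v t, p2 (u + t * e1') (v + t * e2') = p2 u v + (k * t) * e2) ->
  (forall u v, S' u v -> S (p1 u v) (p2 u v)) ->
  Cdir e1 e2 n S F -> Cdir e1' e2' n S' (fun u v => F (p1 u v) (p2 u v)).
Proof.
  intros HL A1 A2 P1 P2 HS. revert F. induction n as [|n IH]; intros F [H1 H2].
  - split; auto. eapply cont2_pull; eauto.
  - split; [eapply cont2_pull; eauto|].
    destruct H2 as [F' [D HF']]. exists (fun u v => k * F' (p1 u v) (p2 u v))%C.
    split; [|apply Cdir_scal, IH, HF'].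
    intros u v Huv. eapply ddir_pull; eauto.
Qed.

Lemma Cdir_sub e1 e2 n (S S' : R -> R -> Prop) F :
  (forall u v, S' u v -> S u v) -> Cdir e1 e2 n S F -> Cdir e1 e2 n S' F.
Proof.
  intros HS HF.
  apply (Cdir_pull e1 e2 e1 e2 1 n S S' F (fun u v => u) (fun u v => v) 1); auto;
    intros; try ring; try lra; generalize (Rabs_pos (u' - u)) (Rabs_pos (v' - v)); lra.
Qed.

Lemma ddir_sub e1 e2 (S S' : R -> R -> Prop) F u v l :
  (forall u v, S' u v -> S u v) -> ddir e1 e2 S F u v l -> ddir e1 e2 S' F u v l.
Proof.
  intros HS HF e He. destruct (HF e He) as [d [Hd H]]. exists d. auto.
Qed.

Lemma cont2_sub (S S' : R -> R -> Prop) F :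
  (forall u v, S' u v -> S u v) -> cont2 S F -> cont2 S' F.
Proof.
  intros HS HF u v Huv e He. destruct (HF u v (HS _ _ Huv) e He) as [d [Hd H]].
  exists d. auto.
Qed.

(** This is how factors such as [q (u + v)] are treated along [(1, -1)]: they
    need no derivative of [q]. *)
Lemma Cdir_invariant e1 e2 n S F :
  cont2 S F -> (forall u v t, S u v -> F (u + t * e1) (v + t * e2) = F u v) -> Cdir e1 e2 n S F.
Proof.
  intros HF HI. destruct n; split; auto.
  exists (fun _ _ => RtoC 0). split; [|apply Cdir_const].
  intros u v Huv e He. exists 1. split; [lra|]. intros t _ _. rewrite HI by easy.
  replace (F u v - F u v - t * 0)%C with (RtoC 0) by ring. rewrite Cmod_0.
  generalize (Rabs_pos t); nra.
Qed.

Lemma RtoC_m1 : RtoC (-1) = (- RtoC 1)%C.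
Proof. rewrite <- RtoC_opp. f_equal. Qed.

(** * Integrals of complex functions and the mean value inequality *)

(** Composing with this retraction turns one-sided continuity on an interval
    into continuity on the line. *)
Definition clamp (a b y : R) : R := Rmax a (Rmin y b).

Lemma clamp_in a b y : a <= b -> a <= clamp a b y <= b.
Proof. intros. unfold clamp, Rmax, Rmin. repeat destruct Rle_dec; lra. Qed.

Lemma clamp_id a b y : a <= y <= b -> clamp a b y = y.
Proof. intros. unfold clamp, Rmax, Rmin. repeat destruct Rle_dec; lra. Qed.

Lemma clamp_lip a b y z : Rabs (clamp a b z - clamp a b y) <= Rabs (z - y).
Proof.
  unfold clamp, Rmax, Rmin.
  repeat destruct Rle_dec; unfold Rabs; repeat destruct Rcase_abs; lra.
Qed.

Definition segcont (g : R -> C) (a b : R) : Prop :=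
  forall y, a <= y <= b -> forall e, 0 < e -> exists d, 0 < d /\
    forall z, a <= z <= b -> Rabs (z - y) < d -> Cmod (g z - g y) < e.

Definition ex_CRInt (g : R -> C) (a b : R) : Prop := @ex_RInt C_R_NormedModule g a b.

Lemma segcont_ex g a b : a <= b -> segcont g a b -> ex_CRInt g a b.
Proof.
  intros Hab Hg.
  apply (@ex_RInt_ext C_R_NormedModule (fun y => g (clamp a b y))).
  { intros y Hy. rewrite Rmin_left, Rmax_right in Hy by lra. now rewrite clamp_id by lra. }
  apply (@ex_RInt_continuous C_R_CompleteNormedModule).
  intros z _. apply (filterlim_C_eps _ _). intros e He.
  destruct (Hg (clamp a b z) (clamp_in a b z Hab) e He) as [d [Hd H]].
  exists (mkposreal d Hd). intros y Hy. apply H; [now apply clamp_in|].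
  eapply Rle_lt_trans; [apply clamp_lip|exact Hy].
Qed.

Lemma segcont_line S F u c v :
  cont2 S F -> (forall s, c <= s <= v -> S u s) -> segcont (F u) c v.
Proof.
  intros HF HS y Hy e He. destruct (HF u y (HS y Hy) e He) as [d [Hd H]].
  exists d. split; [easy|]. intros z Hz Hzy. apply H; auto.
  replace (u - u) with 0 by ring. now rewrite Rabs_R0.
Qed.

Lemma CRInt_chasles g a b c : ex_CRInt g a b -> ex_CRInt g b c ->
  (CRInt g a b + CRInt g b c)%C = CRInt g a c.
Proof. intros H K. exact (@RInt_Chasles C_R_CompleteNormedModule g a b c H K). Qed.

Lemma CRInt_minus f g a b : ex_CRInt f a b -> ex_CRInt g a b ->
  CRInt (fun y => f y - g y)%C a b = (CRInt f a b - CRInt g a b)%C.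
Proof. intros H K. exact (@RInt_minus C_R_CompleteNormedModule f g a b H K). Qed.

Lemma ex_CRInt_minus f g a b : ex_CRInt f a b -> ex_CRInt g a b ->
  ex_CRInt (fun y => f y - g y)%C a b.
Proof. intros H K. exact (@ex_RInt_minus C_R_NormedModule f g a b H K). Qed.

Lemma scal_C_R (t : R) (z : C) : @scal R_AbsRing C_R_ModuleSpace t z = (t * z)%C.
Proof.
  destruct z. unfold Cmult, scal; simpl. unfold prod_scal, scal; simpl. unfold mult; simpl.
  f_equal; ring.
Qed.

Lemma scal_C_N (t : R) (z : C) : @scal R_AbsRing C_R_NormedModule t z = (t * z)%C.
Proof. exact (scal_C_R t z). Qed.

Lemma scal_C_CN (t : R) (z : C) : @scal R_AbsRing C_R_CompleteNormedModule t z = (t * z)%C.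
Proof. exact (scal_C_R t z). Qed.

Lemma CRInt_scal (t : R) g a b : ex_CRInt g a b ->
  CRInt (fun y => t * g y)%C a b = (t * CRInt g a b)%C.
Proof.
  intros H. rewrite <- scal_C_R.
  etransitivity; [|exact (@RInt_scal C_R_CompleteNormedModule g a b t H)].
  apply (@RInt_ext C_R_CompleteNormedModule). intros y _. symmetry. apply scal_C_R.
Qed.

Lemma ex_CRInt_scal (t : R) g a b : ex_CRInt g a b -> ex_CRInt (fun y => t * g y)%C a b.
Proof.
  intros H. apply (@ex_RInt_ext C_R_NormedModule (fun y => @scal R_AbsRing C_R_ModuleSpace t (g y))).
  - intros y _. apply scal_C_R.
  - exact (@ex_RInt_scal C_R_NormedModule g a b t H).
Qed.

Lemma CRInt_const a b c : CRInt (fun _ => c) a b = (RtoC (b - a) * c)%C.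
Proof. rewrite <- scal_C_R. apply (@RInt_const C_R_CompleteNormedModule). Qed.

Lemma ex_CRInt_const a b c : ex_CRInt (fun _ => c) a b.
Proof. apply (@ex_RInt_const C_R_NormedModule). Qed.

Lemma CRInt_point g a : CRInt g a a = RtoC 0.
Proof. apply (@RInt_point C_R_CompleteNormedModule). Qed.

Lemma CRInt_ext f g a b : a <= b -> (forall y, a <= y <= b -> f y = g y) ->
  CRInt f a b = CRInt g a b.
Proof.
  intros Hab H. apply (@RInt_ext C_R_CompleteNormedModule).
  rewrite Rmin_left, Rmax_right by lra. intros y Hy. apply H. lra.
Qed.

Lemma ex_CRInt_sub g a b c d : a <= c -> c <= d -> d <= b -> ex_CRInt g a b -> ex_CRInt g c d.
Proof.
  intros H1 H2 H3 H.
  apply (@ex_RInt_Chasles_1 C_R_CompleteNormedModule g c d b); [lra|].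
  apply (@ex_RInt_Chasles_2 C_R_CompleteNormedModule g a c b); [lra|easy].
Qed.

Lemma CRInt_bound g a b M : a <= b -> ex_CRInt g a b ->
  (forall y, a <= y <= b -> Cmod (g y) <= M) -> Cmod (CRInt g a b) <= (b - a) * M.
Proof.
  intros Hab H HM. rewrite <- norm_C_R.
  apply (@norm_RInt_le_const C_R_NormedModule g a b); auto.
  - intros y Hy. rewrite norm_C_R. auto.
  - exact (@RInt_correct C_R_CompleteNormedModule g a b H).
Qed.

Lemma mean_value_real (g g' : R -> R) p q e : p <= q ->
  (forall y, p <= y <= q -> forall r, 0 < r -> exists d, 0 < d /\
     forall z, p <= z <= q -> Rabs (z - y) < d ->
       Rabs (g z - g y - (z - y) * g' y) <= r * Rabs (z - y)) ->
  (forall y, p <= y <= q -> Rabs (g' y) <= e) ->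
  Rabs (g q - g p) <= e * (q - p).
Proof.
  intros Hpq HD He. destruct Hpq as [Hpq| ->].
  2:{ rewrite !Rminus_diag, Rabs_R0. lra. }
  destruct (MVT_gen (fun y => g (clamp p q y)) p q (fun y => g' (clamp p q y))) as [c [Hc E]].
  - intros y. rewrite Rmin_left, Rmax_right by lra. intros Hy.
    rewrite (clamp_id p q y) by lra.
    apply is_derive_Reals. intros r Hr.
    destruct (HD y ltac:(lra) (r / 2)) as [d [Hd H]]; [lra|].
    assert (Hm : 0 < Rmin d (Rmin (y - p) (q - y))) by (repeat apply Rmin_glb_lt; lra).
    exists (mkposreal _ Hm). simpl. intros t Ht0 Ht.
    pose proof (Rmin_l d (Rmin (y - p) (q - y))). pose proof (Rmin_r d (Rmin (y - p) (q - y))).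
    pose proof (Rmin_l (y - p) (q - y)). pose proof (Rmin_r (y - p) (q - y)).
    assert (Htt : - Rabs t <= t <= Rabs t) by (unfold Rabs; destruct Rcase_abs; lra).
    rewrite !clamp_id by lra.
    specialize (H (y + t) ltac:(lra)). replace (y + t - y) with t in H by ring.
    specialize (H ltac:(lra)).
    replace ((g (y + t) - g y) / t - g' y) with ((g (y + t) - g y - t * g' y) / t) by (now field).
    unfold Rdiv. rewrite Rabs_mult, Rabs_inv.
    assert (0 < Rabs t) by (now apply Rabs_pos_lt).
    apply Rle_lt_trans with (r / 2 * Rabs t * / Rabs t).
    + apply Rmult_le_compat_r; [apply Rlt_le, Rinv_0_lt_compat|]; lra.
    + rewrite Rmult_assoc, Rinv_r by lra. lra.
  - intros y _. intros r Hr. set (y0 := clamp p q y).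
    destruct (HD y0 (clamp_in p q y ltac:(lra)) 1) as [d [Hd H]]; [lra|].
    set (M := Rabs (g' y0) + 1). assert (HM : 1 <= M) by (unfold M; generalize (Rabs_pos (g' y0)); lra).
    exists (Rmin d (r / M)). split; [apply Rmin_glb_lt; [lra|apply Rdiv_lt_0_compat; lra]|].
    intros z [_ Hz]. simpl in *. unfold R_dist in *. fold y0.
    pose proof (Rmin_l d (r / M)). pose proof (Rmin_r d (r / M)).
    pose proof (clamp_lip p q y z) as L. fold y0 in L.
    specialize (H (clamp p q z) (clamp_in p q z ltac:(lra)) ltac:(lra)).
    set (w := clamp p q z) in *.
    replace (g w - g y0) with ((g w - g y0 - (w - y0) * g' y0) + (w - y0) * g' y0) by ring.
    eapply Rle_lt_trans; [apply Rabs_triang|]. rewrite Rabs_mult.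
    assert (Rabs (w - y0) * M < r).
    { replace r with (r / M * M) by (field; lra). apply Rmult_lt_compat_r; lra. }
    unfold M in *. nra.
  - rewrite Rmin_left, Rmax_right in Hc by lra.
    rewrite !clamp_id in E by lra. rewrite E, Rabs_mult, (Rabs_right (q - p)) by lra.
    apply Rmult_le_compat_r; [lra|]. auto.
Qed.

(** The factor [2] comes from treating real and imaginary parts separately. *)
Lemma mean_value_C (g g' : R -> C) p q l e : p <= q ->
  (forall y, p <= y <= q -> forall r, 0 < r -> exists d, 0 < d /\
     forall z, p <= z <= q -> Rabs (z - y) < d ->
       Cmod (g z - g y - RtoC (z - y) * g' y) <= r * Rabs (z - y)) ->
  (forall y, p <= y <= q -> Cmod (g' y - l) <= e) ->
  Cmod (g q - g p - RtoC (q - p) * l) <= 2 * e * (q - p).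
Proof.
  intros Hpq HD He.
  eapply Rle_trans; [apply Cmod_le_parts|].
  assert (H1 : Rabs (fst (g q - g p - RtoC (q - p) * l)%C) <= e * (q - p)).
  { replace (fst (g q - g p - RtoC (q - p) * l)%C)
      with ((fst (g q) - q * fst l) - (fst (g p) - p * fst l)) by (simpl; ring).
    apply (mean_value_real (fun y => fst (g y) - y * fst l) (fun y => fst (g' y) - fst l)); auto.
    - intros y Hy r Hr. destruct (HD y Hy r Hr) as [d [Hd H]].
      exists d. split; [easy|]. intros z Hz Hzy.
      eapply Rle_trans; [|exact (H z Hz Hzy)]. eapply Rle_trans; [|apply Rabs_fst_le].
      simpl. right. f_equal. ring.
    - intros y Hy. eapply Rle_trans; [|exact (He y Hy)].
      apply (Rabs_fst_le (g' y - l)%C). }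
  assert (H2 : Rabs (snd (g q - g p - RtoC (q - p) * l)%C) <= e * (q - p)).
  { replace (snd (g q - g p - RtoC (q - p) * l)%C)
      with ((snd (g q) - q * snd l) - (snd (g p) - p * snd l)) by (simpl; ring).
    apply (mean_value_real (fun y => snd (g y) - y * snd l) (fun y => snd (g' y) - snd l)); auto.
    - intros y Hy r Hr. destruct (HD y Hy r Hr) as [d [Hd H]].
      exists d. split; [easy|]. intros z Hz Hzy.
      eapply Rle_trans; [|exact (H z Hz Hzy)]. eapply Rle_trans; [|apply Rabs_snd_le].
      simpl. right. f_equal. ring.
    - intros y Hy. eapply Rle_trans; [|exact (He y Hy)].
      apply (Rabs_snd_le (g' y - l)%C). }
  lra.
Qed.

(** The derivative at [u] may be replaced by any nearby value [l], which makes
    the estimate uniform in the ordinate [s]. *)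
Lemma mean_value_dir S F F' u s t l e :
  (forall u1 u2 w, S u1 s -> S u2 s -> u1 <= w <= u2 -> S w s) ->
  (forall w, S w s -> ddir 1 0 S F w s (F' w s)) ->
  S u s -> S (u + t) s ->
  (forall w, S w s -> Rabs (w - u) <= Rabs t -> Cmod (F' w s - l) <= e) ->
  Cmod (F (u + t) s - F u s - t * l) <= 2 * e * Rabs t.
Proof.
  intros Hconv HD Hu Ht He.
  assert (D : forall p q, S p s -> S q s -> forall y, p <= y <= q -> forall r, 0 < r ->
     exists d, 0 < d /\ forall z, p <= z <= q -> Rabs (z - y) < d ->
       Cmod (F z s - F y s - RtoC (z - y) * F' y s) <= r * Rabs (z - y)).
  { intros p q Hp Hq y Hy r Hr.
    destruct (HD y (Hconv p q y Hp Hq Hy) r Hr) as [d [Hd H]].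
    exists d. split; [easy|]. intros z Hz Hzy. specialize (H (z - y) Hzy).
    rewrite Rmult_1_r, Rmult_0_r, Rplus_0_r in H.
    replace (y + (z - y)) with z in H by ring. apply H. exact (Hconv p q z Hp Hq Hz). }
  destruct (Rle_dec 0 t) as [H0|H0].
  - rewrite (Rabs_right t) by lra.
    replace (RtoC t) with (RtoC (u + t - u)) by (f_equal; ring).
    replace (2 * e * t) with (2 * e * (u + t - u)) by ring.
    apply (mean_value_C (fun y => F y s) (fun y => F' y s)); [lra|apply D; auto|].
    intros y Hy. apply He; [exact (Hconv u (u + t) y Hu Ht Hy)|]. rewrite !Rabs_right; lra.
  - rewrite (Rabs_left t) by lra.
    replace (F (u + t)%R s - F u s - t * l)%C
      with (- (F u s - F (u + t)%R s - RtoC (u - (u + t)) * l))%C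
      by (rewrite RtoC_minus, RtoC_plus; ring).
    rewrite Cmod_opp.
    replace (2 * e * - t) with (2 * e * (u - (u + t))) by ring.
    apply (mean_value_C (fun y => F y s) (fun y => F' y s)); [lra|apply D; auto|].
    intros y Hy. apply He; [exact (Hconv (u + t) u y Ht Hu Hy)|]. rewrite !Rabs_left1; lra.
Qed.

(** Continuity at the points of a compact vertical segment is uniform, by
    compactness. *)
Lemma cont2_tube S F u a b : cont2 S F -> (forall s, a <= s <= b -> S u s) ->
  forall e, 0 < e -> exists d, 0 < d /\ forall s u' s', a <= s <= b -> S u' s' ->
    Rabs (u' - u) < d -> Rabs (s' - s) < d -> Cmod (F u' s' - F u s) < e.
Proof.
  intros HF HS e He.
  assert (X : forall t, {d : R | 0 < d /\ (a <= t <= b -> forall u' s', S u' s' ->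
     Rabs (u' - u) < d -> Rabs (s' - t) < d -> Cmod (F u' s' - F u t) < e / 2)}).
  { intros t. apply constructive_indefinite_description.
    destruct (classic (a <= t <= b)) as [Ht|Ht].
    - destruct (HF u t (HS t Ht) (e / 2)) as [d [Hd H]]; [lra|]. exists d. auto.
    - exists 1. split; [lra|tauto]. }
  assert (Hpos : forall t, 0 < proj1_sig (X t) / 2).
  { intros t. destruct (X t) as [d [Hd H]]. simpl. lra. }
  destruct (compactness_value_1d a b (fun t => mkposreal _ (Hpos t))) as [d Hd].
  exists d. split; [apply cond_pos|].
  intros s u' s' Hs HS' Hu Hv. specialize (Hd s Hs). apply NNPP in Hd.
  destruct Hd as [t [Ht [H1 H2]]]. simpl in H1, H2.
  destruct (X t) as [dt [Hdt H]]. simpl in *. specialize (H Ht).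
  assert (A1 : Cmod (F u' s' - F u t) < e / 2).
  { apply H; auto; [lra|]. replace (s' - t) with ((s' - s) + (s - t)) by ring.
    eapply Rle_lt_trans; [apply Rabs_triang|]. lra. }
  assert (A2 : Cmod (F u s - F u t) < e / 2).
  { apply H; auto; [|lra]. rewrite Rminus_diag, Rabs_R0. lra. }
  eapply Rle_lt_trans; [apply (Cmod_sub_trans _ (F u t))|].
  rewrite (Cmod_sub_sym (F u t)). lra.
Qed.

Definition vertical_int (c : R) (F : R -> R -> C) (u v : R) : C := CRInt (F u) c v.

Definition below (c : R) (S S' : R -> R -> Prop) : Prop :=
  forall u v, S u v -> c <= v /\ forall s, c <= s <= v -> S' u s.

Lemma vertical_int_cont c S S' F : below c S S' -> cont2 S' F -> cont2 S (vertical_int c F).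
Proof.
  intros HB HF u v Huv e He. destruct (HB u v Huv) as [Hcv HS].
  set (M := Cmod (F u v) + 1). assert (HM : 1 <= M) by (unfold M; generalize (Cmod_ge_0 (F u v)); lra).
  set (e1 := Rmin 1 (e / (2 * (v - c + 1)))).
  assert (He1 : 0 < e1) by (apply Rmin_glb_lt; [lra|]; apply Rdiv_lt_0_compat; lra).
  assert (K1 : e1 <= 1) by apply Rmin_l.
  assert (K2 : e1 * (2 * (v - c + 1)) <= e) by (apply Rle_div_mult; [lra|apply Rmin_r]).
  destruct (cont2_tube S' F u c v HF HS e1 He1) as [d [Hd T]].
  assert (Hd2 : 0 < e / (2 * M)) by (apply Rdiv_lt_0_compat; lra).
  exists (Rmin d (e / (2 * M))). split; [apply Rmin_glb_lt; lra|].
  intros u' v' HS1 Hu Hv. destruct (HB u' v' HS1) as [Hcv' HS'].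
  pose proof (Rmin_l d (e / (2 * M))). pose proof (Rmin_r d (e / (2 * M))).
  assert (HdM : Rabs (v' - v) * M < e / 2).
  { replace (e / 2) with (e / (2 * M) * M) by (field; lra). apply Rmult_lt_compat_r; lra. }
  assert (Z : Rabs (u - u) < d) by (rewrite Rminus_diag, Rabs_R0; lra).
  pose proof (segcont_ex _ _ _ Hcv (segcont_line S' F u c v HF HS)) as E.
  pose proof (segcont_ex _ _ _ Hcv' (segcont_line S' F u' c v' HF HS')) as E'.
  set (m := Rmin v v').
  assert (Hm : c <= m /\ m <= v /\ m <= v') by (unfold m, Rmin; destruct Rle_dec; lra).
  assert (E1 : ex_CRInt (F u) c m) by (apply (ex_CRInt_sub _ c v); lra || easy).
  assert (E1' : ex_CRInt (F u') c m) by (apply (ex_CRInt_sub _ c v'); lra || easy).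
  assert (B : Cmod (CRInt (F u') c m - CRInt (F u) c m) <= (m - c) * e1).
  { rewrite <- CRInt_minus by easy. apply CRInt_bound; [lra|now apply ex_CRInt_minus|].
    intros y Hy. left. apply T; [lra|apply HS'; lra|lra|].
    rewrite Rminus_diag, Rabs_R0. lra. }
  assert (B2 : (m - c) * e1 < e / 2) by nra.
  unfold vertical_int. destruct (Rle_dec v v') as [L|L].
  - assert (m = v) by (unfold m; now rewrite Rmin_left).
    rewrite <- (CRInt_chasles (F u') c v v'); [|congruence|apply (ex_CRInt_sub _ c v'); lra || easy].
    rewrite H1 in *.
    replace (CRInt (F u') c v + CRInt (F u') v v' - CRInt (F u) c v)%C
      with ((CRInt (F u') c v - CRInt (F u) c v) + CRInt (F u') v v')%C by ring.
    eapply Rle_lt_trans; [apply Cmod_triangle|].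
    assert (Cmod (CRInt (F u') v v') <= (v' - v) * M).
    { apply CRInt_bound; [lra|apply (ex_CRInt_sub _ c v'); lra || easy|].
      intros y Hy. eapply Rle_trans; [apply (Cmod_sub_le _ (F u v))|]. unfold M.
      assert (Cmod (F u' y - F u v) < e1); [|lra].
      rewrite Rabs_right in Hv by lra.
      apply T; [lra|apply HS'; lra|lra|]. rewrite Rabs_right; lra. }
    rewrite Rabs_right in HdM by lra. lra.
  - assert (m = v') by (unfold m; rewrite Rmin_right; lra).
    rewrite <- (CRInt_chasles (F u) c v' v); [|congruence|apply (ex_CRInt_sub _ c v); lra || easy].
    rewrite H1 in *.
    replace (CRInt (F u') c v' - (CRInt (F u) c v' + CRInt (F u) v' v))%C
      with ((CRInt (F u') c v' - CRInt (F u) c v') + - CRInt (F u) v' v)%C by ring.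
    eapply Rle_lt_trans; [apply Cmod_triangle|]. rewrite Cmod_opp.
    assert (Cmod (CRInt (F u) v' v) <= (v - v') * M).
    { apply CRInt_bound; [lra|apply (ex_CRInt_sub _ c v); lra || easy|].
      intros y Hy. eapply Rle_trans; [apply (Cmod_sub_le _ (F u v))|]. unfold M.
      assert (Cmod (F u y - F u v) < e1); [|lra].
      rewrite Rabs_left in Hv by lra.
      apply T; [lra|apply HS; lra|lra|]. rewrite Rabs_left1; lra. }
    rewrite Rabs_left in HdM by lra. lra.
Qed.

(** * Leibniz' rule *)

Definition convex_u (S : R -> R -> Prop) : Prop :=
  forall s u1 u2 w, S u1 s -> S u2 s -> u1 <= w <= u2 -> S w s.

(** Leibniz' rule along the direction [(1, k)].  For [k <= 0] the shorter of
    the two vertical segments involved always stays inside the region, which is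
    what allows one-sided derivatives at the boundary. *)
Lemma leibniz c k S S' F F' u v :
  k <= 0 -> convex_u S' -> below c S S' -> S u v -> cont2 S' F -> cont2 S' F' ->
  (forall u v, S' u v -> ddir 1 0 S' F u v (F' u v)) ->
  ddir 1 k S (vertical_int c F) u v (vertical_int c F' u v + k * F u v)%C.
Proof.
  intros Hk Hconv HB Huv HF HF' HD e He. destruct (HB u v Huv) as [Hcv HS].
  set (e1 := e / (8 * (v - c + 1))).
  assert (He1 : 0 < e1) by (apply Rdiv_lt_0_compat; lra).
  assert (K1 : e1 * (8 * (v - c + 1)) <= e) by (apply Rle_div_mult; [lra|apply Rle_refl]).
  destruct (cont2_tube S' F' u c v HF' HS e1 He1) as [d1 [Hd1 T1]].
  set (e2 := e / (4 * (- k + 1))).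
  assert (He2 : 0 < e2) by (apply Rdiv_lt_0_compat; lra).
  assert (K2 : e2 * (4 * (- k + 1)) <= e) by (apply Rle_div_mult; [lra|apply Rle_refl]).
  destruct (HF u v ltac:(apply HS; lra) e2 He2) as [d2 [Hd2 T2]].
  destruct (HF' u v ltac:(apply HS; lra) 1 Rlt_0_1) as [d3 [Hd3 T3]].
  set (M := Cmod (F' u v) + 1).
  assert (HM : 1 <= M) by (unfold M; generalize (Cmod_ge_0 (F' u v)); lra).
  set (d4 := e / (4 * ((- k + 1) * M))).
  assert (HkM : 0 < (- k + 1) * M) by nra.
  assert (Hd4 : 0 < d4) by (apply Rdiv_lt_0_compat; lra).
  assert (K4 : d4 * (4 * ((- k + 1) * M)) <= e) by (apply Rle_div_mult; [lra|apply Rle_refl]).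
  set (d5 := Rmin d1 (Rmin d2 d3) / (- k + 1)).
  assert (Hd123 : 0 < Rmin d1 (Rmin d2 d3)) by (repeat apply Rmin_glb_lt; lra).
  assert (Hd5 : 0 < d5) by (apply Rdiv_lt_0_compat; lra).
  assert (K5 : d5 * (- k + 1) <= Rmin d1 (Rmin d2 d3)) by (apply Rle_div_mult; [lra|apply Rle_refl]).
  assert (K6 : d5 <= Rmin d1 (Rmin d2 d3)) by nra.
  pose proof (Rmin_l d1 (Rmin d2 d3)). pose proof (Rmin_r d1 (Rmin d2 d3)).
  pose proof (Rmin_l d2 d3). pose proof (Rmin_r d2 d3).
  exists (Rmin d4 d5). split; [apply Rmin_glb_lt; lra|].
  intros t Ht HSt. pose proof (Rmin_l d4 d5). pose proof (Rmin_r d4 d5).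
  rewrite Rmult_1_r in *.
  set (w := v + t * k) in *. destruct (HB _ _ HSt) as [Hcw HSw].
  assert (Htk : Rabs (w - v) = - k * Rabs t).
  { unfold w. replace (v + t * k - v) with (t * k) by ring.
    rewrite Rabs_mult, (Rabs_left1 k) by lra. ring. }
  assert (Habs : 0 <= Rabs t) by apply Rabs_pos.
  assert (Het : 0 <= e * Rabs t) by nra.
  assert (Hwd : Rabs (w - v) < Rmin d1 (Rmin d2 d3)) by (rewrite Htk; nra).
  assert (Hut : Rabs (u + t - u) < Rmin d1 (Rmin d2 d3)) by (replace (u + t - u) with t by ring; lra).
  assert (Zu : Rabs (u - u) = 0) by (rewrite Rminus_diag; apply Rabs_R0).
  assert (E0 : ex_CRInt (F u) c v) by (apply segcont_ex; [easy|]; eapply segcont_line; eauto).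
  assert (E0' : ex_CRInt (F' u) c v) by (apply segcont_ex; [easy|]; eapply segcont_line; eauto).
  assert (E1 : ex_CRInt (F (u + t)) c w) by (apply segcont_ex; [easy|]; eapply segcont_line; eauto).
  (* Over the part [c, m] common to both segments only the integrand varies. *)
  assert (Common : forall m, c <= m -> m <= v -> m <= w ->
    Cmod (CRInt (F (u + t)) c m - CRInt (F u) c m - t * CRInt (F' u) c m) <= e / 4 * Rabs t).
  { intros m Hm1 Hm2 Hm3.
    assert (X0 : ex_CRInt (F u) c m) by (apply (ex_CRInt_sub _ c v); lra || easy).
    assert (X0' : ex_CRInt (F' u) c m) by (apply (ex_CRInt_sub _ c v); lra || easy).
    assert (X1 : ex_CRInt (F (u + t)) c m) by (apply (ex_CRInt_sub _ c w); lra || easy).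
    rewrite <- CRInt_scal by easy. rewrite <- !CRInt_minus; auto using ex_CRInt_minus, ex_CRInt_scal.
    eapply Rle_trans; [apply CRInt_bound with (M := 2 * e1 * Rabs t); auto|].
    - auto using ex_CRInt_minus, ex_CRInt_scal.
    - intros y Hy. apply (mean_value_dir S' F F'); auto.
      + intros u1 u2 r. apply Hconv.
      + apply HS; lra.
      + apply HSw; lra.
      + intros r Hr Hru. left. apply T1; auto; [lra| |]; try lra.
        rewrite Rminus_diag, Rabs_R0. lra.
    - assert ((m - c) * (2 * e1) <= e / 4) by nra. nra. }
  unfold vertical_int. destruct (Rle_dec v w) as [L|L].
  - rewrite <- (CRInt_chasles (F (u + t)) c v w);
      [|apply (ex_CRInt_sub _ c w); lra || easy|apply (ex_CRInt_sub _ c w); lra || easy].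
    assert (E2 : ex_CRInt (F (u + t)) v w) by (apply (ex_CRInt_sub _ c w); lra || easy).
    assert (B : Cmod (CRInt (F (u + t)) v w - RtoC (w - v) * F u v) <= (w - v) * e2).
    { rewrite <- CRInt_const, <- CRInt_minus; auto using ex_CRInt_const.
      apply CRInt_bound; auto using ex_CRInt_minus, ex_CRInt_const.
      intros y Hy. left. rewrite Rabs_right in Hwd by lra. apply T2; [apply HSw; lra|lra|].
      rewrite Rabs_right; lra. }
    assert (Ew : (RtoC (w - v) = t * k)%C).
    { unfold w. rewrite <- RtoC_mult. f_equal. ring. }
    rewrite Ew in B. rewrite Rabs_right in Htk by lra.
    match goal with |- Cmod ?X <= _ => replace X with
      ((CRInt (F (u + t)%R) c v - CRInt (F u) c v - t * CRInt (F' u) c v)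
       + (CRInt (F (u + t)%R) v w - t * k * F u v))%C by ring end.
    eapply Rle_trans; [apply Cmod_triangle|].
    specialize (Common v ltac:(lra) ltac:(lra) ltac:(lra)).
    assert ((w - v) * e2 <= e / 4 * Rabs t) by (rewrite Htk; nra).
    lra.
  - rewrite <- (CRInt_chasles (F u) c w v);
      [|apply (ex_CRInt_sub _ c v); lra || easy|apply (ex_CRInt_sub _ c v); lra || easy].
    rewrite <- (CRInt_chasles (F' u) c w v);
      [|apply (ex_CRInt_sub _ c v); lra || easy|apply (ex_CRInt_sub _ c v); lra || easy].
    assert (E2 : ex_CRInt (F u) w v) by (apply (ex_CRInt_sub _ c v); lra || easy).
    assert (E2' : ex_CRInt (F' u) w v) by (apply (ex_CRInt_sub _ c v); lra || easy).
    assert (B : Cmod (CRInt (F u) w v - RtoC (v - w) * F u v) <= (v - w) * e2).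
    { rewrite <- CRInt_const, <- CRInt_minus; auto using ex_CRInt_const.
      apply CRInt_bound; [lra|auto using ex_CRInt_minus, ex_CRInt_const|].
      intros y Hy. left. rewrite Rabs_left in Hwd by lra. apply T2; [apply HS; lra|lra|].
      rewrite Rabs_left1; lra. }
    assert (B' : Cmod (CRInt (F' u) w v) <= (v - w) * M).
    { apply CRInt_bound; [lra|easy|].
      intros y Hy. eapply Rle_trans; [apply (Cmod_sub_le _ (F' u v))|]. unfold M.
      rewrite Rabs_left in Hwd by lra.
      assert (Cmod (F' u y - F' u v) < 1); [|lra].
      apply T3; [apply HS; lra|lra|]. rewrite Rabs_left1; lra. }
    assert (Ew : (RtoC (v - w) = - (t * k))%C).
    { unfold w. rewrite <- RtoC_mult, <- RtoC_opp. f_equal. ring. }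
    rewrite Ew in B. rewrite Rabs_left in Htk by lra.
    match goal with |- Cmod ?X <= _ => replace X with
      ((CRInt (F (u + t)%R) c w - CRInt (F u) c w - t * CRInt (F' u) c w)
       + (- (CRInt (F u) w v - - (t * k) * F u v) + - (t * CRInt (F' u) w v)))%C by ring end.
    eapply Rle_trans; [apply Cmod_triangle|].
    eapply Rle_trans; [apply Rplus_le_compat_l, Cmod_triangle|].
    rewrite !Cmod_opp, Cmod_mult, Cmod_R.
    specialize (Common w ltac:(lra) ltac:(lra) ltac:(lra)).
    assert (Hvw : v - w = - k * Rabs t) by lra.
    assert ((v - w) * e2 <= e / 4 * Rabs t) by (rewrite Hvw; nra).
    assert (Rabs t * Cmod (CRInt (F' u) w v) <= e / 4 * Rabs t).
    { eapply Rle_trans; [apply Rmult_le_compat_l; [easy|exact B']|].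
      rewrite Hvw. assert (- k * Rabs t * M <= e / 4); [|nra].
      apply Rle_trans with (d4 * ((- k + 1) * M)); [|lra].
      assert (Rabs t * ((- k + 1) * M) <= d4 * ((- k + 1) * M)) by (apply Rmult_le_compat_r; lra).
      nra. }
    lra.
Qed.

Lemma vertical_int_last c S S' F u v : below c S S' -> S u v -> cont2 S' F ->
  ddir 0 1 S (vertical_int c F) u v (F u v).
Proof.
  intros HB Huv HF e He. destruct (HB u v Huv) as [Hcv HS].
  destruct (HF u v ltac:(apply HS; lra) e He) as [d [Hd T]].
  exists d. split; [easy|]. intros t Ht HSt.
  rewrite Rmult_0_r, Rplus_0_r, Rmult_1_r in *. destruct (HB _ _ HSt) as [Hcw HSw].
  assert (Zu : Rabs (u - u) < d) by (rewrite Rminus_diag, Rabs_R0; lra).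
  assert (E0 : ex_CRInt (F u) c v) by (apply segcont_ex; [easy|]; eapply segcont_line; eauto).
  assert (E1 : ex_CRInt (F u) c (v + t)) by (apply segcont_ex; [easy|]; eapply segcont_line; eauto).
  unfold vertical_int. destruct (Rle_dec 0 t) as [L|L].
  - rewrite (Rabs_right t) in * by lra.
    rewrite <- (CRInt_chasles (F u) c v (v + t));
      [|easy|apply (ex_CRInt_sub _ c (v + t)); lra || easy].
    replace (CRInt (F u) c v + CRInt (F u) v (v + t) - CRInt (F u) c v - t * F u v)%C
      with (CRInt (F u) v (v + t) - RtoC (v + t - v) * F u v)%C
      by (rewrite RtoC_minus, RtoC_plus; ring).
    assert (E2 : ex_CRInt (F u) v (v + t)) by (apply (ex_CRInt_sub _ c (v + t)); lra || easy).
    rewrite <- CRInt_const, <- CRInt_minus; auto using ex_CRInt_const.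
    replace (e * t) with ((v + t - v) * e) by ring.
    apply CRInt_bound; [lra|auto using ex_CRInt_minus, ex_CRInt_const|].
    intros y Hy. left. apply T; [apply HSw; lra|lra|]. rewrite Rabs_right; lra.
  - rewrite (Rabs_left t) in * by lra.
    rewrite <- (CRInt_chasles (F u) c (v + t) v);
      [|easy|apply (ex_CRInt_sub _ c v); lra || easy].
    replace (CRInt (F u) c (v + t) - (CRInt (F u) c (v + t) + CRInt (F u) (v + t) v) - t * F u v)%C
      with (- (CRInt (F u) (v + t) v - RtoC (v - (v + t)) * F u v))%C
      by (rewrite RtoC_minus, RtoC_plus; ring).
    assert (E2 : ex_CRInt (F u) (v + t) v) by (apply (ex_CRInt_sub _ c v); lra || easy).
    rewrite Cmod_opp, <- CRInt_const, <- CRInt_minus; auto using ex_CRInt_const.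
    replace (e * - t) with ((v - (v + t)) * e) by ring.
    apply CRInt_bound; [lra|auto using ex_CRInt_minus, ex_CRInt_const|].
    intros y Hy. left. apply T; [apply HS; lra|lra|]. rewrite Rabs_left1; lra.
Qed.

Lemma vertical_int_Cdir c n S S' F : convex_u S' -> below c S S' ->
  Cdir 1 0 n S' F -> Cdir 1 0 n S (vertical_int c F).
Proof.
  intros Hc HB. revert F. induction n as [|n IH]; intros F [H1 H2].
  - split; auto. now apply (vertical_int_cont c S S').
  - split; [now apply (vertical_int_cont c S S')|].
    destruct H2 as [F' [D HF']]. exists (vertical_int c F'). split; [|auto].
    intros u v Huv. apply ddir_eq with (vertical_int c F' u v + 0 * F u v)%C; [ring|].
    apply (leibniz c 0 S S'); auto; [lra|]. eapply Cdir_cont; eauto.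
Qed.

(** * Functions preserved by vertical integration *)

Ltac lip := intros; unfold Rabs; repeat destruct Rcase_abs; lra.

Definition Creg (n : nat) (J : R -> Prop) (g : R -> C) : Prop :=
  Cdir 1 0 n (fun u _ => J u) (fun u _ => g u).

Definition interval_in (x : R) (J : R -> Prop) : Prop :=
  (forall y, J y -> 0 <= y <= x) /\ (forall y z w, J y -> J z -> y <= w <= z -> J w).

Definition tri (x u v : R) : Prop := 0 <= u /\ 0 <= v /\ u + v <= x.
(** With [J] the open interval, this keeps the points of the axis [v = 0] and
    leaves out the hypotenuse and the axis [u = 0]; [inner] leaves out the three
    sides.  With [J] closed both are the closed triangle. *)
Definition strip (J : R -> Prop) (u v : R) : Prop := J u /\ 0 <= v /\ J (u + v).
Definition inner (J : R -> Prop) (u v : R) : Prop := J u /\ J v /\ J (u + v).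
Definition transpose (F : R -> R -> C) (u v : R) : C := F v u.

Lemma Creg_pull e1 e2 k1 k2 n J S g c :
  Creg n J g -> (forall u v, S u v -> J (k1 * u + k2 * v + c)) ->
  Cdir e1 e2 n S (fun u v => g (k1 * u + k2 * v + c)).
Proof.
  intros Hg HS.
  apply (Cdir_pull 1 0 e1 e2 (k1 * e1 + k2 * e2) n (fun u _ => J u) S (fun u _ => g u)
     (fun u v => k1 * u + k2 * v + c) (fun _ _ => 0) (Rabs k1 + Rabs k2 + 1)); auto.
  - generalize (Rabs_pos k1) (Rabs_pos k2); lra.
  - intros. replace (k1 * u' + k2 * v' + c - (k1 * u + k2 * v + c))
      with (k1 * (u' - u) + k2 * (v' - v)) by ring.
    eapply Rle_trans; [apply Rabs_triang|]. rewrite !Rabs_mult.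
    generalize (Rabs_pos k1) (Rabs_pos k2) (Rabs_pos (u' - u)) (Rabs_pos (v' - v)); nra.
  - intros. rewrite Rminus_diag, Rabs_R0.
    generalize (Rabs_pos k1) (Rabs_pos k2) (Rabs_pos (u' - u)) (Rabs_pos (v' - v)); nra.
  - intros. ring.
  - intros. ring.
Qed.

Lemma Creg_const n J c : Creg n J (fun _ => c).
Proof. exact (Cdir_const 1 0 n _ c). Qed.

Lemma Creg_u e1 e2 n J S g : Creg n J g -> (forall u v, S u v -> J u) ->
  Cdir e1 e2 n S (fun u _ => g u).
Proof.
  intros Hg HS. eapply Cdir_ext; [|apply (Creg_pull e1 e2 1 0 n J S g 0 Hg)].
  - intros u v _. simpl. f_equal. ring.
  - intros u v H. replace (1 * u + 0 * v + 0) with u by ring. eauto.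
Qed.

Lemma Creg_v e1 e2 n J S g : Creg n J g -> (forall u v, S u v -> J v) ->
  Cdir e1 e2 n S (fun _ v => g v).
Proof.
  intros Hg HS. eapply Cdir_ext; [|apply (Creg_pull e1 e2 0 1 n J S g 0 Hg)].
  - intros u v _. simpl. f_equal. ring.
  - intros u v H. replace (0 * u + 1 * v + 0) with v by ring. eauto.
Qed.

Lemma Creg_sum e1 e2 n J S g : Creg n J g -> (forall u v, S u v -> J (u + v)) ->
  Cdir e1 e2 n S (fun u v => g (u + v)).
Proof.
  intros Hg HS. eapply Cdir_ext; [|apply (Creg_pull e1 e2 1 1 n J S g 0 Hg)].
  - intros u v _. simpl. f_equal. ring.
  - intros u v H. replace (1 * u + 1 * v + 0) with (u + v) by ring. eauto.
Qed.

Lemma Creg_line n J S F (k c : R) : Cdir 1 k n S F -> (forall u, J u -> S u (k * u + c)) ->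
  Creg n J (fun u => F u (k * u + c)).
Proof.
  intros HF HS. unfold Creg.
  apply (Cdir_pull 1 k 1 0 1 n S (fun u _ => J u) F (fun u _ => u) (fun u _ => k * u + c)
     (Rabs k + 1)); auto; intros; try ring.
  - generalize (Rabs_pos k); lra.
  - generalize (Rabs_pos k) (Rabs_pos (u' - u)) (Rabs_pos (v' - v)); nra.
  - replace (k * u' + c - (k * u + c)) with (k * (u' - u)) by ring. rewrite Rabs_mult.
    generalize (Rabs_pos k) (Rabs_pos (u' - u)) (Rabs_pos (v' - v)); nra.
Qed.

Lemma Cdir_transpose n S F : (forall u v, S u v -> S v u) -> Cdir 1 (-1) n S F -> Cdir 1 (-1) n S (transpose F).
Proof.
  intros HS HF.
  apply (Cdir_pull 1 (-1) 1 (-1) (-1) n S S F (fun _ v => v) (fun u _ => u) 1); auto;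
    intros; try ring; try lra; generalize (Rabs_pos (u' - u)) (Rabs_pos (v' - v)); lra.
Qed.

Lemma cont2_transpose S S' F : (forall u v, S' u v -> S v u) -> cont2 S F -> cont2 S' (transpose F).
Proof.
  intros HS HF. apply (cont2_pull S S' F (fun _ v => v) (fun u _ => u) 1); auto; intros;
    try lra; generalize (Rabs_pos (u' - u)) (Rabs_pos (v' - v)); lra.
Qed.

Lemma strip_convex x J : interval_in x J -> convex_u (strip J).
Proof.
  intros [H1 H2] s u1 u2 w [A1 [A2 A3]] [B1 [B2 B3]] Hw. repeat split; auto.
  - exact (H2 u1 u2 w A1 B1 Hw).
  - apply (H2 (u1 + s) (u2 + s)); auto. lra.
Qed.

Lemma strip_below x J : interval_in x J -> below 0 (strip J) (strip J).
Proof.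
  intros [H1 H2] u v [A1 [A2 A3]]. split; auto. intros s Hs. repeat split; auto; try lra.
  apply (H2 u (u + v)); auto. lra.
Qed.

Lemma inner_strip x J : interval_in x J -> forall u v, inner J u v -> strip J u v.
Proof. intros [H1 H2] u v [A1 [A2 A3]]. repeat split; auto. apply H1 in A2. lra. Qed.

Lemma strip_tri x J : interval_in x J -> forall u v, strip J u v -> tri x u v.
Proof.
  intros [H1 H2] u v [A1 [A2 A3]]. apply H1 in A1, A3. unfold tri. lra.
Qed.

Lemma inner_sym J u v : inner J u v -> inner J v u.
Proof. intros [A1 [A2 A3]]. repeat split; auto. now rewrite Rplus_comm. Qed.

Lemma tri_sym x u v : tri x u v -> tri x v u.
Proof. unfold tri. lra. Qed.

Lemma cc_interval_in x : interval_in x (cc_interval 0 x).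
Proof. unfold interval_in, cc_interval. split; intros; lra. Qed.

Lemma tri_convex x : convex_u (tri x).
Proof. unfold convex_u, tri. intros. lra. Qed.

Lemma tri_below x : below 0 (tri x) (tri x).
Proof. unfold below, tri. intros u v H. split; [lra|]. intros. lra. Qed.

(** A class stable under vertical integration from the axis [v = 0].  The
    integral involves [F] down to the axis but differentiates it there only
    horizontally; derivatives along [(1, -1)], in which the solution of the
    Goursat problem is less regular at the axis, are required away from it. *)
Fixpoint tame (J : R -> Prop) (n : nat) (F : R -> R -> C) : Prop :=
  cont2 (strip J) F /\
  match n with
  | O => True
  | Datatypes.S m =>
      (exists Fu, (forall u v, strip J u v -> ddir 1 0 (strip J) F u v (Fu u v)) /\ tame J m Fu)
      /\ (exists Fd, (forall u v, inner J u v -> ddir 1 (-1) (inner J) F u v (Fd u v))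
           /\ Cdir 1 (-1) m (inner J) Fd)
  end.

Lemma tame_cont J n F : tame J n F -> cont2 (strip J) F.
Proof. destruct n; intros H; apply H. Qed.

Lemma tame_S J n F : tame J (S n) F -> tame J n F.
Proof.
  revert F. induction n as [|n IH]; intros F [H [[Fu [D1 HFu]] [Fd [D2 HFd]]]]; split; auto.
  split; [exists Fu|exists Fd]; split; auto. now apply Cdir_S.
Qed.

Lemma tame_horizontal J n F : tame J n F -> Cdir 1 0 n (strip J) F.
Proof.
  revert F. induction n as [|n IH]; intros F; [intros [H _]; now split|].
  intros [H [[Fu [D1 HFu]] _]]. split; auto. exists Fu. auto.
Qed.

Lemma tame_inner x J n F : interval_in x J -> tame J n F -> Cdir 1 (-1) n (inner J) F.
Proof.
  intros HJ HF. pose proof (tame_cont _ _ _ HF) as Hc.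
  apply (cont2_sub _ (inner J)) in Hc; [|eauto using inner_strip].
  destruct n; split; auto. apply HF.
Qed.

Lemma tame_intro J n F Fu : cont2 (strip J) F ->
  (forall u v, strip J u v -> ddir 1 0 (strip J) F u v (Fu u v)) -> tame J n Fu ->
  Cdir 1 (-1) (S n) (inner J) F -> tame J (S n) F.
Proof.
  intros H D HFu [_ HD]. split; [easy|]. split; [|easy]. exists Fu. auto.
Qed.

Lemma tame_ext J n F G : (forall u v, F u v = G u v) -> tame J n F -> tame J n G.
Proof.
  intros E. revert F G E. destruct n; intros F G E.
  - intros [H _]. split; auto. eapply cont2_ext; eauto.
  - intros [H [[Fu [D1 HFu]] [Fd [D2 HFd]]]]. split; [eapply cont2_ext; eauto|].
    split; [exists Fu|exists Fd]; split; auto; intros; eapply ddir_ext; eauto.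
Qed.

Lemma tame_plus J n F G : tame J n F -> tame J n G -> tame J n (fun u v => F u v + G u v)%C.
Proof.
  revert F G. induction n as [|n IH]; intros F G HF HG.
  - split; auto. apply cont2_plus; [apply HF|apply HG].
  - destruct HF as [H [[Fu [D1 HFu]] [Fd [D2 HFd]]]], HG as [K [[Gu [E1 HGu]] [Gd [E2 HGd]]]].
    split; [now apply cont2_plus|]. split.
    + exists (fun u v => Fu u v + Gu u v)%C. split; auto using ddir_plus.
    + exists (fun u v => Fd u v + Gd u v)%C. split; auto using ddir_plus, Cdir_plus.
Qed.

Lemma tame_mult x J n F G : interval_in x J ->
  tame J n F -> tame J n G -> tame J n (fun u v => F u v * G u v)%C.
Proof.
  intros HJ. revert F G. induction n as [|n IH]; intros F G HF HG.
  - split; auto. apply cont2_mult; [apply HF|apply HG].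
  - pose proof (tame_S _ _ _ HF) as HF0. pose proof (tame_S _ _ _ HG) as HG0.
    pose proof (tame_inner _ _ _ _ HJ HF0). pose proof (tame_inner _ _ _ _ HJ HG0).
    destruct HF as [H1 [[Fu [D1 HFu]] [Fd [D2 HFd]]]], HG as [K [[Gu [E1 HGu]] [Gd [E2 HGd]]]].
    split; [now apply cont2_mult|]. split.
    + exists (fun u v => Fu u v * G u v + F u v * Gu u v)%C.
      split; auto using ddir_mult, tame_plus.
    + exists (fun u v => Fd u v * G u v + F u v * Gd u v)%C.
      split; auto using ddir_mult. apply Cdir_plus; now apply Cdir_mult.
Qed.

Lemma tame_const J n c : tame J n (fun _ _ => c).
Proof.
  revert c. induction n as [|n IH]; intros c; split; auto using cont2_const.
  split; exists (fun _ _ => RtoC 0); split; auto using Cdir_const, ddir_const.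
Qed.

Lemma tame_minus x J n F G : interval_in x J ->
  tame J n F -> tame J n G -> tame J n (fun u v => F u v - G u v)%C.
Proof.
  intros HJ HF HG. apply tame_ext with (fun u v => F u v + (- (1)) * G u v)%C; [intros; ring|].
  apply tame_plus; auto. apply (tame_mult x J n (fun _ _ => (- (1))%C)); auto using tame_const.
Qed.

Lemma Creg_S J n g : Creg (S n) J g -> exists g',
  (forall u, J u -> ddir 1 0 (fun u _ => J u) (fun u _ => g u) u 0 (g' u)) /\ Creg n J g'.
Proof.
  intros [H [g' [D Hg']]]. exists (fun u => g' u 0). split; [auto|].
  unfold Creg. apply (Cdir_pull 1 0 1 0 1 n (fun u _ => J u) (fun u _ => J u) g'
    (fun u _ => u) (fun _ _ => 0) 1); auto; intros; try ring; try lra;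
    try rewrite Rminus_diag, Rabs_R0; generalize (Rabs_pos (u' - u)) (Rabs_pos (v' - v)); lra.
Qed.

(** Used with [k = 0] and [k = 1]: functions of [u] and of [u + v]. *)
Lemma tame_Creg x J n g k : interval_in x J -> Creg n J g ->
  (forall u v, strip J u v -> J (u + k * v)) -> tame J n (fun u v => g (u + k * v)).
Proof.
  intros HJ Hg HS.
  assert (P : forall e1 e2 m S h, (forall u v, S u v -> strip J u v) -> Creg m J h ->
     Cdir e1 e2 m S (fun u v => h (u + k * v))).
  { intros e1 e2 m S h HSS Hh. eapply Cdir_ext; [|apply (Creg_pull e1 e2 1 k m J S h 0 Hh)].
    - intros u v _. simpl. f_equal. ring.
    - intros u v Huv. replace (1 * u + k * v + 0) with (u + k * v) by ring. auto. }
  revert g Hg. induction n as [|n IH]; intros g Hg.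
  - split; auto. apply (Cdir_cont 1 0 0). now apply P.
  - destruct (Creg_S _ _ _ Hg) as [g' [D Hg']].
    apply (tame_intro J n _ (fun u v => g' (u + k * v))); auto.
    + apply (Cdir_cont 1 0 (S n)). now apply P.
    + intros u v Huv.
      apply ddir_eq with (1 * g' (u + k * v)%R)%C; [ring|].
      apply (ddir_pull 1 0 1 0 1 (fun u _ => J u) (strip J) (fun u _ => g u)
        (fun u v => u + k * v) (fun _ _ => 0)); auto; intros; ring.
    + apply P; eauto using inner_strip.
Qed.

Lemma tame_Creg_u x J n g : interval_in x J -> Creg n J g -> tame J n (fun u _ => g u).
Proof.
  intros HJ Hg. apply tame_ext with (fun u v => g (u + 0 * v)).
  - intros u v. f_equal. ring.
  - eapply tame_Creg; eauto. intros u v [H _]. now replace (u + 0 * v) with u by ring.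
Qed.

Lemma tame_Creg_sum x J n g : interval_in x J -> Creg n J g -> tame J n (fun u v => g (u + v)).
Proof.
  intros HJ Hg. apply tame_ext with (fun u v => g (u + 1 * v)).
  - intros u v. f_equal. ring.
  - eapply tame_Creg; eauto. intros u v [_ [_ H]]. now replace (u + 1 * v) with (u + v) by ring.
Qed.

(** On the axis [v = 0], which [J] may miss, continuity of [g] suffices
    since horizontal derivatives vanish. *)
Lemma tame_Creg_v x J n g : interval_in x J -> Creg 0 (cc_interval 0 x) g -> Creg n J g ->
  tame J n (fun _ v => g v).
Proof.
  intros HJ Hc Hg.
  assert (K : cont2 (strip J) (fun _ v => g v)).
  { apply (Cdir_cont 1 0 0). apply (Creg_v 1 0 0 (cc_interval 0 x)); auto.
    intros u v H. apply (strip_tri x) in H; auto. unfold tri, cc_interval in *. lra. }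
  destruct n; [now split|].
  apply (tame_intro J n _ (fun _ _ => RtoC 0)); auto using tame_const.
  - intros u v _. apply ddir_eq with (RtoC 0); [easy|].
    intros e He. exists 1. split; [lra|]. intros t _ _. rewrite Rmult_0_r, Rplus_0_r.
    replace (g v - g v - t * 0)%C with (RtoC 0) by ring. rewrite Cmod_0.
    generalize (Rabs_pos t); nra.
  - apply (Creg_v 1 (-1) (S n) J); auto. intros u v H. apply H.
Qed.

(** Both derivatives of the integral are again built from integrals of
    horizontal derivatives and from [F] itself. *)
Lemma tame_vertical_int x J n F : interval_in x J -> tame J n F -> tame J n (vertical_int 0 F).
Proof.
  intros HJ. pose proof (strip_below x J HJ) as HB. pose proof (strip_convex x J HJ) as HC.
  revert F. induction n as [|n IH]; intros F HF.
  - split; auto. apply (vertical_int_cont 0 (strip J) (strip J)); auto. apply HF.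
  - pose proof (tame_S _ _ _ HF) as HF0.
    pose proof (tame_inner _ _ _ _ HJ HF0) as HFi.
    destruct HF as [H [[Fu [D1 HFu]] _]].
    pose proof (tame_cont _ _ _ HFu) as Hc.
    split; [apply (vertical_int_cont 0 (strip J) (strip J)); auto|]. split.
    + exists (vertical_int 0 Fu). split; auto. intros u v Huv.
      apply ddir_eq with (vertical_int 0 Fu u v + 0 * F u v)%C; [ring|].
      apply (leibniz 0 0 (strip J) (strip J)); auto. lra.
    + exists (fun u v => vertical_int 0 Fu u v + (-1) * F u v)%C. split.
      * intros u v Huv. apply (ddir_sub 1 (-1) (strip J)); [eauto using inner_strip|].
        apply (leibniz 0 (-1) (strip J) (strip J)); auto; [lra|eauto using inner_strip].
      * apply Cdir_plus; [|now apply Cdir_scal].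
        eapply tame_inner; eauto.
Qed.

(** * The Goursat problem *)

(** The horizontal derivative of a solution of [H_uv = q (u + v) * H], up to its
    value on the axis [v = 0]. *)
Definition volt (q : R -> C) (F : R -> R -> C) (u v : R) : C :=
  vertical_int 0 (fun u s => q (u + s)%R * F u s)%C u v.

(** Solutions of [H_uv = q (u + v) * H] with [H_u = a] on [v = 0] and [H_v = b]
    on [u = 0].  The third derivative is recorded separately to spare a chain
    rule at the boundary.  The conditions are symmetric under transposition, so
    that each fact about vertical integrals also holds for horizontal ones. *)
Definition goursat (x : R) (q a b : R -> C) (H : R -> R -> C) : Prop :=
  Creg 0 (cc_interval 0 x) q /\ Creg 0 (cc_interval 0 x) a /\ Creg 0 (cc_interval 0 x) b /\
  cont2 (tri x) H /\
  (forall u v, tri x u v -> ddir 1 0 (tri x) H u v (a u + volt q H u v)%C) /\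
  (forall u v, tri x u v -> ddir 1 0 (tri x) (transpose H) u v (b u + volt q (transpose H) u v)%C) /\
  (forall u v, tri x u v -> ddir 1 (-1) (tri x) H u v
     ((a u + volt q H u v) - (b v + volt q (transpose H) v u))%C).

Lemma goursat_transpose x q a b H : goursat x q a b H -> goursat x q b a (transpose H).
Proof.
  intros [Hq [Ha [Hb [Hc [D1 [D2 D3]]]]]]. split; [easy|]. split; [easy|]. split; [easy|].
  split; [|split; [exact D2|split; [exact D1|]]].
  - apply (cont2_transpose (tri x)); auto. intros; now apply tri_sym.
  - intros u v Huv.
    apply ddir_eq with (RtoC (-1) * ((a v + volt q H v u) - (b u + volt q (transpose H) u v)))%C.
    { change (volt q (transpose (transpose H)) v u) with (volt q H v u). rewrite RtoC_m1. ring. }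
    apply (ddir_pull 1 (-1) 1 (-1) (-1) (tri x) (tri x) H (fun _ v => v) (fun u _ => u));
      auto using tri_sym; intros; ring.
Qed.

Lemma volt_tame x J n q H : interval_in x J -> Creg n J q -> tame J n H -> tame J n (volt q H).
Proof.
  intros HJ Hq HH. apply (tame_vertical_int x); auto. apply (tame_mult x); auto.
  now apply (tame_Creg_sum x J n q).
Qed.

Lemma volt_transpose_inner x J n q H : interval_in x J -> Creg n J q -> tame J n (transpose H) ->
  Cdir 1 (-1) n (inner J) (fun u v => volt q (transpose H) v u).
Proof.
  intros HJ Hq HH. apply (Cdir_transpose n (inner J) (volt q (transpose H))); [apply inner_sym|].
  apply (tame_inner x); auto. now apply (volt_tame x).
Qed.

Lemma Creg_le m n J g : (m <= n)%nat -> Creg n J g -> Creg m J g.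
Proof. apply Cdir_le. Qed.

(** The equations express the derivatives of [H] through integrals of [q * H],
    which are as regular as [q] and [H]. *)
Lemma goursat_tame_step x J n q a b H : interval_in x J -> Creg n J q -> Creg n J a -> Creg n J b ->
  goursat x q a b H -> tame J n H -> tame J n (transpose H) -> tame J (S n) H.
Proof.
  intros HJ Hq Ha Hb [_ [_ [_ [Hc [D1 [_ D3]]]]]] HT HT'.
  assert (HH : cont2 (strip J) H) by (apply (cont2_sub (tri x)); eauto using strip_tri).
  assert (HA : tame J n (fun u v => a u + volt q H u v)%C).
  { apply (tame_plus J n (fun u _ => a u) (volt q H)); [now apply (tame_Creg_u x)|now apply (volt_tame x)]. }
  apply (tame_intro J n H (fun u v => a u + volt q H u v)%C); auto.
  - intros u v Huv. apply (ddir_sub 1 0 (tri x)); [eauto using strip_tri|].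
    apply D1. eauto using strip_tri.
  - split; [apply (cont2_sub (strip J)); eauto using inner_strip|].
    exists (fun u v => (a u + volt q H u v) - (b v + volt q (transpose H) v u))%C. split.
    + intros u v Huv.
      apply (ddir_sub 1 (-1) (tri x)); [eauto using strip_tri, inner_strip|].
      apply D3. eauto using strip_tri, inner_strip.
    + apply Cdir_minus; [now apply (tame_inner x)|].
      apply (Cdir_plus _ _ _ _ (fun _ v => b v)).
      * apply (Creg_v _ _ _ J); auto. intros u v Huv. apply Huv.
      * now apply (volt_transpose_inner x).
Qed.

Lemma goursat_tame x J m q a b H : interval_in x J -> Creg m J q -> Creg m J a -> Creg m J b ->
  goursat x q a b H -> tame J (S m) H /\ tame J (S m) (transpose H).
Proof.
  intros HJ Hq Ha Hb HG.
  assert (P : forall n, (n <= S m)%nat -> tame J n H /\ tame J n (transpose H)).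
  { induction n as [|n IH]; intros Hn.
    - pose proof (goursat_transpose _ _ _ _ _ HG) as HG'. split; split; auto;
        apply (cont2_sub (tri x)); try (eapply strip_tri; eassumption);
        [apply HG|apply HG'].
    - destruct IH as [T1 T2]; [lia|].
      assert (Hnm : (n <= m)%nat) by lia.
      pose proof (Creg_le _ _ _ _ Hnm Hq). pose proof (Creg_le _ _ _ _ Hnm Ha).
      pose proof (Creg_le _ _ _ _ Hnm Hb). pose proof (goursat_transpose _ _ _ _ _ HG).
      split; [apply (goursat_tame_step x J n q a b)|apply (goursat_tame_step x J n q b a)]; auto. }
  auto.
Qed.

Lemma CRInt_reflect g v : 0 <= v -> ex_CRInt g 0 v -> CRInt (fun s => g (v - s)) 0 v = CRInt g 0 v.
Proof.
  intros Hv Hg.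
  assert (Hsw : ex_CRInt g v 0) by (apply (@ex_RInt_swap C_R_NormedModule); exact Hg).
  assert (E : ex_CRInt g (-1 * 0 + v) (-1 * v + v)).
  { replace (-1 * 0 + v) with v by ring. replace (-1 * v + v) with 0 by ring. exact Hsw. }
  pose proof (@RInt_comp_lin C_R_CompleteNormedModule g (-1) v 0 v E) as X.
  replace (-1 * 0 + v) with v in X by ring. replace (-1 * v + v) with 0 in X by ring.
  assert (X2 : CRInt (fun y => RtoC (-1) * g (v - y)%R)%C 0 v = CRInt g v 0).
  { unfold CRInt. rewrite <- X. apply (@RInt_ext C_R_CompleteNormedModule). intros y _.
    rewrite scal_C_CN. do 2 f_equal. ring. }
  assert (X3 : ex_CRInt (fun y => g (v - y)) 0 v).
  { apply (@ex_RInt_comp_lin C_R_NormedModule g (-1) v 0 v) in E.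
    apply (ex_CRInt_scal (-1)) in E.
    eapply (@ex_RInt_ext C_R_NormedModule); [|exact E]. intros y _. simpl.
    rewrite scal_C_N, Cmult_assoc, <- RtoC_mult.
    replace (-1 * -1) with 1 by ring. rewrite Cmult_1_l. f_equal. ring. }
  rewrite CRInt_scal in X2 by easy.
  pose proof (CRInt_chasles g 0 v 0 Hg Hsw) as X4. rewrite CRInt_point in X4.
  replace (CRInt (fun s : R => g (v - s)) 0 v)
    with (- (RtoC (-1) * CRInt (fun y : R => g (v - y)%R) 0 v))%C by (rewrite RtoC_m1; ring).
  rewrite X2.
  replace (- CRInt g v 0)%C with (CRInt g 0 v - (CRInt g 0 v + CRInt g v 0))%C by ring.
  rewrite X4. ring.
Qed.

(** The derivative of [H] along [(1, -1)], as given by the equations: continuous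
    on the closed triangle, whatever the derivatives of [q] do at its vertices. *)
Definition diag_derivative (q a b : R -> C) (H : R -> R -> C) (u v : R) : C :=
  ((a u + volt q H u v) - (b v + volt q (transpose H) v u))%C.

Lemma volt_cont2 x q H : Creg 0 (cc_interval 0 x) q -> cont2 (tri x) H -> cont2 (tri x) (volt q H).
Proof.
  intros Hq HH. apply (vertical_int_cont 0 (tri x) (tri x)); [apply tri_below|].
  apply cont2_mult; auto. apply (Cdir_cont 1 0 0).
  apply (Creg_sum _ _ _ (cc_interval 0 x)); auto. unfold tri, cc_interval. intros; lra.
Qed.

Lemma diag_derivative_cont x q a b H : goursat x q a b H -> cont2 (tri x) (diag_derivative q a b H).
Proof.
  intros [Hq [Ha [Hb [Hc _]]]].
  assert (L : forall u v, tri x u v -> cc_interval 0 x u /\ cc_interval 0 x v)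
    by (unfold tri, cc_interval; intros; lra).
  apply (Cdir_cont 1 0 0). apply Cdir_minus.
  - apply (Cdir_plus _ _ _ _ (fun u _ => a u)).
    + apply (Creg_u _ _ _ (cc_interval 0 x)); auto. intros u v Huv. apply (L u v Huv).
    + split; auto. now apply volt_cont2.
  - apply (Cdir_plus _ _ _ _ (fun _ v => b v)).
    + apply (Creg_v _ _ _ (cc_interval 0 x)); auto. intros u v Huv. apply (L u v Huv).
    + split; auto. apply (cont2_transpose (tri x) (tri x) (volt q (transpose H))); auto using tri_sym.
      apply volt_cont2; auto. apply (cont2_transpose (tri x)); auto using tri_sym.
Qed.

Lemma ddir_on_line k S F G u v l :
  (forall t, S (u + t * 1) (v + t * k) -> F (u + t * 1) (v + t * k) = G (u + t * 1) (v + t * k)) ->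
  F u v = G u v -> ddir 1 k S F u v l -> ddir 1 k S G u v l.
Proof.
  intros E E0 HF e He. destruct (HF e He) as [d [Hd H]]. exists d. split; [easy|].
  intros t Ht HS. rewrite <- E, <- E0 by easy. auto.
Qed.

(** Reflecting [s] into [u + v - s] turns the derivative of [volt q H] along
    [(1, -1)] into one that never differentiates [q]: this is where one order
    of regularity is gained. *)
Lemma volt_ddir x q a b H u v : goursat x q a b H -> tri x u v ->
  ddir 1 (-1) (tri x) (volt q H) u v (volt q (diag_derivative q a b H) u v + RtoC (-1) * (q u * H u 0))%C.
Proof.
  intros HG Huv. pose proof (diag_derivative_cont _ _ _ _ _ HG) as HDc.
  destruct HG as [Hq [Ha [Hb [Hc [_ [_ D3]]]]]].
  set (s := u + v).
  assert (Hs : s <= x) by (unfold s, tri in *; lra).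
  pose (G := fun (K : R -> R -> C) u' r => (q (s - r)%R * K u' (s - r - u')%R)%C).
  assert (Ts : forall u' r, tri s u' r -> tri x u' (s - r - u')) by (unfold tri; intros; lra).
  assert (Hqs : cont2 (tri s) (fun _ r => q (s - r)%R)).
  { apply (cont2_ext _ (fun u' r => q (0 * u' + -1 * r + s)%R)).
    - intros. f_equal. ring.
    - apply (Cdir_cont 1 0 0). apply (Creg_pull 1 0 0 (-1) 0 (cc_interval 0 x)); auto.
      unfold tri, cc_interval. intros; lra. }
  assert (GC : forall K, cont2 (tri x) K -> cont2 (tri s) (G K)).
  { intros K HK. apply cont2_mult; auto.
    apply (cont2_pull (tri x) (tri s) K (fun u' _ => u') (fun u' r => s - r - u') 2); auto;
      try lra; intros.
    - generalize (Rabs_pos (u' - u0)) (Rabs_pos (v' - v0)); lra.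
    - replace (s - v' - u' - (s - v0 - u0)) with (- ((u' - u0) + (v' - v0))) by ring.
      rewrite Rabs_Ropp. eapply Rle_trans; [apply Rabs_triang|].
      generalize (Rabs_pos (u' - u0)) (Rabs_pos (v' - v0)); lra. }
  assert (GI : forall K, cont2 (tri x) K -> forall u' w, tri s u' w -> u' + w = s ->
     vertical_int 0 (G K) u' w = volt q K u' w).
  { intros K HK u' w Hw E. unfold volt, vertical_int, G.
    rewrite <- (CRInt_reflect (fun r => (q (u' + r)%R * K u' r)%C) w).
    - apply CRInt_ext; [unfold tri in Hw; lra|]. intros y _.
      replace (s - y) with (u' + (w - y)) by lra. do 2 f_equal. ring.
    - unfold tri in Hw; lra.
    - apply segcont_ex; [unfold tri in Hw; lra|].
      apply (segcont_line (tri x) (fun u s => q (u + s)%R * K u s)%C).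
      + apply cont2_mult; auto. apply (Cdir_cont 1 0 0).
        apply (Creg_sum _ _ _ (cc_interval 0 x)); auto. unfold tri, cc_interval. intros; lra.
      + unfold tri in *; intros; lra. }
  assert (Hsuv : tri s u v) by (unfold tri, s in *; lra).
  apply (ddir_on_line (-1) (tri x) (vertical_int 0 (G H))).
  - intros t Ht. apply GI; auto; unfold tri, s in *; lra.
  - apply GI; auto.
  - apply ddir_eq with (vertical_int 0 (G (diag_derivative q a b H)) u v + RtoC (-1) * G H u v)%C.
    { rewrite GI by auto. unfold G. replace (s - v) with u by (unfold s; ring).
      now rewrite Rminus_diag. }
    intros e He.
    destruct (leibniz 0 (-1) (tri s) (tri s) (G H) (G (diag_derivative q a b H)) u v) with (e := e)
      as [d [Hd HL]]; auto using tri_convex, tri_below; [lra| |].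
    + intros u' r Hur. unfold G.
      apply ddir_eq with (0 * H u' (s - r - u')%R + q (s - r)%R * diag_derivative q a b H u' (s - r - u')%R)%C; [ring|].
      apply (ddir_mult 1 0 (tri s) (fun _ r => q (s - r)%R) (fun u' r => H u' (s - r - u')%R)).
      * intros e1 He1. exists 1. split; [lra|]. intros t _ _. rewrite Rmult_0_r, Rplus_0_r.
        replace (q (s - r)%R - q (s - r)%R - t * 0)%C with (RtoC 0) by ring. rewrite Cmod_0.
        generalize (Rabs_pos t); nra.
      * apply ddir_eq with (1 * diag_derivative q a b H u' (s - r - u')%R)%C; [ring|].
        apply (ddir_pull 1 (-1) 1 0 1 (tri x) (tri s) H (fun u' _ => u') (fun u' r => s - r - u')); auto;
          try (intros; ring).
    + exists d. split; [easy|]. intros t Ht HS. apply HL; auto. unfold tri, s in *; lra.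
Qed.

(** The horizontal integral is differentiated horizontally by the fundamental
    theorem of calculus, which gives [q (u + v) * H u v]; along [(1, -1)] it is
    treated as the transpose of a vertical integral. *)
Lemma volt_transpose_tame x J m q a b H : interval_in x J -> Creg m J q -> Creg m J a -> Creg m J b ->
  goursat x q a b H -> tame J m (fun u v => volt q (transpose H) v u).
Proof.
  intros HJ Hq Ha Hb HG.
  destruct (goursat_tame x J m q a b H) as [T1 T2]; auto.
  apply tame_S in T1, T2.
  pose proof HG as [Hq0 [_ [_ [Hc _]]]].
  assert (Hct : cont2 (tri x) (transpose H)) by (apply (cont2_transpose (tri x)); auto using tri_sym).
  pose proof (volt_cont2 x q (transpose H) Hq0 Hct) as Hcv.
  assert (K : cont2 (strip J) (fun u v => volt q (transpose H) v u)).
  { apply (cont2_sub (tri x)); [eauto using strip_tri|].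
    apply (cont2_transpose (tri x) (tri x) (volt q (transpose H))); auto using tri_sym. }
  destruct m as [|m]; [now split|].
  apply (tame_intro J m _ (fun u v => q (u + v)%R * H u v)%C); auto.
  - intros u v Huv. apply ddir_eq with (1 * (q (v + u)%R * transpose H v u))%C.
    { unfold transpose. rewrite (Rplus_comm v u). ring. }
    apply (ddir_pull 0 1 1 0 1 (tri x) (strip J) (volt q (transpose H)) (fun _ v => v) (fun u _ => u));
      try (intros; ring).
    + intros u' v' H'. apply tri_sym. eapply strip_tri; eauto.
    + apply (vertical_int_last 0 (tri x) (tri x) (fun u s => q (u + s)%R * transpose H u s)%C); auto using tri_below.
      * apply tri_sym. eapply strip_tri; eauto.
      * apply cont2_mult; auto. apply (Cdir_cont 1 0 0).
        apply (Creg_sum _ _ _ (cc_interval 0 x)); auto. unfold tri, cc_interval. intros; lra.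
  - apply tame_S in T1. apply (tame_mult x); auto.
    apply (tame_Creg_sum x); auto. eapply Creg_le; [|exact Hq]. lia.
  - now apply (volt_transpose_inner x).
Qed.

(** In the formula of [volt_ddir] every term has the order of regularity of
    [q], hence the primitive has one more. *)
Lemma volt_gain x J m q a b H : interval_in x J -> Creg m J q -> Creg m J a -> Creg m J b ->
  goursat x q a b H -> Cdir 1 (-1) (S m) (inner J) (volt q H).
Proof.
  intros HJ Hq Ha Hb HG.
  destruct (goursat_tame x J m q a b H) as [T1 T2]; auto.
  pose proof (tame_horizontal _ _ _ T1) as Hh. apply tame_S in T1, T2.
  pose proof (volt_tame x J m q H HJ Hq T1) as HV.
  split.
  - apply (Cdir_cont 1 (-1) m). now apply (tame_inner x).
  - exists (fun u v => volt q (diag_derivative q a b H) u v + RtoC (-1) * (q u * H u 0))%C. split.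
    + intros u v Huv. apply (ddir_sub 1 (-1) (tri x)); [eauto using strip_tri, inner_strip|].
      apply volt_ddir; auto. eauto using strip_tri, inner_strip.
    + apply Cdir_plus.
      * apply (tame_inner x); auto. apply (volt_tame x); auto.
        apply (tame_minus x); auto.
        -- apply (tame_plus J m (fun u _ => a u)); auto. now apply (tame_Creg_u x).
        -- apply (tame_plus J m (fun _ v => b v)).
           ++ apply (tame_Creg_v x); auto. apply HG.
           ++ now apply (volt_transpose_tame x J m q a b H).
      * apply Cdir_scal. apply (Creg_u _ _ _ J (inner J) (fun u => q u * H u 0)%C);
          [|intros u v Huv; apply Huv].
        apply (Cdir_mult 1 0 m (fun u _ => J u) (fun u _ => q u) (fun u _ => H u 0)); [exact Hq|].
        apply (Cdir_pull 1 0 1 0 1 m (strip J) (fun u _ => J u) H (fun u _ => u) (fun _ _ => 0) 1);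
          auto using Cdir_S; intros; try ring; try lra.
        -- generalize (Rabs_pos (u' - u)) (Rabs_pos (v' - v)); lra.
        -- rewrite Rminus_diag, Rabs_R0. generalize (Rabs_pos (u' - u)) (Rabs_pos (v' - v)); lra.
        -- repeat split; auto; [lra|]. now rewrite Rplus_0_r.
Qed.

(** * Regularity up to the hypotenuse *)

Definition edge (x d eta u v : R) : Prop := d < u /\ d < v /\ x - eta <= u + v <= x.

Lemma oo_interval_in x : interval_in x (oo_interval 0 x).
Proof. unfold interval_in, oo_interval. split; intros; lra. Qed.

Lemma CRInt_shift g a b u : ex_CRInt g a b ->
  CRInt (fun r => g (r - u)) (a + u) (b + u) = CRInt g a b.
Proof.
  intros H.
  assert (E : ex_CRInt g (1 * (a + u) + - u) (1 * (b + u) + - u)).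
  { replace (1 * (a + u) + - u) with a by ring. now replace (1 * (b + u) + - u) with b by ring. }
  pose proof (@RInt_comp_lin C_R_CompleteNormedModule g 1 (- u) (a + u) (b + u) E) as X.
  replace (1 * (a + u) + - u) with a in X by ring.
  replace (1 * (b + u) + - u) with b in X by ring.
  unfold CRInt. rewrite <- X. apply (@RInt_ext C_R_CompleteNormedModule). intros y _.
  rewrite scal_C_CN, Cmult_1_l. f_equal. ring.
Qed.

Lemma volt_split x q H u v c : Creg 0 (cc_interval 0 x) q -> cont2 (tri x) H -> tri x u v ->
  u <= c <= u + v ->
  volt q H u v = (volt q H u (c - u) + vertical_int c (fun u r => q r * H u (r - u)%R)%C u (u + v))%C.
Proof.
  intros Hq HH Huv Hc. unfold volt, vertical_int.
  assert (E : ex_CRInt (fun s => q (u + s)%R * H u s)%C 0 v).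
  { apply segcont_ex; [unfold tri in Huv; lra|].
    apply (segcont_line (tri x) (fun u s => q (u + s)%R * H u s)%C).
    - apply cont2_mult; auto. apply (Cdir_cont 1 0 0).
      apply (Creg_sum _ _ _ (cc_interval 0 x)); auto. unfold tri, cc_interval. intros; lra.
    - unfold tri in *; intros; lra. }
  rewrite <- (CRInt_chasles _ 0 (c - u) v);
    [|apply (ex_CRInt_sub _ 0 v); lra || easy|apply (ex_CRInt_sub _ 0 v); lra || easy].
  f_equal. rewrite <- (CRInt_shift _ (c - u) v u);
    [|apply (ex_CRInt_sub _ 0 v); lra || easy].
  replace (c - u + u) with c by ring. rewrite (Rplus_comm v u).
  apply CRInt_ext; [lra|]. intros y _. do 2 f_equal. ring.
Qed.

(** Near the hypotenuse, the vertical integral is cut on a parallel line just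
    inside: the lower part is an interior quantity, and the upper part is
    differentiated along [(1, -1)] without differentiating [q]. *)
Lemma volt_edge x m q a b H i d eta eta' :
  Creg m (oo_interval 0 x) q -> Creg m (oo_interval 0 x) a -> Creg m (oo_interval 0 x) b ->
  goursat x q a b H -> 0 < d -> 0 < eta -> eta <= eta' -> eta <= d / 2 -> (i <= S m)%nat ->
  Cdir 1 (-1) i (edge x (d / 2) eta') H -> Cdir 1 (-1) i (edge x d eta) (volt q H).
Proof.
  intros Hq Ha Hb HG Hd He Hee Hed Hi HH.
  pose proof (volt_gain x _ m q a b H (oo_interval_in x) Hq Ha Hb HG) as HV.
  destruct HG as [Hq0 [_ [_ [Hc _]]]].
  (* The line [u + v = c] on which the integral is cut. *)
  set (c := x - eta).
  set (S0 := fun u r : R => d < u < x - d /\ c <= r <= x).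
  apply Cdir_ext with (fun u v => volt q H u (c - u)
     + vertical_int c (fun u r => q r * H u (r - u)%R)%C u (u + v))%C.
  { intros u v Huv. symmetry. apply (volt_split x); auto; unfold edge, tri, c in *; lra. }
  apply Cdir_plus.
  - apply (Cdir_pull 1 (-1) 1 (-1) 1 i (inner (oo_interval 0 x)) (edge x d eta) (volt q H)
      (fun u _ => u) (fun u _ => c - u) 1); try (intros; ring); try lra.
    + lip.
    + lip.
    + unfold edge, inner, oo_interval, c. intros u v Huv. lra.
    + eapply Cdir_le; eauto.
  - apply (Cdir_pull 1 0 1 (-1) 1 i S0 (edge x d eta) (vertical_int c (fun u r => q r * H u (r - u)%R)%C)
      (fun u _ => u) (fun u v => u + v) 1); try (intros; ring); try lra.
    + lip.
    + lip.
    + unfold edge, S0, c. intros u v Huv. lra.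
    + apply (vertical_int_Cdir c i S0 S0).
      * unfold convex_u, S0. intros; lra.
      * unfold below, S0. intros u v Huv. split; [lra|]. intros; lra.
      * apply Cdir_mult.
        -- apply (Cdir_invariant 1 0 i S0 (fun _ r => q r)).
           ++ apply (Cdir_cont 1 0 0). apply (Creg_v _ _ _ (cc_interval 0 x)); auto.
              unfold S0, cc_interval, c. intros; lra.
           ++ intros u v t _. f_equal. ring.
        -- apply (Cdir_pull 1 (-1) 1 0 1 i (edge x (d / 2) eta') S0 H
             (fun u _ => u) (fun u r => r - u) 1); auto; try (intros; ring); try lra.
           ++ lip.
           ++ lip.
           ++ unfold S0, edge, c. intros; lra.
Qed.

Lemma edge_sym x d eta u v : edge x d eta u v -> edge x d eta v u.
Proof. unfold edge. lra. Qed.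

(** The margins [d] must shrink at each order: the segments along which the
    equations are integrated leave any fixed neighbourhood [edge x d eta]. *)
Lemma edge_regular x m q a b H :
  Creg m (oo_interval 0 x) q -> Creg m (oo_interval 0 x) a -> Creg m (oo_interval 0 x) b ->
  goursat x q a b H -> forall i, (i <= S m)%nat -> forall d, 0 < d ->
  exists eta, 0 < eta /\ Cdir 1 (-1) i (edge x d eta) H.
Proof.
  intros Hq Ha Hb HG. pose proof (goursat_transpose _ _ _ _ _ HG) as HG'.
  pose proof HG as [Hq0 [_ [_ [Hc [_ [_ D3]]]]]].
  assert (ET : forall d eta, 0 < d -> forall u v, edge x d eta u v -> tri x u v)
    by (unfold edge, tri; intros; lra).
  induction i as [|i IH]; intros Hi d Hd.
  - exists 1. split; [lra|]. split; auto. apply (cont2_sub (tri x)); auto. now apply ET.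
  - destruct (IH ltac:(lia) (d / 2)) as [eta' [He' HH]]; [lra|].
    set (eta := Rmin eta' (d / 2)).
    assert (He : 0 < eta) by (apply Rmin_glb_lt; lra).
    assert (H1 : eta <= eta') by apply Rmin_l. assert (H2 : eta <= d / 2) by apply Rmin_r.
    exists eta. split; [easy|].
    pose proof (volt_edge x m q a b H i d eta eta' Hq Ha Hb HG Hd He H1 H2 ltac:(lia) HH) as V1.
    pose proof (volt_edge x m q b a (transpose H) i d eta eta' Hq Hb Ha HG' Hd He H1 H2 ltac:(lia)
      (Cdir_transpose _ _ _ (edge_sym _ _ _) HH)) as V2.
    apply (Cdir_transpose _ _ _ (edge_sym _ _ _)) in V2.
    split; [apply (cont2_sub (tri x)); auto; now apply ET|].
    exists (diag_derivative q a b H). split.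
    + intros u v Huv. apply (ddir_sub 1 (-1) (tri x)); [now apply ET|].
      exact (D3 _ _ (ET d eta Hd _ _ Huv)).
    + apply (Cdir_minus _ _ _ _ (fun u v => a u + volt q H u v)%C
        (fun u v => b v + volt q (transpose H) v u)%C).
      all: apply (Cdir_plus _ _ _ _ (fun u _ => a u) (volt q H))
        || apply (Cdir_plus _ _ _ _ (fun _ v => b v) (transpose (volt q (transpose H)))); auto.
      * apply (Creg_u _ _ _ (oo_interval 0 x)); [apply (Creg_le _ m); auto; lia|].
        unfold edge, oo_interval. intros; lra.
      * apply (Creg_v _ _ _ (oo_interval 0 x) (edge x d eta) b); [apply (Creg_le _ m); auto; lia|].
        unfold edge, oo_interval. intros; lra.
Qed.

Lemma volt_hypotenuse_open x m q a b H d :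
  Creg m (oo_interval 0 x) q -> Creg m (oo_interval 0 x) a -> Creg m (oo_interval 0 x) b ->
  goursat x q a b H -> 0 < d ->
  exists eta, 0 < eta /\ Cdir 1 (-1) (S m) (edge x d eta) (volt q H).
Proof.
  intros Hq Ha Hb HG Hd.
  destruct (edge_regular x m q a b H Hq Ha Hb HG (S m) (le_n _) (d / 2)) as [eta' [He' HH]]; [lra|].
  exists (Rmin eta' (d / 2)). split; [apply Rmin_glb_lt; lra|].
  apply (volt_edge x m q a b H (S m) d _ eta'); auto using Rmin_l, Rmin_r.
  apply Rmin_glb_lt; lra.
Qed.

Lemma ddir_unique J g u l l' :
  (forall d, 0 < d -> exists t, t <> 0 /\ Rabs t < d /\ J (u + t)) ->
  ddir 1 0 (fun u _ => J u) (fun u _ => g u) u 0 l ->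
  ddir 1 0 (fun u _ => J u) (fun u _ => g u) u 0 l' -> l = l'.
Proof.
  intros HJ H1 H2.
  destruct (classic (l = l')) as [|Hn]; auto. exfalso.
  assert (Hp : 0 < Cmod (l - l')).
  { apply Cmod_gt_0. intros E. apply Hn. replace l with ((l - l') + l')%C by ring.
    rewrite E. ring. }
  set (e := Cmod (l - l') / 4). assert (He : 0 < e) by (unfold e; lra).
  destruct (H1 e He) as [d1 [Hd1 K1]]. destruct (H2 e He) as [d2 [Hd2 K2]].
  destruct (HJ (Rmin d1 d2)) as [t [Ht0 [Ht HJt]]]; [apply Rmin_glb_lt; lra|].
  pose proof (Rmin_l d1 d2). pose proof (Rmin_r d1 d2).
  rewrite <- (Rmult_1_r t) in HJt.
  specialize (K1 t ltac:(lra) HJt). specialize (K2 t ltac:(lra) HJt).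
  assert (A : Cmod (t * (l - l')) <= 2 * e * Rabs t).
  { replace (t * (l - l'))%C with
      ((g (u + t * 1)%R - g u - t * l') + - (g (u + t * 1)%R - g u - t * l))%C by ring.
    eapply Rle_trans; [apply Cmod_triangle|]. rewrite Cmod_opp. lra. }
  rewrite Cmod_mult, Cmod_R in A.
  assert (0 < Rabs t) by now apply Rabs_pos_lt. unfold e in A. nra.
Qed.

Lemma Creg_ext n J f g : (forall u, J u -> f u = g u) -> Creg n J f -> Creg n J g.
Proof. intros E. apply Cdir_ext. auto. Qed.

Lemma Creg_sub n (J J' : R -> Prop) g : (forall u, J' u -> J u) -> Creg n J g -> Creg n J' g.
Proof. intros HJ. apply Cdir_sub. auto. Qed.

Lemma Creg_C_class n J g : Creg n J g -> C_class n J g.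
Proof.
  revert g. induction n as [|n IH]; intros g Hg.
  - exists (fun _ => g). split; [auto|]. split; [intros j y Hj; lia|].
    apply continuous_on_eps. intros y Hy e He. destruct Hg as [Hg _].
    destruct (Hg y 0 Hy e He) as [d [Hd H]]. exists d. split; [easy|].
    intros z Hz Hzy. apply (H z 0); auto. now rewrite Rminus_diag, Rabs_R0.
  - destruct (Creg_S _ _ _ Hg) as [g' [D Hg']]. destruct (IH g' Hg') as [ds [E [HD Hc]]].
    exists (fun j => match j with O => g | S i => ds i end). split; [auto|]. split; [|auto].
    intros [|j] y Hj Hy; [|apply HD; auto; lia]. simpl.
    rewrite E by auto. split.
    + apply (@is_linear_scal_l R_AbsRing C_R_NormedModule).
    + intros y0 Hy0 e.
      assert (Ey : y0 = y).
      { destruct (Req_dec y0 y) as [|Hn]; auto. exfalso.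
        assert (Hp : 0 < Rabs (y - y0)) by (apply Rabs_pos_lt; lra).
        assert (X : locally y0 (fun z => Rabs (z - y0) < Rabs (y - y0))).
        { exists (mkposreal _ Hp). intros z Hz. exact Hz. }
        specialize (Hy0 _ X). destruct Hy0 as [d Hd].
        specialize (Hd y (ball_center y d) Hy). lra. }
      subst y0. destruct (D y Hy e (cond_pos e)) as [d [Hd H]].
      assert (Ez : forall z : R, y + (z - y) = z) by (intros; ring).
      exists (mkposreal d Hd). intros z Hz HJz.
      specialize (H (z - y) Hz). rewrite Rmult_1_r in H.
      rewrite Ez in H. specialize (H HJz).
      rewrite norm_C_R, scal_C_R. exact H.
Qed.

Lemma ddir_local (J J' : R -> Prop) g y l r : 0 < r -> (forall z, Rabs (z - y) < r -> J' z -> J z) ->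
  ddir 1 0 (fun u _ => J u) (fun u _ => g u) y 0 l ->
  ddir 1 0 (fun u _ => J' u) (fun u _ => g u) y 0 l.
Proof.
  intros Hr HJ H e He. destruct (H e He) as [d [Hd K]].
  exists (Rmin d r). split; [apply Rmin_glb_lt; lra|].
  intros t Ht HJt. pose proof (Rmin_l d r). pose proof (Rmin_r d r).
  apply K; [lra|]. apply HJ; auto. replace (y + t * 1 - y) with t by ring. lra.
Qed.

Lemma open_accum (p r u : R) : p < u < r -> forall d, 0 < d ->
  exists t, t <> 0 /\ Rabs t < d /\ p < u + t < r.
Proof.
  intros Hu d Hd. exists (Rmin d (r - u) / 2).
  assert (0 < Rmin d (r - u)) by (apply Rmin_glb_lt; lra).
  pose proof (Rmin_l d (r - u)). pose proof (Rmin_r d (r - u)).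
  rewrite Rabs_right; lra.
Qed.

Lemma interior_margin x y : oo_interval 0 x y ->
  exists d, 0 < d /\ d < y < x - d.
Proof.
  intros [Hy1 Hy2]. exists (Rmin y (x - y) / 2).
  assert (0 < Rmin y (x - y)) by (apply Rmin_glb_lt; lra).
  pose proof (Rmin_l y (x - y)). pose proof (Rmin_r y (x - y)). lra.
Qed.

Lemma margin_radius d x y : d < y < x - d ->
  exists r, 0 < r /\ forall z, Rabs (z - y) < r -> d < z < x - d.
Proof.
  intros Hy. exists (Rmin (y - d) (x - d - y)). split; [apply Rmin_glb_lt; lra|].
  pose proof (Rmin_l (y - d) (x - d - y)). pose proof (Rmin_r (y - d) (x - d - y)).
  intros z Hz. apply Rabs_def2 in Hz. lra.
Qed.

Lemma Creg0_glue x g : (forall d, 0 < d -> Creg 0 (fun u => d < u < x - d) g) ->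
  Creg 0 (oo_interval 0 x) g.
Proof.
  intros Hg. split; auto. intros y v Hy e He.
  destruct (interior_margin x y Hy) as [d [Hd Hyd]].
  destruct (Hg d Hd) as [K _]. destruct (K y v Hyd e He) as [r [Hr HK]].
  destruct (margin_radius d x y Hyd) as [r' [Hr' HK']].
  exists (Rmin r r'). split; [now apply Rmin_glb_lt|].
  pose proof (Rmin_l r r'). pose proof (Rmin_r r r').
  intros z w _ Hz Hw. apply (HK z w); try lra. apply HK'. lra.
Qed.

(** Derivatives on nested intervals agree by uniqueness, so that those chosen
    for each margin fit together. *)
Lemma Creg_glue n x g : (forall d, 0 < d -> Creg n (fun u => d < u < x - d) g) ->
  Creg n (oo_interval 0 x) g.
Proof.
  revert g. induction n as [|n IH]; intros g Hg; [now apply Creg0_glue|].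
  assert (X : forall d, {g' : R -> C | 0 < d ->
     (forall u, d < u < x - d ->
        ddir 1 0 (fun u _ => d < u < x - d) (fun u _ => g u) u 0 (g' u))
     /\ Creg n (fun u => d < u < x - d) g'}).
  { intros d. apply constructive_indefinite_description.
    destruct (classic (0 < d)) as [Hd|Hd].
    - destruct (Creg_S _ _ _ (Hg d Hd)) as [g' K]. exists g'. auto.
    - exists (fun _ => RtoC 0). tauto. }
  set (h := fun d => proj1_sig (X d)).
  assert (D : forall d u, 0 < d -> d < u < x - d ->
    ddir 1 0 (fun u _ => d < u < x - d) (fun u _ => g u) u 0 (h d u)).
  { intros d u Hd. unfold h. destruct (X d) as [k Hk]. simpl. now apply Hk. }
  assert (Hh : forall d, 0 < d -> Creg n (fun u => d < u < x - d) (h d)).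
  { intros d Hd. unfold h. destruct (X d) as [k Hk]. simpl. now apply Hk. }
  assert (Q : forall d d' u, 0 < d -> 0 < d' -> d < u < x - d -> d' < u < x - d' -> h d u = h d' u).
  { intros d d' u Hd Hd' Hu Hu'.
    set (m := Rmax d d').
    assert (Hm : d <= m /\ d' <= m /\ m < u < x - m).
    { unfold m, Rmax. destruct Rle_dec; lra. }
    apply (ddir_unique (fun u => m < u < x - m) g u).
    - apply open_accum. apply Hm.
    - apply (ddir_sub 1 0 (fun u _ => d < u < x - d)); [intros; lra|]. now apply D.
    - apply (ddir_sub 1 0 (fun y _ => d' < y < x - d')); [intros; lra|]. now apply D. }
  set (dd := fun y => Rmin y (x - y) / 2).
  assert (Hdd : forall y, 0 < y < x -> 0 < dd y /\ dd y < y < x - dd y).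
  { intros y Hy. unfold dd. assert (0 < Rmin y (x - y)) by (apply Rmin_glb_lt; lra).
    pose proof (Rmin_l y (x - y)). pose proof (Rmin_r y (x - y)). lra. }
  split.
  - destruct (Creg0_glue x g) as [K _]; auto. intros d Hd. eapply Creg_le; [|apply Hg; auto]. lia.
  - exists (fun u _ => h (dd u) u). split.
    + intros u v Hu. destruct (Hdd u Hu) as [H1 H2].
      destruct (margin_radius _ _ _ H2) as [r [Hr HK]].
      exact (ddir_local _ (oo_interval 0 x) g u _ r Hr (fun z Hz _ => HK z Hz) (D _ _ H1 H2)).
    + apply (IH (fun u => h (dd u) u)). intros d Hd.
      apply (Creg_ext n _ (h d)); [|auto]. intros u Hu. simpl in Hu.
      destruct (Hdd u ltac:(lra)) as [H1 H2]. now apply Q.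
Qed.

(** * Recovering the potential from one section of the kernel *)

Lemma kernel_cont b K x : x <= b ->
  continuous_on (goursat_domain b) (fun z : R * R => K (fst z) (snd z)) ->
  cont2 (tri x) (fun u v => K (u + v) (u - v)).
Proof.
  intros Hxb HK u v Huv e He.
  assert (G : forall u v, tri x u v -> goursat_domain b (u + v, u - v)).
  { unfold tri, goursat_domain. simpl. intros p r Hpr. split; [lra|].
    unfold Rabs. destruct Rcase_abs; lra. }
  specialize (HK (u + v, u - v) (G u v Huv)).
  apply (filterlim_C_eps _ _) with (e := e) in HK; [|lra].
  destruct HK as [d Hd]. exists (d / 2). split; [generalize (cond_pos d); lra|].
  intros u' v' HS Hu Hv. apply (Hd (u' + v', u' - v')); [|now apply G].
  apply Rabs_def2 in Hu, Hv.
  split; unfold ball; simpl; unfold AbsRing_ball, abs, minus, plus, opp; simpl;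
    apply Rabs_def1; lra.
Qed.

Lemma Creg_continuous_on J q : continuous_on J q -> Creg 0 J q.
Proof.
  intros Hq. split; auto. intros u v Hu e He.
  destruct (proj1 (continuous_on_eps J q) Hq u Hu e He) as [d [Hd H]].
  exists d. split; [easy|]. intros; now apply H.
Qed.

Lemma ddir_scal e1 e2 S F u v l c :
  ddir e1 e2 S F u v l -> ddir e1 e2 S (fun u v => c * F u v)%C u v (c * l)%C.
Proof.
  intros H. apply ddir_eq with (0 * F u v + c * l)%C; [ring|].
  apply (ddir_mult e1 e2 S (fun _ _ => c)); auto using ddir_const.
Qed.

(** The first term of the integral equation depends on [u] only, hence [b = 0];
    the double integral is a horizontal integral of [volt q H] and, by
    Leibniz' rule instead of an exchange of integrals, also a vertical one. *)
Lemma kernel_goursat b q h K x : 0 < x <= b -> continuous_on (cc_interval 0 b) q ->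
  transmutation_kernel b q h K ->
  goursat x q (fun u => RtoC (/ 2) * q u)%C (fun _ => RtoC 0) (fun u v => K (u + v) (u - v)).
Proof.
  intros Hx Hq [HKc HK].
  set (H := fun u v => K (u + v) (u - v)).
  assert (Hq0 : Creg 0 (cc_interval 0 x) q).
  { apply (Creg_sub 0 (cc_interval 0 b)); [unfold cc_interval; intros; lra|].
    now apply Creg_continuous_on. }
  assert (Hc : cont2 (tri x) H) by (now apply (kernel_cont b)).
  (* The integrand of the outer integral and its horizontal derivative, with
     the variable of integration second. *)
  set (G := transpose (volt q H)).
  set (G' := fun u s => (q (u + s)%R * transpose H u s)%C).
  assert (Hct : cont2 (tri x) (transpose H)) by (apply (cont2_transpose (tri x)); auto using tri_sym).
  assert (Hqs : cont2 (tri x) (fun u s => q (u + s))).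
  { apply (Cdir_cont 1 0 0).
    apply (Creg_sum _ _ _ (cc_interval 0 x)); auto. unfold tri, cc_interval. intros; lra. }
  assert (HGc : cont2 (tri x) G).
  { apply (cont2_transpose (tri x)); auto using tri_sym. now apply volt_cont2. }
  assert (HGc' : cont2 (tri x) G') by (now apply cont2_mult).
  assert (HGD : forall u v, tri x u v -> ddir 1 0 (tri x) G u v (G' u v)).
  { intros u v Huv. apply ddir_eq with (1 * (q (v + u)%R * H v u))%C.
    { unfold G', transpose. rewrite (Rplus_comm v u). ring. }
    apply (ddir_pull 0 1 1 0 1 (tri x) (tri x) (volt q H) (fun _ v => v) (fun u _ => u));
      auto using tri_sym; try (intros; ring).
    apply (vertical_int_last 0 (tri x) (tri x) (fun u s => q (u + s)%R * H u s)%C);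
      auto using tri_below, tri_sym. now apply cont2_mult. }
  set (Q := fun u => CRInt q 0 u).
  assert (HQ : forall e1 e2 (p1 : R -> R -> R) k u v, tri x u v ->
     (forall u v, tri x u v -> 0 <= p1 u v <= x) ->
     (forall t, p1 (u + t * e1) (v + t * e2) = p1 u v + k * t * 1) ->
     ddir e1 e2 (tri x) (fun u v => Q (p1 u v)) u v (k * q (p1 u v))%C).
  { intros e1 e2 p1 k u v Huv Hp1 Hp2.
    apply (ddir_pull 0 1 e1 e2 k (fun _ s => cc_interval 0 x s) (tri x)
      (vertical_int 0 (fun _ s => q s)) (fun _ _ => 0) p1); auto; try (intros; ring).
    apply (vertical_int_last 0 (fun _ s => cc_interval 0 x s) (fun _ s => cc_interval 0 x s)).
    - unfold below, cc_interval. intros; split; [lra|]. intros; lra.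
    - now apply Hp1.
    - apply (Cdir_cont 1 0 0). apply (Creg_v _ _ _ (cc_interval 0 x)); auto. }
  assert (EH : forall u v, tri x u v -> (h / 2 + RtoC (/ 2) * Q u + vertical_int 0 G v u)%C = H u v).
  { intros u v Huv. unfold H at 1. rewrite HK.
    2:{ unfold tri, goursat_domain in *. simpl. split; [lra|].
        unfold Rabs. destruct Rcase_abs; lra. }
    replace ((u + v + (u - v)) / 2) with u by field.
    replace ((u + v - (u - v)) / 2) with v by field.
    rewrite RtoC_inv by lra. reflexivity. }
  assert (TI : forall u v, tri x u v -> 0 <= u <= x) by (unfold tri; intros; lra).
  assert (TI' : forall u v, tri x u v -> 0 <= v <= x) by (unfold tri; intros; lra).
  assert (IG' : forall u v, tri x u v -> vertical_int 0 G' u v = volt q (transpose H) u v) by reflexivity.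
  split; [easy|]. split.
  { apply (Cdir_scal 1 0 0 _ (fun u _ => q u)). exact Hq0. }
  split; [apply Creg_const|]. split; [easy|]. split; [|split].
  - intros u v Huv. apply (ddir_ext _ _ _ (fun u v => h / 2 + RtoC (/ 2) * Q u + vertical_int 0 G v u)%C); auto.
    apply ddir_plus.
    + apply ddir_eq with (0 + RtoC (/ 2) * (1 * q u))%C; [ring|].
      apply (ddir_plus _ _ _ (fun _ _ => h / 2)%C (fun u _ => RtoC (/ 2) * Q u)%C); auto using ddir_const.
      apply (ddir_scal _ _ _ (fun u _ => Q u)). apply (HQ 1 0 (fun u _ => u) 1); auto. intros; ring.
    + apply ddir_eq with (1 * G v u)%C; [unfold G, transpose; ring|].
      apply (ddir_pull 0 1 1 0 1 (tri x) (tri x) (vertical_int 0 G) (fun _ v => v) (fun u _ => u));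
        auto using tri_sym; try (intros; ring).
      apply (vertical_int_last 0 (tri x) (tri x)); auto using tri_below, tri_sym.
  - intros u v Huv.
    apply (ddir_ext _ _ _ (fun u v => h / 2 + RtoC (/ 2) * Q v + vertical_int 0 G u v)%C); auto.
    { intros u' v' H'. unfold transpose. rewrite EH; auto using tri_sym. }
    apply ddir_plus.
    + apply ddir_eq with (0 + RtoC (/ 2) * (0 * q v))%C; [ring|].
      apply (ddir_plus _ _ _ (fun _ _ => h / 2)%C (fun _ v => RtoC (/ 2) * Q v)%C); auto using ddir_const.
      apply (ddir_scal _ _ _ (fun _ v => Q v)). apply (HQ 1 0 (fun _ v => v) 0); auto. intros; ring.
    + apply ddir_eq with (vertical_int 0 G' u v + 0 * G u v)%C; [rewrite IG' by auto; ring|].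
      apply (leibniz 0 0 (tri x) (tri x)); auto using tri_below, tri_convex. lra.
  - intros u v Huv. apply (ddir_ext _ _ _ (fun u v => h / 2 + RtoC (/ 2) * Q u + vertical_int 0 G v u)%C); auto.
    apply ddir_eq with ((0 + RtoC (/ 2) * (1 * q u))
      + RtoC (-1) * (vertical_int 0 G' v u + RtoC (-1) * G v u))%C.
    { rewrite IG' by auto using tri_sym. unfold G, transpose at 2. rewrite RtoC_m1. ring. }
    apply ddir_plus.
    + apply (ddir_plus _ _ _ (fun _ _ => h / 2)%C (fun u _ => RtoC (/ 2) * Q u)%C); auto using ddir_const.
      apply (ddir_scal _ _ _ (fun u _ => Q u)). apply (HQ 1 (-1) (fun u _ => u) 1); auto. intros; ring.
    + apply (ddir_pull 1 (-1) 1 (-1) (-1) (tri x) (tri x) (vertical_int 0 G) (fun _ v => v) (fun u _ => u));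
        auto using tri_sym; try (intros; ring).
      apply (leibniz 0 (-1) (tri x) (tri x)); auto using tri_below, tri_convex, tri_sym. lra.
Qed.

Definition kernel_problem (x : R) (q : R -> C) (H : R -> R -> C) : Prop :=
  goursat x q (fun u => RtoC (/ 2) * q u)%C (fun _ => RtoC 0) H.

(** Differentiating [H] along the hypotenuse in two ways, from the assumed
    regularity and from the equations, and solving for [q]. *)
Lemma q_from_hypotenuse x q H n J : kernel_problem x q H ->
  (forall u, J u -> 0 <= u <= x) ->
  (forall u, J u -> forall d, 0 < d -> exists t, t <> 0 /\ Rabs t < d /\ J (u + t)) ->
  Creg (S n) J (fun u => H u (-1 * u + x)) ->
  Creg n J (fun u => volt q H u (-1 * u + x)) ->
  Creg n J (fun u => transpose (volt q (transpose H)) u (-1 * u + x)) ->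
  Creg n J q.
Proof.
  intros [_ [_ [_ [_ [_ [_ D3]]]]]] HJ Hacc Hk HA HB.
  destruct (Creg_S _ _ _ Hk) as [k' [D Hk']].
  apply Creg_ext with (fun u => 2 * ((k' u - volt q H u (-1 * u + x)%R)
    + transpose (volt q (transpose H)) u (-1 * u + x)%R))%C.
  - intros u Hu.
    rewrite (ddir_unique J (fun u => H u (-1 * u + x)) u (k' u)
      (1 * ((RtoC (/ 2) * q u + volt q H u (-1 * u + x)%R)
        - (0 + volt q (transpose H) (-1 * u + x)%R u)))%C); auto.
    + unfold transpose at 2. rewrite RtoC_inv by lra. field.
    + apply (ddir_pull 1 (-1) 1 0 1 (tri x) (fun u _ => J u) H (fun u _ => u)
        (fun u _ => -1 * u + x)); try (intros; ring).
      * intros y _ Hy. apply HJ in Hy. unfold tri. lra.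
      * apply D3. apply HJ in Hu. unfold tri. lra.
  - apply (Cdir_scal 1 0 n _ (fun u _ => (k' u - volt q H u (-1 * u + x)%R)
      + transpose (volt q (transpose H)) u (-1 * u + x)%R)%C).
    apply (Cdir_plus 1 0 n _ (fun u _ => k' u - volt q H u (-1 * u + x)%R)%C); [|exact HB].
    apply (Cdir_minus 1 0 n _ (fun u _ => k' u)); [exact Hk'|exact HA].
Qed.

Lemma q_regular_closed x q H n : 0 < x -> kernel_problem x q H ->
  Creg (S n) (cc_interval 0 x) (fun u => H u (-1 * u + x)) -> Creg n (cc_interval 0 x) q.
Proof.
  intros Hx HG. pose proof (goursat_transpose _ _ _ _ _ HG) as HG'. pose proof (cc_interval_in x) as HJ.
  assert (HL : forall u, cc_interval 0 x u -> inner (cc_interval 0 x) u (-1 * u + x))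
    by (unfold inner, cc_interval; intros; lra).
  induction n as [|n IH]; intros Hk; [apply HG|].
  assert (Hq : Creg n (cc_interval 0 x) q) by (apply IH; now apply Cdir_S).
  assert (Ha : Creg n (cc_interval 0 x) (fun u => RtoC (/ 2) * q u)%C).
  { apply (Cdir_scal 1 0 n _ (fun u _ => q u)). exact Hq. }
  assert (Hb : Creg n (cc_interval 0 x) (fun _ => RtoC 0)) by apply Creg_const.
  apply (q_from_hypotenuse x q H); auto.
  - intros u Hu d Hd. unfold cc_interval in *. destruct (Rle_dec (2 * u) x).
    + exists (Rmin d (x / 2) / 2). assert (0 < Rmin d (x / 2)) by (apply Rmin_glb_lt; lra).
      pose proof (Rmin_l d (x / 2)). pose proof (Rmin_r d (x / 2)). rewrite Rabs_right; lra.
    + exists (- (Rmin d (x / 2) / 2)). assert (0 < Rmin d (x / 2)) by (apply Rmin_glb_lt; lra).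
      pose proof (Rmin_l d (x / 2)). pose proof (Rmin_r d (x / 2)). rewrite Rabs_left; lra.
  - apply (Creg_line (S n) _ (inner (cc_interval 0 x)) (volt q H) (-1) x); auto.
    exact (volt_gain x _ n q _ _ H HJ Hq Ha Hb HG).
  - apply (Creg_line (S n) _ (inner (cc_interval 0 x)) (transpose (volt q (transpose H))) (-1) x); auto.
    apply Cdir_transpose; [apply inner_sym|].
    exact (volt_gain x _ n q _ _ (transpose H) HJ Hq Hb Ha HG').
Qed.

Lemma q_regular_open x q H n : kernel_problem x q H ->
  (forall d, 0 < d -> Creg (S n) (fun u => d < u < x - d) (fun u => H u (-1 * u + x))) ->
  Creg n (oo_interval 0 x) q.
Proof.
  intros HG. pose proof (goursat_transpose _ _ _ _ _ HG) as HG'. pose proof (oo_interval_in x) as HJ.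
  induction n as [|n IH]; intros Hk.
  { apply (Creg_sub 0 (cc_interval 0 x)); [unfold cc_interval, oo_interval; intros; lra|]. apply HG. }
  assert (Hq : Creg n (oo_interval 0 x) q) by (apply IH; intros; apply Cdir_S; now apply Hk).
  assert (Ha : Creg n (oo_interval 0 x) (fun u => RtoC (/ 2) * q u)%C).
  { apply (Cdir_scal 1 0 n _ (fun u _ => q u)). exact Hq. }
  assert (Hb : Creg n (oo_interval 0 x) (fun _ => RtoC 0)) by apply Creg_const.
  apply Creg_glue. intros d Hd.
  apply (q_from_hypotenuse x q H); auto.
  - intros; lra.
  - intros u Hu. now apply open_accum.
  - destruct (volt_hypotenuse_open x n q _ _ H d Hq Ha Hb HG Hd) as [eta [He HV]].
    apply (Creg_line (S n) _ _ (volt q H) (-1) x HV). unfold edge. intros; lra.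
  - destruct (volt_hypotenuse_open x n q _ _ (transpose H) d Hq Hb Ha HG' Hd) as [eta [He HV]].
    apply (Cdir_transpose _ _ _ (edge_sym _ _ _)) in HV.
    apply (Creg_line (S n) _ _ (transpose (volt q (transpose H))) (-1) x HV). unfold edge. intros; lra.
Qed.

(** * Bernstein's inequality *)

(** The mean over [M + 1] equidistant points is exact on trigonometric
    polynomials of degree at most [M], and replaces the integral over a period. *)
Definition mean (M : nat) (g : R -> R) : R :=
  / INR (S M) * sum_f_R0 (fun k => g (2 * PI * INR k / INR (S M))) M.

Lemma mean_plus M f g : mean M (fun t => f t + g t) = mean M f + mean M g.
Proof. unfold mean. rewrite sum_plus. ring. Qed.

Lemma mean_scal M a f : mean M (fun t => a * f t) = a * mean M f.
Proof.
  unfold mean. rewrite <- (Rmult_assoc a), (Rmult_comm a), Rmult_assoc. f_equal.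
  rewrite scal_sum. apply sum_eq. intros. ring.
Qed.

Lemma mean_ext M f g : (forall t, f t = g t) -> mean M f = mean M g.
Proof. intros E. unfold mean. f_equal. apply sum_eq. intros. apply E. Qed.

Lemma mean_le M f g : (forall t, f t <= g t) -> mean M f <= mean M g.
Proof.
  intros E. unfold mean. apply Rmult_le_compat_l.
  - apply Rlt_le, Rinv_0_lt_compat, lt_0_INR. lia.
  - apply sum_Rle. intros. apply E.
Qed.

Lemma mean_abs M f g : (forall t, Rabs (f t) <= g t) -> Rabs (mean M f) <= mean M g.
Proof.
  intros E. apply Rabs_le. split.
  - replace (- mean M g) with (mean M (fun t => -1 * g t)) by (rewrite mean_scal; ring).
    apply mean_le. intros t. specialize (E t). apply Rabs_le_between in E. lra.
  - apply mean_le. intros t. specialize (E t). apply Rabs_le_between in E. lra.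
Qed.

Lemma sum_cos (al : R) N : 2 * sin (al / 2) * sum_f_R0 (fun k => cos (INR k * al)) N
  = sin ((INR N + / 2) * al) + sin (al / 2).
Proof.
  induction N as [|N IH]; cbn [sum_f_R0].
  - simpl. rewrite Rmult_0_l, cos_0. replace ((0 + / 2) * al) with (al / 2) by field. ring.
  - rewrite Rmult_plus_distr_l, IH. rewrite S_INR.
    replace ((INR N + 1 + / 2) * al) with ((INR N + 1) * al + al / 2) by field.
    replace ((INR N + / 2) * al) with ((INR N + 1) * al - al / 2) by field.
    rewrite sin_plus, sin_minus. ring.
Qed.

Lemma sum_sin (al : R) N : 2 * sin (al / 2) * sum_f_R0 (fun k => sin (INR k * al)) N
  = cos (al / 2) - cos ((INR N + / 2) * al).
Proof.
  induction N as [|N IH]; cbn [sum_f_R0].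
  - simpl. rewrite Rmult_0_l, sin_0. replace ((0 + / 2) * al) with (al / 2) by field. ring.
  - rewrite Rmult_plus_distr_l, IH. rewrite S_INR.
    replace ((INR N + 1 + / 2) * al) with ((INR N + 1) * al + al / 2) by field.
    replace ((INR N + / 2) * al) with ((INR N + 1) * al - al / 2) by field.
    rewrite cos_plus, cos_minus. ring.
Qed.

Lemma mean_freq_nat M j : (0 < j <= M)%nat ->
  mean M (fun t => cos (INR j * t)) = 0 /\ mean M (fun t => sin (INR j * t)) = 0.
Proof.
  intros Hj. set (al := 2 * PI * INR j / INR (S M)).
  assert (HM : 0 < INR (S M)) by (apply lt_0_INR; lia).
  assert (Hj0 : 0 < INR j) by (apply lt_0_INR; lia).
  assert (HjM : INR j < INR (S M)) by (apply lt_INR; lia).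
  pose proof PI_RGT_0 as HPI.
  assert (Hal : al / 2 = PI * (INR j / INR (S M))) by (unfold al; field; lra).
  assert (Hfrac : 0 < INR j / INR (S M) < 1).
  { split; [now apply Rdiv_lt_0_compat|]. apply Rmult_lt_reg_r with (INR (S M)); [easy|].
    unfold Rdiv. rewrite Rmult_assoc, Rinv_l; lra. }
  assert (Hs : 0 < sin (al / 2)) by (apply sin_gt_0; rewrite Hal; nra).
  assert (E : (INR M + / 2) * al = - (al / 2) + 2 * INR j * PI).
  { unfold al. rewrite S_INR in *. field. lra. }
  assert (E2 : forall k, INR j * (2 * PI * INR k / INR (S M)) = INR k * al)
    by (intros; unfold al; field; lra).
  split; unfold mean; apply Rmult_eq_0_compat_l;
    apply Rmult_eq_reg_l with (2 * sin (al / 2)); try lra; rewrite Rmult_0_r.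
  - rewrite <- (sum_eq (fun k => cos (INR k * al))); [|intros; now rewrite E2].
    rewrite sum_cos, E, sin_period, sin_neg. ring.
  - rewrite <- (sum_eq (fun k => sin (INR k * al))); [|intros; now rewrite E2].
    rewrite sum_sin, E, cos_period, cos_neg. ring.
Qed.

Lemma mean_const M c : mean M (fun _ => c) = c.
Proof.
  unfold mean. rewrite sum_cte. field. apply not_0_INR. lia.
Qed.

Lemma mean_cos M z : (Z.abs z <= Z.of_nat M)%Z ->
  mean M (fun t => cos (IZR z * t)) = if Z.eq_dec z 0 then 1 else 0.
Proof.
  intros Hz. destruct (Z.eq_dec z 0) as [->|Hn].
  - rewrite (mean_ext M _ (fun _ => 1)); [apply mean_const|].
    intros t. now rewrite Rmult_0_l, cos_0.
  - rewrite <- (proj1 (mean_freq_nat M (Z.abs_nat z) ltac:(lia))).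
    apply mean_ext. intros t. rewrite INR_IZR_INZ. replace (Z.of_nat (Z.abs_nat z)) with (Z.abs z) by lia.
    destruct (Z.abs_eq_or_opp z) as [-> | ->]; [easy|].
    rewrite opp_IZR, Ropp_mult_distr_l_reverse. now rewrite cos_neg.
Qed.

Lemma mean_sin M z : (Z.abs z <= Z.of_nat M)%Z -> mean M (fun t => sin (IZR z * t)) = 0.
Proof.
  intros Hz. destruct (Z.eq_dec z 0) as [->|Hn].
  - rewrite (mean_ext M _ (fun _ => 0)); [apply mean_const|].
    intros t. now rewrite Rmult_0_l, sin_0.
  - pose proof (proj2 (mean_freq_nat M (Z.abs_nat z) ltac:(lia))) as H.
    rewrite INR_IZR_INZ in H. replace (Z.of_nat (Z.abs_nat z)) with (Z.abs z) in H by lia.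
    destruct (Z.abs_eq_or_opp z) as [E|E]; rewrite E in H; [easy|].
    rewrite (mean_ext M _ (fun t => -1 * sin (IZR (- z) * t))), mean_scal, H; [ring|].
    intros t. rewrite opp_IZR, Ropp_mult_distr_l_reverse, sin_neg. ring.
Qed.

(** Normalised so that [fejer n], the sum of the first [n] of these, has
    Fourier coefficients [n - |z|], with mean [n]. *)
Fixpoint dirichlet (j : nat) (t : R) : R :=
  match j with
  | O => 1
  | S i => dirichlet i t + 2 * cos (IZR (Z.of_nat j) * t)
  end.

Fixpoint fejer (n : nat) (t : R) : R :=
  match n with
  | O => 0
  | S m => fejer m t + dirichlet m t
  end.

Lemma cos_mult_2cos a b t :
  cos (IZR a * t) * (2 * cos (IZR b * t)) = cos (IZR (a + b) * t) + cos (IZR (a - b) * t).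
Proof.
  rewrite plus_IZR, minus_IZR, Rmult_plus_distr_r, Rmult_minus_distr_r, cos_plus, cos_minus. ring.
Qed.

Lemma sin_mult_2cos a b t :
  sin (IZR a * t) * (2 * cos (IZR b * t)) = sin (IZR (a + b) * t) + sin (IZR (a - b) * t).
Proof.
  rewrite plus_IZR, minus_IZR, Rmult_plus_distr_r, Rmult_minus_distr_r, sin_plus, sin_minus. ring.
Qed.

Lemma mean_cos_dirichlet M z j : (Z.abs z + Z.of_nat j <= Z.of_nat M)%Z ->
  mean M (fun t => cos (IZR z * t) * dirichlet j t)
  = if Z_le_gt_dec (Z.abs z) (Z.of_nat j) then 1 else 0.
Proof.
  induction j as [|j IH]; intros H; cbn [dirichlet].
  - rewrite (mean_ext M _ (fun t => cos (IZR z * t))) by (intros; ring).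
    rewrite mean_cos by lia. destruct Z.eq_dec, Z_le_gt_dec; lia || lra.
  - rewrite (mean_ext M _ (fun t => cos (IZR z * t) * dirichlet j t
      + (cos (IZR (z + Z.of_nat (S j)) * t) + cos (IZR (z - Z.of_nat (S j)) * t)))).
    2:{ intros t. rewrite <- cos_mult_2cos. ring. }
    rewrite !mean_plus, IH, !mean_cos by lia.
    destruct Z.eq_dec, Z.eq_dec, Z_le_gt_dec, Z_le_gt_dec; lia || lra.
Qed.

Lemma mean_sin_dirichlet M z j : (Z.abs z + Z.of_nat j <= Z.of_nat M)%Z ->
  mean M (fun t => sin (IZR z * t) * dirichlet j t) = 0.
Proof.
  induction j as [|j IH]; intros H; cbn [dirichlet].
  - rewrite (mean_ext M _ (fun t => sin (IZR z * t))) by (intros; ring).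
    apply mean_sin. lia.
  - rewrite (mean_ext M _ (fun t => sin (IZR z * t) * dirichlet j t
      + (sin (IZR (z + Z.of_nat (S j)) * t) + sin (IZR (z - Z.of_nat (S j)) * t)))).
    2:{ intros t. rewrite <- sin_mult_2cos. ring. }
    rewrite !mean_plus, IH, !mean_sin by lia. ring.
Qed.

(** The Fourier coefficients of Fejer's kernel. *)
Lemma mean_cos_fejer M z n : (Z.abs z + Z.of_nat n <= Z.of_nat M)%Z ->
  mean M (fun t => cos (IZR z * t) * fejer n t) = IZR (Z.max 0 (Z.of_nat n - Z.abs z)).
Proof.
  induction n as [|n IH]; intros H; cbn [fejer].
  - rewrite (mean_ext M _ (fun _ => 0)) by (intros; ring). rewrite mean_const.
    f_equal. lia.
  - rewrite (mean_ext M _ (fun t => cos (IZR z * t) * fejer n t + cos (IZR z * t) * dirichlet n t))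
      by (intros; ring).
    rewrite mean_plus, IH, mean_cos_dirichlet by lia.
    destruct Z_le_gt_dec; [rewrite <- plus_IZR|rewrite Rplus_0_r]; f_equal; lia.
Qed.

Lemma mean_sin_fejer M z n : (Z.abs z + Z.of_nat n <= Z.of_nat M)%Z ->
  mean M (fun t => sin (IZR z * t) * fejer n t) = 0.
Proof.
  induction n as [|n IH]; intros H; cbn [fejer].
  - rewrite (mean_ext M _ (fun _ => 0)) by (intros; ring). apply mean_const.
  - rewrite (mean_ext M _ (fun t => sin (IZR z * t) * fejer n t + sin (IZR z * t) * dirichlet n t))
      by (intros; ring).
    rewrite mean_plus, IH, mean_sin_dirichlet by lia. ring.
Qed.

Lemma dirichlet_closed j t :
  (1 - cos t) * dirichlet j t = cos (IZR (Z.of_nat j) * t) - cos (IZR (Z.of_nat (S j)) * t).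
Proof.
  induction j as [|j IH]; cbn [dirichlet].
  - simpl. rewrite Rmult_0_l, cos_0, Rmult_1_l. ring.
  - rewrite Rmult_plus_distr_l, IH.
    pose proof (cos_mult_2cos (Z.of_nat (S j)) 1 t) as H. rewrite Rmult_1_l in H.
    replace (Z.of_nat (S j) + 1)%Z with (Z.of_nat (S (S j))) in H by lia.
    replace (Z.of_nat (S j) - 1)%Z with (Z.of_nat j) in H by lia. lra.
Qed.

Lemma fejer_closed n t : (1 - cos t) * fejer n t = 1 - cos (IZR (Z.of_nat n) * t).
Proof.
  induction n as [|n IH]; cbn [fejer].
  - simpl. rewrite Rmult_0_l, cos_0. ring.
  - rewrite Rmult_plus_distr_l, IH, dirichlet_closed. ring.
Qed.

Lemma fejer_nonneg n t : 0 <= fejer n t.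
Proof.
  destruct (Req_dec (cos t) 1) as [E|E].
  - assert (Hs : sin t = 0).
    { pose proof (sin2_cos2 t) as H. rewrite E in H. unfold Rsqr in H. nra. }
    assert (Hk : forall j, cos (IZR (Z.of_nat j) * t) = 1 /\ sin (IZR (Z.of_nat j) * t) = 0).
    { induction j as [|j [C D]].
      - simpl. rewrite Rmult_0_l, cos_0, sin_0. auto.
      - rewrite Nat2Z.inj_succ, succ_IZR, Rmult_plus_distr_r, Rmult_1_l, cos_plus, sin_plus.
        rewrite C, D, E, Hs. lra. }
    assert (HD : forall j, 0 <= dirichlet j t).
    { induction j as [|j IH]; cbn [dirichlet]; [lra|]. rewrite (proj1 (Hk (S j))). lra. }
    induction n as [|n IH]; cbn [fejer]; [lra|]. specialize (HD n). lra.
  - pose proof (fejer_closed n t). pose proof (COS_bound t).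
    pose proof (COS_bound (IZR (Z.of_nat n) * t)). 
    destruct (Rle_dec 0 (fejer n t)); [easy|]. nra.
Qed.

Fixpoint trig (n : nat) (T : R -> R) : Prop :=
  match n with
  | O => exists c, forall t, T t = c
  | S m => exists a b U, trig m U /\
      forall t, T t = U t + (a * cos (IZR (Z.of_nat n) * t) + b * sin (IZR (Z.of_nat n) * t))
  end.

Lemma trig_S n T : trig n T -> trig (S n) T.
Proof. intros H. exists 0, 0, T. split; auto. intros; ring. Qed.

Lemma trig_le m n T : (m <= n)%nat -> trig m T -> trig n T.
Proof. induction 1; auto using trig_S. Qed.

Lemma trig_plus n T U : trig n T -> trig n U -> trig n (fun t => T t + U t).
Proof.
  revert T U. induction n as [|n IH]; intros T U.
  - intros [c Hc] [d Hd]. exists (c + d). intros. now rewrite Hc, Hd.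
  - intros [a [b [V [HV E]]]] [a' [b' [V' [HV' E']]]].
    exists (a + a'), (b + b'), (fun t => V t + V' t). split; auto.
    intros t. rewrite E, E'. ring.
Qed.

Lemma trig_scal n c T : trig n T -> trig n (fun t => c * T t).
Proof.
  revert T. induction n as [|n IH]; intros T.
  - intros [d Hd]. exists (c * d). intros. now rewrite Hd.
  - intros [a [b [V [HV E]]]]. exists (c * a), (c * b), (fun t => c * V t). split; auto.
    intros t. rewrite E. ring.
Qed.

Lemma trig_ext n T U : (forall t, T t = U t) -> trig n T -> trig n U.
Proof.
  intros HE. destruct n.
  - intros [c Hc]. exists c. intros. now rewrite <- HE.
  - intros [a [b [V [HV E]]]]. exists a, b, V. split; auto. intros t. now rewrite <- HE.
Qed.

Lemma trig_freq n a b :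
  trig n (fun t => a * cos (IZR (Z.of_nat n) * t) + b * sin (IZR (Z.of_nat n) * t)).
Proof.
  destruct n.
  - exists a. intros t. simpl. rewrite Rmult_0_l, cos_0, sin_0. ring.
  - exists a, b, (fun _ => 0). split; [|intros; ring].
    apply (trig_le 0); [lia|]. now exists 0.
Qed.

Lemma trig_mult_cos n T : trig n T -> trig (S n) (fun t => cos t * T t).
Proof.
  revert T. induction n as [|n IH]; intros T.
  - intros [c Hc]. exists c, 0, (fun _ => 0). split; [now exists 0|].
    intros t. rewrite Hc. simpl. rewrite Rmult_1_l. ring.
  - intros [a [b [V [HV E]]]].
    apply trig_ext with (fun t => cos t * V t +
      ((a / 2 * cos (IZR (Z.of_nat (S (S n))) * t) + b / 2 * sin (IZR (Z.of_nat (S (S n))) * t))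
       + (a / 2 * cos (IZR (Z.of_nat n) * t) + b / 2 * sin (IZR (Z.of_nat n) * t)))).
    + intros t. rewrite E.
      pose proof (cos_mult_2cos (Z.of_nat (S n)) 1 t) as H1.
      pose proof (sin_mult_2cos (Z.of_nat (S n)) 1 t) as H2. rewrite Rmult_1_l in H1, H2.
      replace (Z.of_nat (S n) + 1)%Z with (Z.of_nat (S (S n))) in H1, H2 by lia.
      replace (Z.of_nat (S n) - 1)%Z with (Z.of_nat n) in H1, H2 by lia.
      replace (cos (IZR (Z.of_nat (S (S n))) * t)) with (cos (IZR (Z.of_nat (S n)) * t) * (2 * cos t)
        - cos (IZR (Z.of_nat n) * t)) by lra.
      replace (sin (IZR (Z.of_nat (S (S n))) * t)) with (sin (IZR (Z.of_nat (S n)) * t) * (2 * cos t)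
        - sin (IZR (Z.of_nat n) * t)) by lra.
      field.
    + apply trig_plus; [apply trig_S; auto|]. apply trig_plus; [apply trig_freq|].
      apply (trig_le n); [lia|]. apply trig_freq.
Qed.

(** [3 * n] exceeds the degree of the product: at most [n] for [T], [n] for the
    sine and [n - 1] for Fejer's kernel. *)
Definition bernstein_mean (n : nat) (T : R -> R) (s : R) : R :=
  mean (3 * n) (fun t => T (s + t) * (2 * sin (IZR (Z.of_nat n) * t) * fejer n t)).

(** Multiplying by [2 * sin (n t)] shifts the frequency [k] to [n - k] and
    [n + k]; Fejer's kernel weighs them by [n - (n - k) = k] and [0], which is
    what differentiation does. *)
Lemma bernstein_mean_freq n k a b s : (k <= n)%nat ->
  bernstein_mean n (fun t => a * cos (IZR (Z.of_nat k) * t) + b * sin (IZR (Z.of_nat k) * t)) s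
  = IZR (Z.of_nat k) * (b * cos (IZR (Z.of_nat k) * s) - a * sin (IZR (Z.of_nat k) * s)).
Proof.
  intros Hk. unfold bernstein_mean.
  set (zk := Z.of_nat k). set (zn := Z.of_nat n).
  set (p := a * cos (IZR zk * s) + b * sin (IZR zk * s)).
  set (r := b * cos (IZR zk * s) - a * sin (IZR zk * s)).
  rewrite (mean_ext _ _ (fun t =>
    p * (sin (IZR (zn + zk) * t) * fejer n t) + (p * (sin (IZR (zn - zk) * t) * fejer n t)
    + (r * (cos (IZR (zn - zk) * t) * fejer n t) + (- r) * (cos (IZR (zn + zk) * t) * fejer n t))))).
  - rewrite !mean_plus, !mean_scal.
    rewrite !mean_sin_fejer, !mean_cos_fejer by (unfold zk, zn; lia).
    replace (Z.max 0 (Z.of_nat n - Z.abs (zn - zk))) with zk by (unfold zk, zn; lia).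
    replace (Z.max 0 (Z.of_nat n - Z.abs (zn + zk))) with 0%Z by (unfold zk, zn; lia).
    ring.
  - intros t. rewrite plus_IZR, minus_IZR.
    replace (IZR zk * (s + t)) with (IZR zk * s + IZR zk * t) by ring.
    replace ((IZR zn + IZR zk) * t) with (IZR zn * t + IZR zk * t) by ring.
    replace ((IZR zn - IZR zk) * t) with (IZR zn * t - IZR zk * t) by ring.
    rewrite !cos_plus, !sin_plus, !cos_minus, !sin_minus. unfold p, r. ring.
Qed.

Lemma is_derive_freq z a b s :
  is_derive (fun t => a * cos (IZR z * t) + b * sin (IZR z * t)) s
    (IZR z * (b * cos (IZR z * s) - a * sin (IZR z * s))).
Proof. auto_derive; auto. ring. Qed.

Lemma bernstein_mean_derive m n T s : (m <= n)%nat -> trig m T ->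
  is_derive T s (bernstein_mean n T s).
Proof.
  revert T. induction m as [|m IH]; intros T Hm.
  - intros [c Hc].
    apply (is_derive_ext (fun t => c * cos (IZR (Z.of_nat 0) * t) + 0 * sin (IZR (Z.of_nat 0) * t))).
    { intros t. rewrite Hc. simpl. rewrite Rmult_0_l, cos_0, sin_0. ring. }
    replace (bernstein_mean n T s) with (bernstein_mean n
      (fun t => c * cos (IZR (Z.of_nat 0) * t) + 0 * sin (IZR (Z.of_nat 0) * t)) s).
    + rewrite bernstein_mean_freq by lia. apply is_derive_freq.
    + apply mean_ext. intros t. rewrite Hc. simpl. rewrite !Rmult_0_l, cos_0. ring.
  - intros [a [b [V [HV E]]]].
    apply (is_derive_ext (fun t => V t + (a * cos (IZR (Z.of_nat (S m)) * t) + b * sin (IZR (Z.of_nat (S m)) * t)))).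
    { intros t. now rewrite E. }
    replace (bernstein_mean n T s) with (bernstein_mean n V s + bernstein_mean n
      (fun t => a * cos (IZR (Z.of_nat (S m)) * t) + b * sin (IZR (Z.of_nat (S m)) * t)) s).
    + apply (is_derive_plus V); [apply IH; auto; lia|].
      rewrite bernstein_mean_freq by lia. apply is_derive_freq.
    + unfold bernstein_mean. rewrite <- mean_plus. apply mean_ext. intros t. rewrite E. ring.
Qed.

(** The derivative is a mean of [T] against a kernel bounded by twice Fejer's,
    which is nonnegative of mean [n]. *)
Lemma bernstein n T B s l : trig n T -> (forall t, Rabs (T t) <= B) -> is_derive T s l ->
  Rabs l <= 2 * INR n * B.
Proof.
  intros HT HB Hl.
  rewrite <- (is_derive_unique _ _ _ Hl).
  rewrite (is_derive_unique _ _ _ (bernstein_mean_derive n n T s (le_n _) HT)).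
  replace (2 * INR n * B) with (mean (3 * n) (fun t => 2 * B * (cos (IZR 0 * t) * fejer n t))).
  - apply mean_abs. intros t. rewrite !Rabs_mult, Rmult_0_l, cos_0, Rmult_1_l.
    rewrite (Rabs_right (fejer n t)) by (apply Rle_ge, fejer_nonneg).
    rewrite (Rabs_right 2) by lra.
    pose proof (fejer_nonneg n t). specialize (HB (s + t)). pose proof (Rabs_pos (T (s + t))).
    pose proof (SIN_bound (IZR (Z.of_nat n) * t)) as Hs. apply Rabs_le_between in Hs.
    pose proof (Rabs_pos (sin (IZR (Z.of_nat n) * t))).
    assert (Rabs (T (s + t)) * Rabs (sin (IZR (Z.of_nat n) * t)) <= B * 1)
      by (apply Rmult_le_compat; lra).
    nra.
  - rewrite mean_scal, mean_cos_fejer by lia.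
    replace (Z.max 0 (Z.of_nat n - Z.abs 0)) with (Z.of_nat n) by lia.
    rewrite <- INR_IZR_INZ. ring.
Qed.

Lemma trig_derive n T : trig n T -> exists U, trig n U /\ forall s, is_derive T s (U s).
Proof.
  revert T. induction n as [|n IH]; intros T.
  - intros [c Hc]. exists (fun _ => 0). split; [now exists 0|]. intros s.
    apply (is_derive_ext (fun _ => c)); [auto|]. apply (@is_derive_const R_AbsRing R_NormedModule).
  - intros [a [b [V [HV E]]]]. destruct (IH V HV) as [U [HU D]].
    set (z := Z.of_nat (S n)) in *.
    exists (fun s => U s + IZR z * (b * cos (IZR z * s) - a * sin (IZR z * s))). split.
    + exists (IZR z * b), (- IZR z * a), U. split; auto. intros s. fold z. ring.
    + intros s. apply (is_derive_ext (fun t => V t + (a * cos (IZR z * t) + b * sin (IZR z * t))));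
        [auto|]. apply (is_derive_plus V); auto using is_derive_freq.
Qed.

(** * Bernstein and Markov inequalities for polynomials *)

(** Horner's form makes closure under derivation and the substitution of
    [rho * cos t] direct inductions. *)
Fixpoint polyn (n : nat) (g : R -> R) : Prop :=
  match n with
  | O => exists c, forall y, g y = c
  | S m => exists c h, polyn m h /\ forall y, g y = c + y * h y
  end.

Lemma polyn_ext n f g : (forall y, f y = g y) -> polyn n f -> polyn n g.
Proof.
  intros HE. destruct n.
  - intros [c Hc]. exists c. intros. now rewrite <- HE.
  - intros [c [h [Hh E]]]. exists c, h. split; auto. intros y. now rewrite <- HE.
Qed.

Lemma polyn_S n g : polyn n g -> polyn (S n) g.
Proof.
  revert g. induction n as [|n IH]; intros g.
  - intros [c Hc]. exists c, (fun _ => 0). split; [now exists 0|]. intros y. rewrite Hc. ring.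
  - intros [c [h [Hh E]]]. exists c, h. split; [now apply IH|easy].
Qed.

Lemma polyn_le m n g : (m <= n)%nat -> polyn m g -> polyn n g.
Proof. induction 1; auto using polyn_S. Qed.

Lemma polyn_plus n f g : polyn n f -> polyn n g -> polyn n (fun y => f y + g y).
Proof.
  revert f g. induction n as [|n IH]; intros f g.
  - intros [c Hc] [d Hd]. exists (c + d). intros. now rewrite Hc, Hd.
  - intros [c [h [Hh E]]] [c' [h' [Hh' E']]]. exists (c + c'), (fun y => h y + h' y).
    split; auto. intros y. rewrite E, E'. ring.
Qed.

Lemma polyn_scal n a f : polyn n f -> polyn n (fun y => a * f y).
Proof.
  revert f. induction n as [|n IH]; intros f.
  - intros [c Hc]. exists (a * c). intros. now rewrite Hc.
  - intros [c [h [Hh E]]]. exists (a * c), (fun y => a * h y).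
    split; auto. intros y. rewrite E. ring.
Qed.

Lemma polyn_mulX n f : polyn n f -> polyn (S n) (fun y => y * f y).
Proof. intros H. exists 0, f. split; auto. intros; ring. Qed.

Lemma polyn_derive_ex n g : polyn n g -> exists g', polyn n g' /\ forall y, is_derive g y (g' y).
Proof.
  revert g. induction n as [|n IH]; intros g.
  - intros [c Hc]. exists (fun _ => 0). split; [now exists 0|]. intros y.
    apply (is_derive_ext (fun _ => c)); [auto|]. apply (@is_derive_const R_AbsRing R_NormedModule).
  - intros [c [h [Hh E]]]. destruct (IH h Hh) as [h' [Hh' D]].
    exists (fun y => h y + y * h' y). split.
    + apply polyn_plus; [now apply polyn_S|now apply polyn_mulX].
    + intros y. apply (is_derive_ext (fun y => c + y * h y)); [auto|].
      specialize (D y). auto_derive; [now exists (h' y)|].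
      replace (Derive (fun x : R => h x) y) with (h' y) by (symmetry; now apply is_derive_unique). ring.
Qed.

Lemma polyn_Derive n g : polyn n g -> polyn n (Derive g).
Proof.
  intros H. destruct (polyn_derive_ex n g H) as [g' [Hg' D]].
  apply (polyn_ext n g'); auto. intros y. symmetry. now apply is_derive_unique.
Qed.

Lemma polyn_is_derive n g y : polyn n g -> is_derive g y (Derive g y).
Proof.
  intros H. destruct (polyn_derive_ex n g H) as [g' [Hg' D]].
  apply Derive_correct. now exists (g' y).
Qed.

Lemma polyn_Derive_n n g j : polyn n g -> polyn n (Derive_n g j).
Proof. intros H. induction j; simpl; auto using polyn_Derive. Qed.

Lemma polyn_Derive_n_minus n f g j y : polyn n f -> polyn n g ->
  Derive_n (fun y => f y - g y) j y = Derive_n f j y - Derive_n g j y.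
Proof.
  intros Hf Hg. revert y. induction j as [|j IH]; intros y; simpl; auto.
  rewrite (Derive_ext _ _ _ IH). apply Derive_minus.
  - exists (Derive (Derive_n f j) y). apply (polyn_is_derive n). now apply polyn_Derive_n.
  - exists (Derive (Derive_n g j) y). apply (polyn_is_derive n). now apply polyn_Derive_n.
Qed.

Lemma polyn_trig n g rho : polyn n g -> trig n (fun t => g (rho * cos t)).
Proof.
  revert g. induction n as [|n IH]; intros g.
  - intros [c Hc]. exists c. intros; apply Hc.
  - intros [c [h [Hh E]]].
    apply trig_ext with (fun t => c + rho * (cos t * h (rho * cos t))).
    { intros t. rewrite E. ring. }
    apply trig_plus; [apply (trig_le 0); [lia|now exists c]|].
    apply trig_scal. apply trig_mult_cos. auto.
Qed.

Lemma circle_bound rho t : 0 <= rho -> - rho <= rho * cos t <= rho.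
Proof. intros H. pose proof (COS_bound t). nra. Qed.

(** Bernstein's inequality on [[-rho, rho]], after the substitution
    [y = rho * cos t]. *)
Lemma bernstein_polyn n g rho B y : 0 < rho -> polyn n g ->
  (forall y, - rho <= y <= rho -> Rabs (g y) <= B) -> - rho <= y <= rho ->
  sqrt (rho ^ 2 - y ^ 2) * Rabs (Derive g y) <= 2 * INR n * B.
Proof.
  intros Hr Hg HB Hy.
  set (t := acos (y / rho)).
  assert (Hyr : -1 <= y / rho <= 1).
  { split; apply Rmult_le_reg_r with rho; auto; unfold Rdiv; rewrite Rmult_assoc, Rinv_l; lra. }
  assert (Ec : rho * cos t = y) by (unfold t; rewrite cos_acos by easy; field; lra).
  assert (Es : sqrt (rho ^ 2 - y ^ 2) = rho * sin t).
  { unfold t. rewrite sin_acos by easy.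
    rewrite <- (sqrt_pow2 rho) at 2 by lra. rewrite <- sqrt_mult by (unfold Rsqr; nra).
    f_equal. unfold Rsqr. field. lra. }
  rewrite Es.
  assert (Hs : 0 <= sin t).
  { unfold t. destruct (acos_bound (y / rho)). apply sin_ge_0; lra. }
  rewrite <- (Rabs_right (rho * sin t)) by nra. rewrite <- Rabs_mult.
  rewrite <- (Rabs_Ropp (rho * sin t * Derive g y)).
  apply (bernstein n (fun t => g (rho * cos t)) B t).
  - now apply polyn_trig.
  - intros s. apply HB, circle_bound. lra.
  - replace (- (rho * sin t * Derive g y)) with ((- (rho * sin t)) * Derive g (rho * cos t))
      by (rewrite Ec; ring).
    apply (is_derive_comp g (fun t => rho * cos t)).
    + now apply (polyn_is_derive n).
    + auto_derive; auto. ring.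
Qed.

(** Markov's inequality, with a crude constant.  Where [|g'|] is maximal on
    [[-1, 1]], either [y = cos t] is an endpoint or [g''] vanishes; in both
    cases [T = g o cos] satisfies [T' = - sin t * g'] and [T'' = - cos t * g']
    there, so that two applications of Bernstein's inequality suffice. *)
Lemma markov n g B y : (1 <= n)%nat -> polyn n g ->
  (forall y, -1 <= y <= 1 -> Rabs (g y) <= B) -> -1 <= y <= 1 ->
  Rabs (Derive g y) <= 6 * INR n ^ 2 * B.
Proof.
  intros Hn Hg HB Hy.
  assert (Hg' : polyn n (Derive g)) by now apply polyn_Derive.
  assert (HB0 : 0 <= B).
  { eapply Rle_trans; [apply Rabs_pos|]. apply (HB 0). lra. }
  assert (Hn1 : 1 <= INR n) by (apply (le_INR 1); lia).
  destruct (continuity_ab_maj (fun z => (Derive g z) ^ 2) (-1) 1) as [y0 [Hmax Hy0]]; [lra| |].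
  { intros c _. apply continuity_pt_filterlim.
    apply (ex_derive_continuous (fun z => Derive g z ^ 2)).
    exists (INR 2 * Derive (Derive g) c * Derive g c ^ 1). apply is_derive_pow.
    now apply (polyn_is_derive n). }
  assert (Hle : Rabs (Derive g y) <= Rabs (Derive g y0)).
  { apply Rsqr_le_abs_0. specialize (Hmax y Hy). simpl in Hmax. unfold Rsqr. lra. }
  eapply Rle_trans; [exact Hle|].
  set (t := acos y0).
  assert (Ec : cos t = y0) by (unfold t; now rewrite cos_acos).
  set (T := fun s => g (1 * cos s)).
  set (T1 := fun s => - sin s * Derive g (cos s)).
  assert (HT : trig n T) by now apply polyn_trig.
  assert (D1 : forall s, is_derive T s (T1 s)).
  { intros s. unfold T1. apply (is_derive_ext (fun s => g (cos s))).
    { intros r. unfold T. now rewrite Rmult_1_l. }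
    apply (is_derive_comp g cos).
    - now apply (polyn_is_derive n).
    - apply is_derive_cos. }
  assert (B1 : forall s, Rabs (T1 s) <= 2 * INR n * B).
  { intros s. apply (bernstein n T B s); auto. intros r. apply HB.
    rewrite Rmult_1_l. apply COS_bound. }
  assert (HT1 : trig n T1).
  { destruct (trig_derive n T HT) as [U [HU DU]].
    apply (trig_ext n U); auto. intros s.
    rewrite <- (is_derive_unique _ _ _ (DU s)). apply is_derive_unique. auto. }
  set (l2 := - cos t * Derive g (cos t) + sin t ^ 2 * Derive (Derive g) (cos t)).
  assert (D2 : is_derive T1 t l2).
  { unfold T1, l2.
    apply (is_derive_ext (fun s => (- sin s) * ((fun s => Derive g (cos s)) s))); [auto|].
    replace (- cos t * Derive g (cos t) + sin t ^ 2 * Derive (Derive g) (cos t))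
      with ((- cos t) * Derive g (cos t) + (- sin t) * ((- sin t) * Derive (Derive g) (cos t))) by ring.
    apply (is_derive_mult (fun s => - sin s) (fun s => Derive g (cos s))).
    - auto_derive; auto. ring.
    - apply (is_derive_comp (Derive g) cos).
      + now apply (polyn_is_derive n).
      + apply is_derive_cos.
    - intros; apply Rmult_comm. }
  pose proof (bernstein n T1 _ t l2 HT1 B1 D2) as B2. specialize (B1 t).
  set (G := Derive g y0) in *.
  assert (Z : sin t ^ 2 * (Derive (Derive g) y0 * G) = 0).
  { destruct (Req_dec (Rabs y0) 1) as [E|E].
    - replace (sin t ^ 2) with 0; [ring|].
      pose proof (sin2_cos2 t) as S. rewrite Ec in S. unfold Rsqr in S.
      assert (y0 * y0 = 1) by (unfold Rabs in E; destruct Rcase_abs; nra). simpl. lra.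
    - assert (Hin : -1 < y0 < 1) by (unfold Rabs in E; destruct Rcase_abs; lra).
      assert (D : is_derive (fun z => Derive g z ^ 2) y0 (INR 2 * Derive (Derive g) y0 * G ^ 1)).
      { apply is_derive_pow. now apply (polyn_is_derive n). }
      apply is_derive_Reals in D.
      assert (pr : derivable_pt (fun z => Derive g z ^ 2) y0) by (eexists; exact D).
      pose proof (deriv_maximum (fun z => Derive g z ^ 2) (-1) 1 y0 pr
        (proj1 Hin) (proj2 Hin)) as M.
      rewrite (derive_pt_eq_0 _ _ _ pr D) in M.
      assert (X : INR 2 * Derive (Derive g) y0 * G ^ 1 = 0).
      { apply M. intros z Hz1 Hz2. apply Hmax. lra. }
      simpl in X. replace (Derive (Derive g) y0 * G) with 0 by lra. ring. }
  destruct (Req_dec G 0) as [E|E].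
  { rewrite E, Rabs_R0. nra. }
  assert (Z2 : sin t ^ 2 * Derive (Derive g) y0 = 0).
  { apply Rmult_eq_reg_r with G; auto. rewrite Rmult_0_l, <- Z. ring. }
  assert (El2 : l2 = - cos t * G) by (unfold l2; rewrite Ec, Z2; fold G; ring).
  unfold T1 in B1. rewrite El2, Ec in *. fold G in B1.
  rewrite Rabs_mult, Rabs_Ropp in B1, B2.
  assert (Hsc : 1 <= Rabs (sin t) + Rabs y0).
  { pose proof (sin2_cos2 t) as S. rewrite Ec in S. unfold Rsqr in S.
    pose proof (SIN_bound t).
    assert (A1 : sin t * sin t <= Rabs (sin t)) by (unfold Rabs; destruct Rcase_abs; nra).
    assert (A2 : y0 * y0 <= Rabs y0) by (unfold Rabs; destruct Rcase_abs; nra). lra. }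
  pose proof (Rabs_pos G).
  assert (Rabs G <= (Rabs (sin t) + Rabs y0) * Rabs G) by nra.
  assert (2 * INR n * B <= 2 * INR n ^ 2 * B).
  { apply Rmult_le_compat_r; [easy|]. simpl. nra. }
  replace (2 * INR n * (2 * INR n * B)) with (4 * INR n ^ 2 * B) in B2 by ring. lra.
Qed.

(** * The inverse approximation theorem *)

(** Each derivative is taken on a slightly smaller interval, so that the weight
    [sqrt (r1 ^ 2 - y ^ 2)] in Bernstein's inequality stays away from [0]. *)
Lemma rate_interior j : forall rho, 0 < rho < 1 -> exists C, 0 <= C /\
  forall n g B y, (1 <= n)%nat -> polyn n g ->
    (forall y, -1 <= y <= 1 -> Rabs (g y) <= B) -> - rho <= y <= rho ->
    Rabs (Derive_n g j y) <= C * INR n ^ j * B.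
Proof.
  induction j as [|j IH]; intros rho Hrho.
  - exists 1. split; [lra|]. intros n g B y _ _ HB Hy. simpl.
    replace (1 * 1 * B) with B by ring. apply HB. lra.
  - destruct (IH ((1 + rho) / 2)) as [C [HC H]]; [lra|].
    set (r1 := (1 + rho) / 2) in *.
    set (s := sqrt (r1 ^ 2 - rho ^ 2)).
    assert (Hs : 0 < s) by (apply sqrt_lt_R0; unfold r1; simpl; nra).
    exists (2 * C / s). split; [apply Rmult_le_pos; [lra|apply Rlt_le, Rinv_0_lt_compat; lra]|].
    intros n g B y Hn Hg HB Hy.
    assert (Hy1 : - r1 <= y <= r1) by (unfold r1 in *; lra).
    pose proof (bernstein_polyn n (Derive_n g j) r1 (C * INR n ^ j * B) y ltac:(unfold r1; lra)
      (polyn_Derive_n n g j Hg) (fun z Hz => H n g B z Hn Hg HB Hz) Hy1) as K.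
    assert (Hsy : s <= sqrt (r1 ^ 2 - y ^ 2)) by (apply sqrt_le_1_alt; simpl; nra).
    change (Derive_n g (S j) y) with (Derive (Derive_n g j) y).
    apply Rmult_le_reg_l with s; auto.
    replace (s * (2 * C / s * INR n ^ S j * B)) with (2 * INR n * (C * INR n ^ j * B))
      by (simpl; field; lra).
    eapply Rle_trans; [|exact K]. apply Rmult_le_compat_r; [apply Rabs_pos|easy].
Qed.

Lemma rate_closed j n g B y : (1 <= n)%nat -> polyn n g ->
  (forall y, -1 <= y <= 1 -> Rabs (g y) <= B) -> -1 <= y <= 1 ->
  Rabs (Derive_n g j y) <= 6 ^ j * INR n ^ (2 * j) * B.
Proof.
  intros Hn Hg HB. revert y. induction j as [|j IH]; intros y Hy.
  - simpl. rewrite !Rmult_1_l. auto.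
  - change (Derive_n g (S j) y) with (Derive (Derive_n g j) y).
    pose proof (markov n (Derive_n g j) _ y Hn (polyn_Derive_n n g j Hg) IH Hy) as K.
    eapply Rle_trans; [exact K|]. right.
    replace (2 * S j)%nat with (2 + 2 * j)%nat by lia. rewrite pow_add.
    change (6 ^ S j) with (6 * 6 ^ j). ring.
Qed.

(** The common form of the two inequalities: [r = p] when [rho < 1], and
    [r = p / 2] when [rho = 1], where each derivative costs [n ^ 2]. *)
Definition derivative_rate (p r : nat) (rho : R) : Prop :=
  exists C, 0 <= C /\ forall j n g B y, (j <= r)%nat -> (1 <= n)%nat -> polyn n g ->
    (forall y, -1 <= y <= 1 -> Rabs (g y) <= B) -> - rho <= y <= rho ->
    Rabs (Derive_n g j y) <= C * INR n ^ p * B.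

Lemma derivative_rate_of p r rho :
  (forall j, (j <= r)%nat -> exists C, 0 <= C /\ exists m, (m <= p)%nat /\
    forall n g B y, (1 <= n)%nat -> polyn n g ->
    (forall y, -1 <= y <= 1 -> Rabs (g y) <= B) -> - rho <= y <= rho ->
    Rabs (Derive_n g j y) <= C * INR n ^ m * B) -> derivative_rate p r rho.
Proof.
  intros H.
  assert (X : forall k, (k <= S r)%nat -> exists C, 0 <= C /\
    forall j n g B y, (j < k)%nat -> (1 <= n)%nat -> polyn n g ->
    (forall y, -1 <= y <= 1 -> Rabs (g y) <= B) -> - rho <= y <= rho ->
    Rabs (Derive_n g j y) <= C * INR n ^ p * B).
  { induction k as [|k IH]; intros Hk.
    - exists 0. split; [lra|]. intros; lia.
    - destruct (IH ltac:(lia)) as [C [HC K]].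
      destruct (H k ltac:(lia)) as [C' [HC' [m [Hm K']]]].
      exists (Rmax C C'). split; [eapply Rle_trans; [exact HC|apply Rmax_l]|].
      intros j n g B y Hj Hn Hg HB Hy.
      assert (HB0 : 0 <= B) by (eapply Rle_trans; [apply Rabs_pos|apply (HB 0); lra]).
      assert (Hn1 : 1 <= INR n) by (apply (le_INR 1); lia).
      pose proof (pow_R1_Rle (INR n) p Hn1).
      destruct (Nat.eq_dec j k) as [->|Hne].
      + eapply Rle_trans; [exact (K' n g B y Hn Hg HB Hy)|]. apply Rmult_le_compat_r; auto.
        apply Rmult_le_compat; auto; [apply pow_le; lra|apply Rmax_r|now apply Rle_pow].
      + eapply Rle_trans; [exact (K j n g B y ltac:(lia) Hn Hg HB Hy)|]. apply Rmult_le_compat_r; auto.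
        apply Rmult_le_compat_r; [lra|apply Rmax_l]. }
  destruct (X (S r) (le_n _)) as [C [HC K]]. exists C. split; auto.
  intros j n g B y Hj. apply K. lia.
Qed.

Lemma derivative_rate_closed p : derivative_rate p (Nat.div p 2) 1.
Proof.
  apply derivative_rate_of. intros j Hj. exists (6 ^ j). split; [apply pow_le; lra|].
  exists (2 * j)%nat. split.
  - pose proof (Nat.Div0.div_mod p 2). lia.
  - intros n g B y Hn Hg HB Hy. now apply rate_closed.
Qed.

Lemma derivative_rate_interior p rho : 0 < rho < 1 -> derivative_rate p p rho.
Proof.
  intros Hrho. apply derivative_rate_of. intros j Hj.
  destruct (rate_interior j rho Hrho) as [C [HC H]].
  exists C. split; auto. exists j. split; auto.
Qed.

Lemma geometric_limit a A la : 0 < la < 1 -> (forall i, Rabs (a (S i) - a i) <= A * la ^ i) ->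
  exists l : R, is_lim_seq a l /\ forall i, Rabs (a i - l) <= A / (1 - la) * la ^ i.
Proof.
  intros Hla Ha.
  assert (HA : 0 <= A).
  { specialize (Ha 0%nat). simpl in Ha. pose proof (Rabs_pos (a 1%nat - a 0%nat)). lra. }
  set (M := A / (1 - la)).
  assert (HM : 0 <= M) by (apply Rmult_le_pos; [easy|apply Rlt_le, Rinv_0_lt_compat; lra]).
  assert (HAM : A = M * (1 - la)) by (unfold M; field; lra).
  assert (Hpow : forall i, 0 <= la ^ i) by (intros; apply pow_le; lra).
  assert (T : forall i k, Rabs (a (k + i)%nat - a i) <= M * la ^ i * (1 - la ^ k)).
  { intros i k. induction k as [|k IH].
    - simpl. rewrite Rminus_diag, Rabs_R0. lra.
    - replace (a (S k + i)%nat - a i) with ((a (S (k + i)) - a (k + i)%nat) + (a (k + i)%nat - a i))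
        by (simpl; ring).
      eapply Rle_trans; [apply Rabs_triang|].
      specialize (Ha (k + i)%nat). rewrite pow_add in Ha. rewrite HAM in Ha.
      change (la ^ S k) with (la * la ^ k). lra. }
  assert (T' : forall i k, Rabs (a (k + i)%nat - a i) <= M * la ^ i).
  { intros i k. eapply Rle_trans; [apply T|]. specialize (Hpow i) as H1. specialize (Hpow k) as H2.
    assert (0 <= M * la ^ i) by nra. nra. }
  assert (Hex : ex_finite_lim_seq a).
  { apply ex_lim_seq_cauchy_corr. intros e.
    destruct (pow_lt_1_zero la ltac:(rewrite Rabs_right; lra) (e / (2 * (M + 1)))) as [N HN].
    { apply Rdiv_lt_0_compat; [apply cond_pos|lra]. }
    specialize (HN N (le_n _)). rewrite Rabs_right in HN by (apply Rle_ge; auto).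
    assert (HMN : M * la ^ N < e / 2).
    { apply Rle_lt_trans with ((M + 1) * la ^ N); [specialize (Hpow N); nra|].
      replace (e / 2) with ((M + 1) * (e / (2 * (M + 1)))) by (field; lra).
      apply Rmult_lt_compat_l; lra. }
    exists N. intros n m Hn Hm.
    pose proof (T' N (n - N)%nat) as E1. pose proof (T' N (m - N)%nat) as E2.
    rewrite Nat.sub_add in E1, E2 by easy.
    replace (a n - a m) with ((a n - a N) - (a m - a N)) by ring.
    eapply Rle_lt_trans; [apply Rabs_triang|]. rewrite Rabs_Ropp. lra. }
  destruct Hex as [l Hl]. exists l. split; auto. intros i.
  rewrite Rabs_minus_sym.
  assert (L : is_lim_seq (fun k => Rabs (a (k + i)%nat - a i)) (Rabs (l - a i))).
  { apply (is_lim_seq_abs _ (Finite (l - a i))). apply is_lim_seq_minus'.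
    - now apply -> (is_lim_seq_incr_n a i).
    - apply is_lim_seq_const. }
  exact (is_lim_seq_le _ _ (Finite _) (Finite _) (T' i) L (is_lim_seq_const _)).
Qed.

Lemma small_power (M la e : R) : 0 < la < 1 -> 0 < e -> exists i, M * la ^ i <= e.
Proof.
  intros Hla He.
  destruct (pow_lt_1_zero la ltac:(rewrite Rabs_right; lra) (e / (Rabs M + 1))) as [N HN].
  { pose proof (Rabs_pos M). apply Rdiv_lt_0_compat; lra. }
  exists N. specialize (HN N (le_n _)).
  assert (0 <= la ^ N) by (apply pow_le; lra). rewrite Rabs_right in HN by lra.
  pose proof (Rle_abs M). pose proof (Rabs_pos M).
  apply Rle_trans with ((Rabs M + 1) * la ^ N); [nra|].
  replace e with ((Rabs M + 1) * (e / (Rabs M + 1))) by (field; lra).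
  apply Rmult_le_compat_l; lra.
Qed.

Definition sym_interval (rho y : R) : Prop := - rho <= y <= rho.

Lemma uniform_limit_cont rho la M (f : nat -> R -> R) k : 0 < la < 1 ->
  (forall i y, continuity_pt (f i) y) ->
  (forall i y, sym_interval rho y -> Rabs (f i y - k y) <= M * la ^ i) ->
  forall y, sym_interval rho y -> forall e, 0 < e -> exists d, 0 < d /\
    forall z, sym_interval rho z -> Rabs (z - y) < d -> Rabs (k z - k y) < e.
Proof.
  intros Hla Hc Hf y Hy e He.
  destruct (small_power M la (e / 4) Hla) as [i Hi]; [lra|].
  destruct (Hc i y (e / 4)) as [d [Hd H]]; [lra|]. exists d. split; [easy|].
  intros z Hz Hzy.
  assert (A : Rabs (f i z - f i y) < e / 4).
  { destruct (Req_dec z y) as [->|Hn]; [rewrite Rminus_diag, Rabs_R0; lra|].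
    apply H. split; [split; [exact I|auto]|exact Hzy]. }
  pose proof (Hf i z Hz) as H1. pose proof (Hf i y Hy) as H2. rewrite Rabs_minus_sym in H1.
  replace (k z - k y) with ((k z - f i z) + ((f i z - f i y) + (f i y - k y))) by ring.
  eapply Rle_lt_trans; [apply Rabs_triang|].
  eapply Rle_lt_trans; [apply Rplus_le_compat_l, Rabs_triang|]. lra.
Qed.

Lemma Cmod_RtoC_diff (a b : R) : Cmod (a - b) = Rabs (a - b).
Proof. now rewrite <- RtoC_minus, Cmod_R. Qed.

(** All the derivatives converge uniformly, so that the limit may be
    differentiated term by term; the mean value theorem for [P i 0] is passed to
    the limit in [i]. *)
Lemma tower_limit rho la A : 0 < la < 1 -> forall r (P : nat -> nat -> R -> R) (k : R -> R),
  (forall i j y, is_derive (P i j) y (P i (S j) y)) ->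
  (forall i j y, (j <= r)%nat -> sym_interval rho y ->
     Rabs (P (S i) j y - P i j y) <= A * la ^ i) ->
  (forall y, sym_interval rho y -> is_lim_seq (fun i => P i 0%nat y) (k y)) ->
  Creg r (sym_interval rho) (fun y => RtoC (k y)).
Proof.
  intros Hla. set (M := A / (1 - la)).
  assert (Bnd : forall (P : nat -> nat -> R -> R) (k : R -> R) j,
    (forall i y, sym_interval rho y -> Rabs (P (S i) j y - P i j y) <= A * la ^ i) ->
    (forall y, sym_interval rho y -> is_lim_seq (fun i => P i j y) (k y)) ->
    forall i y, sym_interval rho y -> Rabs (P i j y - k y) <= M * la ^ i).
  { intros P k j HP Hk i y Hy.
    destruct (geometric_limit (fun i => P i j y) A la Hla) as [l [Hl Hb]]; [auto|].
    pose proof (is_lim_seq_unique _ _ Hl) as E1.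
    pose proof (is_lim_seq_unique _ _ (Hk y Hy)) as E2. rewrite E1 in E2.
    apply (f_equal real) in E2. simpl in E2. rewrite <- E2. apply Hb. }
  assert (Ctn : forall (P : nat -> nat -> R -> R), (forall i j y, is_derive (P i j) y (P i (S j) y)) ->
    forall i j y, continuity_pt (P i j) y).
  { intros P HD i j y. apply derivable_continuous_pt.
    exists (P i (S j) y). apply is_derive_Reals. apply HD. }
  induction r as [|r IH]; intros P k HD HP Hk.
  - split; auto. intros y v Hy e He.
    destruct (uniform_limit_cont rho la M (fun i => P i 0%nat) k Hla
      (fun i z => Ctn P HD i 0%nat z)
      (Bnd P k 0%nat (fun i z => HP i 0%nat z (le_n _)) Hk) y Hy e He) as [d [Hd H]].
    exists d. split; [easy|]. intros z w Hz Hzy _. rewrite Cmod_RtoC_diff. auto.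
  - set (k' := fun y => real (Lim_seq (fun i => P i 1%nat y))).
    assert (Hk' : forall y, sym_interval rho y -> is_lim_seq (fun i => P i 1%nat y) (k' y)).
    { intros y Hy. destruct (geometric_limit (fun i => P i 1%nat y) A la Hla) as [l [Hl _]].
      - intros i. apply HP; auto. lia.
      - unfold k'. now rewrite (is_lim_seq_unique _ _ Hl). }
    pose proof (IH (fun i j => P i (S j)) k' (fun i j y => HD i (S j) y)
      (fun i j y Hj => HP i (S j) y (le_n_S _ _ Hj)) Hk') as HC.
    pose proof (Cdir_cont _ _ _ _ _ (IH P k HD (fun i j y Hj => HP i j y (le_S _ _ Hj)) Hk)) as C0.
    split; [exact C0|]. exists (fun y _ => RtoC (k' y)). split; [|exact HC].
    assert (B0 : forall i y, sym_interval rho y -> Rabs (P i 0%nat y - k y) <= M * la ^ i).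
    { apply (Bnd P k 0%nat); auto. intros; apply HP; auto; lia. }
    assert (B1 : forall i y, sym_interval rho y -> Rabs (P i 1%nat y - k' y) <= M * la ^ i).
    { apply (Bnd P k' 1%nat); auto. intros; apply HP; auto; lia. }
    intros y v Hy e He.
    destruct (uniform_limit_cont rho la M (fun i => P i 1%nat) k' Hla
      (fun i z => Ctn P HD i 1%nat z) B1 y Hy e He) as [d [Hd H]].
    exists d. split; [easy|]. intros t Ht Hyt. rewrite Rmult_1_r in *.
    rewrite <- RtoC_mult, <- !RtoC_minus, Cmod_R.
    apply le_epsilon. intros e' He'.
    destruct (small_power M la (e' / (2 + Rabs t)) Hla) as [i Hi].
    { pose proof (Rabs_pos t). apply Rdiv_lt_0_compat; lra. }
    assert (Hi' : (2 + Rabs t) * (M * la ^ i) <= e').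
    { replace e' with ((2 + Rabs t) * (e' / (2 + Rabs t))) by (field; pose proof (Rabs_pos t); lra).
      apply Rmult_le_compat_l; [pose proof (Rabs_pos t); lra|easy]. }
    destruct (MVT_gen (P i 0%nat) y (y + t) (P i 1%nat)) as [c [Hc E]].
    { intros z _. apply HD. }
    { intros z _. now apply Ctn. }
    assert (Hcy : Rabs (c - y) <= Rabs t /\ sym_interval rho c).
    { unfold sym_interval in *. unfold Rmin, Rmax in Hc. destruct Rle_dec in Hc;
        split; try lra; unfold Rabs; repeat destruct Rcase_abs; lra. }
    destruct Hcy as [Hcy Hcr].
    replace (y + t - y) with t in E by ring.
    replace (k (y + t) - k y - t * k' y) with
      ((- (P i 0%nat (y + t) - k (y + t))) + ((P i 0%nat y - k y)
        + (t * (P i 1%nat c - k' c) + t * (k' c - k' y)))) by lra.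
    eapply Rle_trans; [apply Rabs_triang|].
    eapply Rle_trans; [apply Rplus_le_compat_l, Rabs_triang|].
    eapply Rle_trans; [do 2 apply Rplus_le_compat_l; apply Rabs_triang|].
    rewrite Rabs_Ropp, !Rabs_mult.
    pose proof (B0 i _ Hyt). pose proof (B0 i _ Hy). pose proof (B1 i _ Hcr).
    pose proof (H c Hcr ltac:(lra)). pose proof (Rabs_pos t).
    assert (Rabs t * Rabs (P i 1%nat c - k' c) <= Rabs t * (M * la ^ i)) by (apply Rmult_le_compat_l; lra).
    assert (Rabs t * Rabs (k' c - k' y) <= Rabs t * e) by (apply Rmult_le_compat_l; lra).
    lra.
Qed.

(** Dyadic degrees make the increments of the [j]-th derivatives geometric: the
    factor [N ^ p] lost by differentiation is regained from the rate, and
    [N ^ - eps] is left. *)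
Lemma inverse_approximation p r rho eps c (k : R -> R) (P : nat -> R -> R) :
  0 < rho <= 1 -> 0 < eps -> derivative_rate p r rho -> (forall N, polyn N (P N)) ->
  (forall N y, (p + 1 < N)%nat -> -1 <= y <= 1 ->
     Rabs (k y - P N y) <= c / Rpower (INR N) (INR p + eps)) ->
  Creg r (sym_interval rho) (fun y => RtoC (k y)).
Proof.
  intros Hrho Heps [C [HC Hrate]] HP Hk.
  set (la := Rpower 2 (- eps)).
  assert (Hla : 0 < la < 1).
  { split; [apply exp_pos|]. unfold la. rewrite <- (Rpower_O 2) by lra.
    apply Rpower_lt; lra. }
  (* The shift by [p + 2] makes all the degrees exceed [p + 1]. *)
  set (N := fun i => (2 ^ (i + (p + 2)))%nat).
  assert (HN : forall i, (p + 1 < N i)%nat).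
  { intros i. unfold N. apply Nat.lt_le_trans with (2 ^ (p + 2))%nat.
    - pose proof (Nat.pow_gt_lin_r 2 (p + 2) ltac:(lia)). lia.
    - apply Nat.pow_le_mono_r; lia. }
  assert (HNS : forall i, N (S i) = (2 * N i)%nat) by reflexivity.
  assert (HNpos : forall i, 1 <= INR (N i)) by (intros i; apply (le_INR 1); specialize (HN i); lia).
  assert (Hpow : forall i, Rpower (INR (N i)) (INR p + eps) * la ^ (i + (p + 2)) = INR (N i) ^ p).
  { intros i. rewrite Rpower_plus, Rpower_pow by (specialize (HNpos i); lra).
    rewrite Rmult_assoc. rewrite <- (Rmult_1_r (INR (N i) ^ p)) at 2. f_equal.
    unfold N, la. rewrite pow_INR. replace (INR 2) with 2 by (simpl; ring).
    rewrite <- !(Rpower_pow _ 2) by lra.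
    rewrite <- (Rpower_pow _ (Rpower 2 (- eps))) by apply exp_pos.
    rewrite !Rpower_mult, <- Rpower_plus.
    replace (INR (i + (p + 2)) * eps + - eps * INR (i + (p + 2))) with 0 by ring.
    apply Rpower_O. lra. }
  assert (HRpos : forall i, 0 < Rpower (INR (N i)) (INR p + eps)) by (intros; apply exp_pos).
  assert (Hc : 0 <= c).
  { assert (A : 0 <= c / Rpower (INR (N 0%nat)) (INR p + eps)).
    { eapply Rle_trans; [apply Rabs_pos|]. apply (Hk (N 0%nat) 0); [apply HN|lra]. }
    apply Rmult_le_reg_r with (/ Rpower (INR (N 0%nat)) (INR p + eps)).
    - now apply Rinv_0_lt_compat.
    - rewrite Rmult_0_l. exact A. }
  assert (Hstep : forall i y, -1 <= y <= 1 ->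
    Rabs (P (N (S i)) y - P (N i) y) <= 2 * c / Rpower (INR (N i)) (INR p + eps)).
  { intros i y Hy. pose proof (Hk (N i) y (HN i) Hy) as K1.
    pose proof (Hk (N (S i)) y (HN (S i)) Hy) as K2. rewrite Rabs_minus_sym in K2.
    assert (K3 : c / Rpower (INR (N (S i))) (INR p + eps) <= c / Rpower (INR (N i)) (INR p + eps)).
    { apply Rmult_le_compat_l; [easy|]. apply Rinv_le_contravar; auto.
      apply Rle_Rpower_l; [pose proof (pos_INR p); lra|]. split; [specialize (HNpos i); lra|].
      apply le_INR. rewrite HNS. lia. }
    replace (P (N (S i)) y - P (N i) y) with ((P (N (S i)) y - k y) + (k y - P (N i) y)) by ring.
    eapply Rle_trans; [apply Rabs_triang|]. unfold Rdiv in *. lra. }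
  assert (HpN : forall i, polyn (N (S i)) (P (N i))).
  { intros i. apply (polyn_le (N i)); auto. rewrite HNS. lia. }
  apply (tower_limit rho la (C * 2 ^ p * (2 * c) * la ^ (p + 2)) Hla r (fun i j => Derive_n (P (N i)) j) k).
  - intros i j y. change (Derive_n (P (N i)) (S j) y) with (Derive (Derive_n (P (N i)) j) y).
    apply (polyn_is_derive (N i)). now apply polyn_Derive_n.
  - intros i j y Hj Hy. rewrite <- (polyn_Derive_n_minus (N (S i))) by auto.
    eapply Rle_trans.
    + apply (Hrate j (N (S i)) _ (2 * c / Rpower (INR (N i)) (INR p + eps))); auto.
      * specialize (HN (S i)). lia.
      * apply (polyn_ext _ (fun y => P (N (S i)) y + -1 * P (N i) y)); [intros; ring|].
        apply polyn_plus; auto. now apply polyn_scal.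
    + right. rewrite HNS, mult_INR, Rpow_mult_distr, <- Hpow, pow_add.
      replace (INR 2) with 2 by (simpl; ring). field. specialize (HRpos i). lra.
  - intros y Hy.
    assert (Hy1 : -1 <= y <= 1) by (unfold sym_interval in Hy; lra).
    apply is_lim_seq_spec. intros e. simpl.
    destruct (small_power c la (e / 2) Hla) as [i0 Hi0]; [generalize (cond_pos e); lra|].
    exists i0. intros i Hi. rewrite Rabs_minus_sym.
    eapply Rle_lt_trans; [apply Hk; auto|].
    apply Rle_lt_trans with (c * la ^ i0); [|generalize (cond_pos e); lra].
    apply Rmult_le_compat_l; [easy|].
    apply Rmult_le_reg_l with (Rpower (INR (N i)) (INR p + eps)); auto.
    rewrite Rinv_r by (specialize (HRpos i); lra).
    apply Rle_trans with (INR (N i) ^ p); [apply pow_R1_Rle; auto|].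
    rewrite <- Hpow. apply Rmult_le_compat_l; [apply Rlt_le, HRpos|].
    replace (i + (p + 2))%nat with (i0 + (i - i0 + (p + 2)))%nat by lia.
    rewrite (pow_add la i0). rewrite <- (Rmult_1_r (la ^ i0)) at 2.
    apply Rmult_le_compat_l; [apply pow_le; lra|].
    rewrite <- (pow1 (i - i0 + (p + 2))). apply pow_incr. lra.
Qed.

(** * Kernel sections as limits of Legendre sums *)

Lemma legendre_polyn n : polyn n (legendre n) /\ polyn (S n) (legendre (S n)).
Proof.
  induction n as [|n [IH1 IH2]].
  - split; [now exists 1|]. exists 0, (fun _ => 1). split; [now exists 1|].
    intros y. cbn [legendre]. ring.
  - split; [exact IH2|].
    apply (polyn_ext _ (fun y => (2 * INR n + 3) / (INR n + 2) * (y * legendre (S n) y)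
      + - ((INR n + 1) / (INR n + 2)) * legendre n y)).
    + intros y. change (legendre (S (S n)) y) with
        (((2 * INR n + 3) * y * legendre (S n) y - (INR n + 1) * legendre n y) / (INR n + 2)).
      field. pose proof (pos_INR n). lra.
    + apply polyn_plus.
      * apply polyn_scal, polyn_mulX, IH2.
      * apply polyn_scal. apply (polyn_le n); [lia|easy].
Qed.

Lemma kernel_partial_sum_S f N x t : kernel_partial_sum f (S N) x t =
  (kernel_partial_sum f N x t + beta f (S N) x / x * legendre (S N) (t / x)%R)%C.
Proof. unfold kernel_partial_sum. now rewrite sum_Sn. Qed.

Lemma kernel_partial_sum_polyn f N x : 0 < x ->
  polyn N (fun y => fst (kernel_partial_sum f N x (x * y))) /\
  polyn N (fun y => snd (kernel_partial_sum f N x (x * y))).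
Proof.
  intros Hx. 
  assert (E : forall y, x * y / x = y) by (intros; field; lra).
  induction N as [|N [IH1 IH2]].
  - unfold kernel_partial_sum.
    split; [exists (fst (beta f 0 x / x)%C)|exists (snd (beta f 0 x / x)%C)];
      intros y; rewrite sum_O; cbn [legendre]; now rewrite Cmult_1_r.
  - set (w := (beta f (S N) x / x)%C).
    destruct (legendre_polyn N) as [_ HL].
    split.
    + apply (polyn_ext _ (fun y => fst (kernel_partial_sum f N x (x * y))
        + fst w * legendre (S N) y)).
      { intros y. rewrite kernel_partial_sum_S, E. fold w. cbn [fst snd Cplus Cmult RtoC]. ring. }
      apply polyn_plus; [now apply polyn_S|]. now apply polyn_scal.
    + apply (polyn_ext _ (fun y => snd (kernel_partial_sum f N x (x * y))
        + snd w * legendre (S N) y)).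
      { intros y. rewrite kernel_partial_sum_S, E. fold w. cbn [fst snd Cplus Cmult RtoC]. ring. }
      apply polyn_plus; [now apply polyn_S|]. now apply polyn_scal.
Qed.

Lemma Creg_parts r J g : Creg r J (fun y => RtoC (fst (g y))) -> Creg r J (fun y => RtoC (snd (g y))) ->
  Creg r J g.
Proof.
  intros H1 H2. apply Creg_ext with (fun y => RtoC (fst (g y)) + Ci * RtoC (snd (g y)))%C.
  - intros y _. destruct (g y) as [a b]. unfold Ci, RtoC, Cplus, Cmult. simpl. f_equal; ring.
  - apply (Cdir_plus 1 0 r _ (fun y _ => RtoC (fst (g y)))); [exact H1|].
    apply (Cdir_scal 1 0 r _ (fun y _ => RtoC (snd (g y)))). exact H2.
Qed.

Lemma kernel_section_regular f (K : R -> R -> C) x p r c eps rho :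
  0 < x -> 0 < rho <= 1 -> 0 < eps -> derivative_rate p r rho ->
  (forall (N : nat) (t : R), (p + 1 < N)%nat -> Rabs t <= x ->
       Cmod (K x t - kernel_partial_sum f N x t)%C <= c / Rpower (INR N) (INR p + eps)) ->
  Creg r (sym_interval rho) (fun y => K x (x * y)).
Proof.
  intros Hx Hrho Heps Hrate HK.
  assert (HK' : forall N y, (p + 1 < N)%nat -> -1 <= y <= 1 ->
    Cmod (K x (x * y)%R - kernel_partial_sum f N x (x * y)%R)%C <= c / Rpower (INR N) (INR p + eps)).
  { intros N y HN Hy. apply HK; auto. rewrite Rabs_mult, (Rabs_right x) by lra.
    assert (Rabs y <= 1) by (apply Rabs_le; lra). nra. }
  apply Creg_parts.
  - apply (inverse_approximation p r rho eps c (fun y => fst (K x (x * y)))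
      (fun N y => fst (kernel_partial_sum f N x (x * y)))); auto.
    + intros N. now apply kernel_partial_sum_polyn.
    + intros N y HN Hy. eapply Rle_trans; [|exact (HK' N y HN Hy)].
      apply (Rabs_fst_le (K x (x * y)%R - kernel_partial_sum f N x (x * y)%R)%C).
  - apply (inverse_approximation p r rho eps c (fun y => snd (K x (x * y)))
      (fun N y => snd (kernel_partial_sum f N x (x * y)))); auto.
    + intros N. now apply kernel_partial_sum_polyn.
    + intros N y HN Hy. eapply Rle_trans; [|exact (HK' N y HN Hy)].
      apply (Rabs_snd_le (K x (x * y)%R - kernel_partial_sum f N x (x * y)%R)%C).
Qed.

(** The hypotenuse of the triangle in the coordinates [u] and [v] is the section
    at [x], with [y = 2 * u / x - 1]. *)
Lemma hypotenuse_section (K : R -> R -> C) x r J rho : 0 < x ->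
  (forall u, J u -> sym_interval rho (2 / x * u + -1)) ->
  Creg r (sym_interval rho) (fun y => K x (x * y)) ->
  Creg r J (fun u => K (u + (-1 * u + x)) (u - (-1 * u + x))).
Proof.
  intros Hx HJ HK.
  apply Creg_ext with (fun u => K x (x * (2 / x * u + 0 * 0 + -1))).
  - intros u _. f_equal; field; lra.
  - apply (Cdir_ext 1 0 r _ (fun u v => K x (x * (2 / x * u + 0 * v + -1)))).
    { intros u v _. do 2 f_equal. ring. }
    apply (Creg_pull 1 0 (2 / x) 0 r (sym_interval rho) _ (fun y => K x (x * y)) (-1) HK).
    intros u v Hu. replace (2 / x * u + 0 * v + -1) with (2 / x * u + -1) by ring. auto.
Qed.

Theorem theorem3p6 (b : R) (hb : 0 < b)
    (q : R -> C) (hq : continuous_on (cc_interval 0 b) q)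
    (f f' : R -> C)
    (hf' : forall y, cc_interval 0 b y ->
             is_derive_on (cc_interval 0 b) f y (f' y))
    (hf'' : forall y, cc_interval 0 b y ->
             is_derive_on (cc_interval 0 b) f' y (q y * f y)%C)
    (hfnz : forall y, cc_interval 0 b y -> f y <> RtoC 0)
    (hf0 : f 0 = RtoC 1)
    (h : C) (hh : h = f' 0)
    (K : R -> R -> C) (hK : transmutation_kernel b q h K)
    (x : R) (hx : 0 < x <= b)
    (p : nat) (hp : (2 <= p)%nat) (c eps : R) (heps : 0 < eps)
    (hbound : forall (N : nat) (t : R), (p + 1 < N)%nat -> Rabs t <= x ->
       Cmod (K x t - kernel_partial_sum f N x t)%C
         <= c / Rpower (INR N) (INR p + eps)) :
  C_class (Nat.div p 2 - 1) (cc_interval 0 x) q /\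
  C_class (p - 1) (oo_interval 0 x) q.
Proof.
  assert (Hx0 : 0 < x) by lra.
  pose proof (kernel_goursat b q h K x hx hq hK) as HG.
  set (H := fun u v => K (u + v) (u - v)) in HG.
  assert (Hscale : forall u y, y = 2 / x * u + -1 -> x * y = 2 * u - x).
  { intros u y ->. field. lra. }
  split; apply Creg_C_class.
  - apply (q_regular_closed x q H); auto.
    assert (Hp : (1 <= Nat.div p 2)%nat) by (pose proof (Nat.Div0.div_mod p 2);
      pose proof (Nat.mod_upper_bound p 2); lia).
    replace (S (Nat.div p 2 - 1)) with (Nat.div p 2) by lia.
    apply (hypotenuse_section K x _ _ 1); auto.
    + unfold cc_interval, sym_interval. intros u Hu.
      pose proof (Hscale u _ eq_refl) as E. nra.
    + apply (kernel_section_regular f K x p _ c eps 1); auto; [lra|].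
      apply derivative_rate_closed.
  - apply (q_regular_open x q H); auto. intros d Hd.
    replace (S (p - 1)) with p by lia.
    (* The maximum only keeps [rho] positive when [d >= x / 2], where no [u] is
       left. *)
    set (rho := Rmax (1 / 2) (1 - 2 * d / x)).
    assert (Hrho : 0 < rho < 1).
    { split; [apply Rlt_le_trans with (1 / 2); [lra|apply Rmax_l]|].
      apply Rmax_lub_lt; [lra|]. assert (0 < 2 * d / x) by (apply Rdiv_lt_0_compat; lra). lra. }
    apply (hypotenuse_section K x _ _ rho); auto.
    + unfold sym_interval. intros u Hu.
      pose proof (Hscale u _ eq_refl) as E.
      assert (R1 : 1 - 2 * d / x <= rho) by apply Rmax_r.
      assert (E2 : x * (1 - 2 * d / x) = x - 2 * d) by (field; lra).
      split; apply Rmult_le_reg_l with x; auto; nra.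
    + apply (kernel_section_regular f K x p _ c eps rho); auto; [lra|].
      now apply derivative_rate_interior.
Qed.
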